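(* For $i\in\{1,2\}$ let $G_i$ be a finite graph on $n_i$ vertices and let $k_i$ be a natural number. Then $\mathcal{B}_{\geq k_1}(G_1)\cong\mathcal{B}_{\geq k_2}(G_2)$ if and only if there is a $j\in\{1,\dots,8\}$ such that condition $j$ below holds for both $i=1$ and $i=2$: (1) $k_i>n_i$. (2) $k_i=n_i$, or ($k_i\le n_i$ and $G_i$ is a complete graph). (3) $G_1^{\mathrm{claw}}\cong G_2^{\mathrm{claw}}$ and $k_i=n_i-1$. (4) $G_1'\cong G_2'$, $\chi(G_i)+1\le k_i\le n_i-2$, and $n_1-k_1=n_2-k_2$. (5) $G_1'\cong G_2'$ and $k_i\le\chi(G_i)$. (6) $k_i\le n_i-1$ and $G_i'\cong K_{N_i-1}+K_1$, where $N_i$ is the number of vertices of $\mathcal{B}_{\geq k_i}(G_i)$. (7) ($k_i\le n_i-1$ and $G_i'\cong K_3+K_1$), or ($k_i=n_i-1$ and $G_i'\cong\overline{K_3}$). (8) ($k_i\le n_i-2$ and $G_i'\cong\overline{K_3}$), or ($k_i=n_i-1$ and $G_i'\cong P_3+K_1$).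
   Context: All graphs are finite and simple; $\chi$ is the chromatic number; $K_s$ and $P_s$ are the complete graph and path on $s$ vertices, $H_1+H_2$ is disjoint union, $\overline{H}$ is the complement. A vertex of $G$ is universal if it has degree $|V(G)|-1$; $G'$ is the graph obtained from $G$ by removing all universal vertices. $G^{\mathrm{claw}}$ is the graph whose complement is obtained from $\overline{G}$ by deleting all isolated vertices and replacing every connected component isomorphic to a triangle $K_3$ by a component isomorphic to the claw $K_{1,3}$ (with the three triangle vertices as the leaves and a new centre vertex). An independent set partition of $G$ is a partition of $V(G)$ into nonempty independent sets (parts). For such a partition $P$ and $v\in V(G)$, let $P-v$ be the partition of $V(G)\setminus\{v\}$ obtained by deleting $v$ from its part (discarding that part if empty). The Bell colouring graph $\mathcal{B}(G)$ has as vertices the independent set partitions of $G$, with $P\neq Q$ adjacent iff $P-v=Q-v$ for some $v\in V(G)$; $\mathcal{B}_{\geq k}(G)$ is its induced subgraph on partitions with at least $k$ parts.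
   Formalization: Condition (6) is taken with N_1 = N_2; as written it fails: G_1=K_2+K_1, k_1=2 (N_1=3) and G_2=K_3+K_1, k_2=3 (N_2=4) both satisfy (6), yet the Bell graphs are K_3 and K_4. *)

(* Defs.v *)
From HB Require Import structures.
From mathcomp Require Import all_boot.

Set Implicit Arguments.
Unset Strict Implicit.
Unset Printing Implicit Defensive.

Record sgraph := SGraph {
  svertex :> finType;
  sedge : rel svertex;
  sg_sym : symmetric sedge;
  sg_irrefl : irreflexive sedge }.

Notation "x -- y" := (sedge x y) (at level 30, no associativity).

(* Boolean so that it can be used to define subtypes; see isoP. *)
Definition iso (G H : sgraph) : bool :=
  [exists f : {ffun G -> H},
     [&& injectiveb f, [forall y, y \in codom f]
       & [forall x, forall y, (f x -- f y) == (x -- y)]]].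

Notation "G ~= H" := (iso G H) (at level 70, no associativity).

Lemma isoP (G H : sgraph) :
  reflect (exists f : G -> H,
             bijective f /\ forall x y, (f x -- f y) = (x -- y))
          (G ~= H).
Proof.
apply: (iffP existsP) => [[f /and3P[/injectiveP fI /forallP fS /forallP fE]]|].
  exists f; split=> [|x y]; last by move/forallP/(_ y)/eqP: (fE x).
  exists (fun y => iinv (fS y)) => [x|y]; last exact: f_iinv.
  by apply: fI; rewrite f_iinv.
case=> f [fB fE]; exists [ffun x => f x]; apply/and3P; split.
- by apply/injectiveP => x y; rewrite !ffunE; apply: bij_inj.
- have [g fK gK] := fB; apply/forallP => y; apply/codomP; exists (g y).
  by rewrite ffunE gK.
- by apply/forallP => x; apply/forallP => y; rewrite !ffunE fE.
Qed.

Lemma induced_sym (G : sgraph) (A : {set G}) :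
  symmetric (fun x y : {x : G | x \in A} => val x -- val y).
Proof. by move=> x y; apply: sg_sym. Qed.

Lemma induced_irrefl (G : sgraph) (A : {set G}) :
  irreflexive (fun x y : {x : G | x \in A} => val x -- val y).
Proof. by move=> x; apply: sg_irrefl. Qed.

Definition induced (G : sgraph) (A : {set G}) : sgraph :=
  SGraph (@induced_sym G A) (@induced_irrefl G A).

Lemma compl_sym (G : sgraph) :
  symmetric (fun x y : G => (x != y) && ~~ (x -- y)).
Proof. by move=> x y; rewrite eq_sym sg_sym. Qed.

Lemma compl_irrefl (G : sgraph) :
  irreflexive (fun x y : G => (x != y) && ~~ (x -- y)).
Proof. by move=> x; rewrite eqxx. Qed.

Definition compl (G : sgraph) : sgraph :=
  SGraph (@compl_sym G) (@compl_irrefl G).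

Definition dunion_rel (G H : sgraph) : rel (G + H) := fun u v =>
  match u, v with
  | inl x, inl y => x -- y
  | inr x, inr y => x -- y
  | _, _ => false
  end.

Lemma dunion_sym (G H : sgraph) : symmetric (@dunion_rel G H).
Proof. by move=> [x|x] [y|y] //=; apply: sg_sym. Qed.

Lemma dunion_irrefl (G H : sgraph) : irreflexive (@dunion_rel G H).
Proof. by move=> [x|x] /=; apply: sg_irrefl. Qed.

Definition dunion (G H : sgraph) : sgraph :=
  SGraph (@dunion_sym G H) (@dunion_irrefl G H).

Lemma complete_sym n : symmetric (fun i j : 'I_n => i != j).
Proof. by move=> i j; rewrite eq_sym. Qed.

Lemma complete_irrefl n : irreflexive (fun i j : 'I_n => i != j).
Proof. by move=> i; rewrite eqxx. Qed.

Definition complete n : sgraph :=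
  SGraph (@complete_sym n) (@complete_irrefl n).

Lemma path_sym n :
  symmetric (fun i j : 'I_n => (i.+1 == j :> nat) || (j.+1 == i :> nat)).
Proof. by move=> i j; rewrite orbC. Qed.

Lemma path_irrefl n :
  irreflexive (fun i j : 'I_n => (i.+1 == j :> nat) || (j.+1 == i :> nat)).
Proof. by move=> i; rewrite orbb -[X in _ == X]addn0 -addn1 eqn_add2l. Qed.

Definition path_graph n : sgraph :=
  SGraph (@path_sym n) (@path_irrefl n).

Section Invariants.
Variable G : sgraph.

Definition is_complete : bool := [forall x : G, forall y : G, (x != y) ==> (x -- y)].

Definition colourable (k : nat) : bool :=
  [exists c : {ffun G -> 'I_k},
     [forall x, forall y, (x -- y) ==> (c x != c y)]].

Lemma colourable_card : exists k, colourable k.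
Proof.
exists #|G|; apply/existsP; exists [ffun x => enum_rank x].
apply/forallP => x; apply/forallP => y; apply/implyP => xy; rewrite !ffunE.
by apply: contraTneq xy => /enum_rank_inj ->; rewrite sg_irrefl.
Qed.

Definition chi : nat := ex_minn colourable_card.

Definition degree (x : G) : nat := #|[set y : G | x -- y]|.

Definition universal (x : G) : bool := degree x == #|G|.-1.

Definition del_universal : sgraph := induced [set x : G | ~~ universal x].

Definition component (C : {set G}) : bool :=
  C \in equivalence_partition (connect (@sedge G)) [set: G].

Definition triangle_component (C : {set G}) : bool :=
  component C && (induced C ~= complete 3).

(* Operation on the complement graph: drop isolated vertices and replace each
   triangle component by a claw.
   inl: the non-isolated vertices of G; inr: the new centre attached to each
   triangle component. *)
Definition claw_vertex : finType :=
  ({x : G | 0 < degree x} + {C : {set G} | triangle_component C})%type.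

Definition claw_rel : rel claw_vertex := fun u v =>
  match u, v with
  | inl x, inl y =>
      (val x -- val y) &&
      ~~ [exists C : {set G},
            [&& triangle_component C, val x \in C & val y \in C]]
  | inl x, inr C => val x \in val C
  | inr C, inl x => val x \in val C
  | inr _, inr _ => false
  end.

Lemma claw_sym : symmetric claw_rel.
Proof.
move=> [x|C] [y|D] //=; rewrite sg_sym; congr (_ && ~~ _).
by apply: eq_existsb => C; rewrite [_ && (val y \in C)]andbC.
Qed.

Lemma claw_irrefl : irreflexive claw_rel.
Proof. by move=> [x|C] //=; rewrite sg_irrefl. Qed.

Definition triangles_to_claws : sgraph := SGraph claw_sym claw_irrefl.

Definition independent (A : {set G}) : bool :=
  [forall x in A, forall y in A, ~~ (x -- y)].

(* finset's [partition] excludes the empty block. *)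
Definition indep_partition (P : {set {set G}}) : bool :=
  partition P [set: G] && [forall A in P, independent A].

Definition part_del (P : {set {set G}}) (v : G) : {set {set G}} :=
  [set A :\ v | A in P] :\ set0.

Definition bell_rel : rel {P : {set {set G}} | indep_partition P} := fun P Q =>
  (P != Q) && [exists v : G, part_del (val P) v == part_del (val Q) v].

Lemma bell_sym : symmetric bell_rel.
Proof.
move=> P Q; rewrite /bell_rel eq_sym; congr (_ && _).
by apply: eq_existsb => v; rewrite eq_sym.
Qed.

Lemma bell_irrefl : irreflexive bell_rel.
Proof. by move=> P; rewrite /bell_rel eqxx. Qed.

Definition bell : sgraph := SGraph bell_sym bell_irrefl.

Definition bell_geq (k : nat) : sgraph :=
  induced [set P : bell | k <= #|val P|].

End Invariants.

(* G^claw; the claws are created in the complement. *)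
Definition claw_graph (G : sgraph) : sgraph :=
  compl (triangles_to_claws (compl G)).

(* Main.v *)
(** Let H be the complement of G.  An independent set partition of G is a clique
    partition of H, and we see it as the equivalence relation "same part" on
    V(G): two partitions are adjacent iff the relations agree off one vertex, and
    the neighbours of the finest partition are the edges of H, with the
    adjacency of the line graph L(H).

    Around the finest partition nonadjacent neighbours have exactly one common
    neighbour that is not adjacent to it, and a vertex at distance two is either
    a triangle or a two-edge matching of H.  When k <= n - 2, the image Q of the
    finest partition under an isomorphism has the same local properties.  These
    force the parts of Q to have size at most three, the parts of size three to
    be components of H, and the parts of size two to be the centres of double
    stars; hence the neighbourhood of Q is again isomorphic to L(H), by the map
    [tau], and triangles of L(H) that come from triangles of H can be told from
    those that come from stars.  A line graph isomorphism which respects this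
    distinction comes from an isomorphism of the graphs induced by the
    nonisolated vertices (Whitney), that is, from G_1' to G_2'; the parameters
    are then recovered by counting partitions.

    When k = n - 1 the finest partition is adjacent to all others, so that only
    L(H) is left; replacing triangle components by claws does not change L(H)
    and makes it determine the nonisolated part of H.  The remaining coincidences
    involve some k <= n - 2 for which a partition is adjacent to all others,
    which happens only when H is a star or a triangle up to isolated vertices. *)

Require Import Defs.
From mathcomp Require Import all_boot.
From mathcomp Require Import zify.

Set Implicit Arguments.
Unset Strict Implicit.
Unset Printing Implicit Defensive.

(** * Equivalence relations and their classes *)

(** The lower bound [k] is the obstacle that shapes the argument at [Q]. Splitting a part is always
    allowed, while joining two parts loses a class and may fall below [k]. The finest partition has
    [n - k >= 2] classes to spare, but its image [Q] may have exactly [k] or [k + 1] parts, and then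
    the partitions that would serve as witnesses do not exist. In that case another nontrivial part
    of [Q] is split first to make room, and the additional common neighbours that this admits have
    to be controlled.

    For [k = n - 1] nothing distinguishes triangles from stars in L(H), and a line graph isomorphism
    may exchange them. It is corrected by exchanging two opposite edges on four vertices; the number
    of wrongly mapped triples drops each time. Only triangle components resist, which is why they
    are replaced by claws. *)

Section Relations.
Variable V : finType.
Implicit Types (r q : rel V) (v w x y : V).

Definition eqv r := [/\ reflexive r, symmetric r & transitive r].

Definition agree_off v r q :=
  forall x y, x != v -> y != v -> r x y = q x y.

Definition single r v := [forall y, r v y ==> (y == v)].

Lemma singleP r v : reflect (forall y, r v y -> y = v) (single r v).
Proof.
apply: (iffP forallP) => [s y ry|s y].
  by apply/eqP; apply: (implyP (s y)).
by apply/implyP => ry; apply/eqP/s.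
Qed.

Lemma nsingleP r v : reflect (exists2 y, y != v & r v y) (~~ single r v).
Proof.
rewrite negb_forall; apply: (iffP existsP) => [[y]|[y yv ry]].
  by rewrite negb_imply => /andP[ry yv]; exists y.
by exists y; rewrite negb_imply ry.
Qed.

Definition classes r : nat := #|equivalence_partition r [set: V]|.

Lemma classes_ext r q : r =2 q -> classes r = classes q.
Proof.
move=> e; rewrite /classes /equivalence_partition; congr #|pred_of_set _|.
apply: eq_imset => x; apply/setP => y; by rewrite !inE e.
Qed.

Lemma eqv_equivalence r : eqv r -> {in [set: V] & &, equivalence_rel r}.
Proof.
case=> rr rs rt x y z _ _ _; split=> // xy; apply/idP/idP; apply: rt => //.
by rewrite rs.
Qed.

Lemma eqv_class r : eqv r -> forall x y, r x y -> r x =1 r y.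
Proof.
case=> rr rs rt x y xy z; apply/idP/idP; apply: rt => //.
by rewrite rs.
Qed.

(** Deleting [v] keeps distinct classes distinct and nonempty, except that a class [{v}] disappears.
    The first summand therefore depends only on [r] off [v]. *)
Lemma classes_off r v : eqv r ->
  classes r = #|[set [set y | (y != v) && r x y] | x in [set~ v]]| + single r v.
Proof.
move=> er; have [rr rs rt] := er.
have eC : classes r = #|[set [set y | r x y] | x in [set: V]]|.
  rewrite /classes /equivalence_partition; congr #|pred_of_set _|.
  by apply: eq_imset => x; apply/setP => y; rewrite !inE.
rewrite eC; case: (boolP (single r v)) => [/singleP sv|/nsingleP[u uv rvu]].
  have -> : [set [set y | r x y] | x in [set: V]] =
     [set v] |: [set [set y | (y != v) && r x y] | x in [set~ v]].
    apply/setP => A; apply/imsetP/setU1P => [[x _ ->]|[->|/imsetP[x]]].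
    - have [->|xv] := eqVneq x v; [left|right].
        apply/setP => y; rewrite !inE; apply/idP/eqP => [/sv|->] //.
      apply/imsetP; exists x; first by rewrite !inE.
      apply/setP => y; rewrite !inE; have [->|//] := eqVneq y v.
      by apply: contra_neqF xv; rewrite rs => /sv.
    - exists v => //; apply/setP => y; rewrite !inE.
      by apply/eqP/idP => [->|/sv].
    rewrite !inE => xv ->; exists x => //; apply/setP => y; rewrite !inE.
    have [->|//] := eqVneq y v.
    by symmetry; apply: contra_neqF xv; rewrite rs => /sv.
  rewrite cardsU1 addnC; congr (_ + _).
  suff -> : [set v] \notin [set [set y | (y != v) && r x y] | x in [set~ v]] by [].
  apply/imsetP => -[x _ /setP/(_ v)]; by rewrite !inE !eqxx.
rewrite addn0.
have -> : [set [set y | r x y] | x in [set: V]] = [set [set y | r x y] | x in [set~ v]].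
  apply/setP => A; apply/imsetP/imsetP => [[x _ ->]|[x _ ->]]; last by exists x.
  have [->|xv] := eqVneq x v; last by exists x; rewrite ?inE.
  exists u; rewrite ?inE //; apply/setP => y; rewrite !inE; exact: eqv_class.
have -> : [set [set y | (y != v) && r x y] | x in [set~ v]] =
   [set A :\ v | A in [set [set y | r x y] | x in [set~ v]]].
  rewrite -imset_comp; apply: eq_imset => x; apply/setP => y /=; by rewrite !inE.
(* A class is recovered from its trace off [v] because it contains some [x] other than [v]. *)
rewrite [RHS]card_in_imset // => A B /imsetP[x + ->] /imsetP[y + ->].
rewrite !inE => xv yv /setP/(_ x); rewrite !inE xv rr /= => /esym ryx.
by apply/setP => z; rewrite !inE; apply/esym/(eqv_class er).
Qed.

(** Changing the place of [v] affects the count only through [v] becoming or ceasing to be a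
    singleton; the additive form avoids truncated subtraction. *)
Lemma classes_move r q v : eqv r -> eqv q -> agree_off v r q ->
  classes r + single q v = classes q + single r v.
Proof.
move=> er eq_ a; rewrite !(classes_off v) //.
rewrite addnAC; congr (_ + _ + _); congr #|pred_of_set _|.
apply: eq_in_imset => x; rewrite !inE => xv; apply/setP => y; rewrite !inE.
by have [->|yv] //= := eqVneq y v; apply: a.
Qed.

Lemma eqv_eq : eqv (@eq_op V).
Proof.
by split=> [x|x y|y x z]; [exact: eqxx|exact: eq_sym|move=> /eqP->].
Qed.

Lemma classes_eq : classes (@eq_op V) = #|V|.
Proof.
rewrite /classes /equivalence_partition card_in_imset ?cardsT //.
move=> x y _ _ /setP/(_ x); rewrite !inE eqxx => /esym/eqP //.
Qed.

Lemma classes_le r : eqv r -> classes r <= #|V|.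
Proof.
move=> er; rewrite /classes /equivalence_partition -cardsT; exact: leq_imset_card.
Qed.

(* [mv r v w] moves v into the class of w; it isolates v when w = v. *)
Definition mv r v w : rel V := fun x y =>
  if x == v then (y == v) || (w != v) && r w y
  else if y == v then (w != v) && r w x else r x y.

Lemma mv_off r v w : agree_off v (mv r v w) r.
Proof. by move=> x y xv yv; rewrite /mv (negPf xv) (negPf yv). Qed.

Lemma eqv_mv r v w : eqv r -> eqv (mv r v w).
Proof.
move=> er; have [rr rs rt] := er; split=> [x|x y|y x z]; rewrite /mv.
- by case: eqP => // _; apply: rr.
- by case: eqP => [->|/eqP xv]; case: eqP => //= _; apply: rs.
case: (eqVneq x v) => xv; case: (eqVneq y v) => yv;
  case: (eqVneq z v) => zv //=; subst.
- move=> /andP[-> wy] /=; exact: rt.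
- move=> /andP[_ wx] /andP[_ wz]; apply: rt wz; by rewrite rs.
- move=> xy /andP[-> wy] /=; apply: rt wy _; by rewrite rs.
- exact: rt.
Qed.

Lemma single_mv r v w : eqv r -> single (mv r v w) v = (w == v).
Proof.
case=> rr rs rt; apply/singleP/eqP => [s|->].
  case: (eqVneq w v) => // wv; apply: s; by rewrite /mv eqxx (negPf wv) rr.
by move=> y; rewrite /mv !eqxx /= orbF => /eqP.
Qed.

Lemma classes_mv r v w : eqv r ->
  classes (mv r v w) + single r v = classes r + (w == v).
Proof.
move=> er; rewrite -(single_mv v w er).
apply: classes_move => //; [exact: eqv_mv|exact: mv_off].
Qed.

End Relations.

(** * Vertices of the Bell colouring graph as equivalence relations *)

Definition nonedge (G : sgraph) : rel G := @sedge (compl G).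
Arguments nonedge G x y : simpl never.

Section Bell.
Variables (G : sgraph) (k : nat).
Local Notation h := (@nonedge G).
Local Notation B := (bell_geq G k).
Implicit Types (P Q : B) (v w x y : G).

Definition rl P : rel G := fun x y => y \in pblock (val (val P)) x.

Lemma rl_partition P : partition (val (val P)) [set: G].
Proof. by have /andP[] := valP (val P). Qed.

Lemma rl_eqv P : eqv (rl P).
Proof.
have /and3P[/eqP cov tr _] := rl_partition P.
have eq_ x y : rl P x y = (pblock (val (val P)) x == pblock (val (val P)) y).
  by rewrite /rl -eq_pblock ?cov ?inE.
split=> [x|x y|y x z]; rewrite !eq_ ?eqxx //.
by move=> /eqP-> /eqP->.
Qed.

Lemma rl_refl P x : rl P x x. Proof. by case: (rl_eqv P). Qed.
Lemma rl_sym P x y : rl P x y = rl P y x. Proof. by case: (rl_eqv P). Qed.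
Lemma rl_trans P : transitive (rl P). Proof. by case: (rl_eqv P). Qed.

Lemma rl_parts P : equivalence_partition (rl P) [set: G] = val (val P).
Proof. exact: equivalence_partition_pblock (rl_partition P). Qed.

Lemma rl_classes P : #|val (val P)| = classes (rl P).
Proof. by rewrite -rl_parts. Qed.

Lemma rl_ge P : k <= classes (rl P).
Proof. by rewrite -rl_classes; have := valP P; rewrite inE. Qed.

Lemma rl_inj P Q : rl P =2 rl Q -> P = Q.
Proof.
move=> e; apply/val_inj/val_inj; rewrite -!rl_parts /=.
apply: eq_imset => x; apply/setP => y; by rewrite !inE e.
Qed.

Lemma rl_h P x y : rl P x y -> x != y -> h x y.
Proof.
move=> xy nxy; rewrite /nonedge /= nxy /=.
have /andP[/and3P[/eqP cov tr _] /forall_inP ind] := valP (val P).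
have xb : pblock (val (val P)) x \in val (val P) by rewrite pblock_mem // cov inE.
have /forall_inP/(_ x)/[!mem_pblock]/[!cov]/[!inE]/(_ isT) := ind _ xb.
by move/forall_inP/(_ y); apply.
Qed.

Lemma rl_mk (r : rel G) : eqv r -> (forall x y, r x y -> x != y -> h x y) ->
  k <= classes r -> exists P, rl P =2 r.
Proof.
move=> er rh kr; have part := equivalence_partitionP (eqv_equivalence er).
have [rr rs rt] := er.
have ind : indep_partition (equivalence_partition r [set: G]).
  rewrite /indep_partition part /=; apply/forall_inP => A /imsetP[x _ ->].
  apply/forall_inP => y; rewrite !inE => /andP[_ xy].
  apply/forall_inP => z; rewrite !inE => /andP[_ xz].
  have [->|yz] := eqVneq y z; first by rewrite sg_irrefl.
  have /rh/(_ yz) : r y z by apply: rt xz; rewrite rs.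
  by case/andP.
have mem : Sub (equivalence_partition r [set: G]) ind \in
    [set P : bell G | k <= #|val P|] by rewrite inE.
exists (Sub (Sub (equivalence_partition r [set: G]) ind) mem) => x y.
by rewrite /rl !SubK (pblock_equivalence_partition (eqv_equivalence er)) ?inE.
Qed.

Lemma part_del_rl P v : part_del (val (val P)) v =
  [set [set y | (y != v) && rl P x y] | x in [set~ v]].
Proof.
rewrite /part_del -(rl_parts P).
have [rr rs rt] := rl_eqv P.
apply/setP => A; rewrite !inE; apply/andP/imsetP.
  case=> A0 /imsetP[C /imsetP[x _ ->] eA].
  move: A0; rewrite eA => /set0Pn[y]; rewrite !inE => /andP[yv xy].
  exists y; rewrite ?inE //; apply/setP => z; rewrite !inE.
  by congr (_ && _); apply: eqv_class (rl_eqv P) _ _ _ _.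
case=> x; rewrite !inE => xv ->; split.
  by apply/set0Pn; exists x; rewrite !inE xv rr.
apply/imsetP; exists [set y in [set: G] | rl P x y]; first by apply/imsetP; exists x.
by apply/setP => z; rewrite !inE.
Qed.

(** From here on adjacency is a statement about relations: a step in the Bell graph changes only
    pairs through one vertex. *)
Lemma part_del_agree P Q v :
  (part_del (val (val P)) v = part_del (val (val Q)) v) <->
  agree_off v (rl P) (rl Q).
Proof.
rewrite !part_del_rl; split=> [e x y xv yv|a].
  suff D (R S : B) : [set [set y | (y != v) && rl R x y] | x in [set~ v]] =
    [set [set y | (y != v) && rl S x y] | x in [set~ v]] ->
    rl R x y -> rl S x y by apply/idP/idP; apply: D.
  move=> {}e xy.
  have : [set y | (y != v) && rl R x y] \in
    [set [set y | (y != v) && rl R x y] | x in [set~ v]].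
    by apply/imsetP; exists x; rewrite ?inE.
  rewrite e => /imsetP[z _ /setP ez].
  have := ez y; have := ez x; rewrite !inE xv yv xy rl_refl /= => /esym zx /esym zy.
  by rewrite rl_sym in zx; apply: rl_trans zy.
apply: eq_in_imset => x; rewrite !inE => xv; apply/setP => y; rewrite !inE.
by have [->|yv] //= := eqVneq y v; apply: a.
Qed.

Lemma adjP P Q : reflect (P <> Q /\ exists v, agree_off v (rl P) (rl Q)) (P -- Q).
Proof.
apply: (iffP andP); rewrite val_eqE.
  case=> /eqP PQ /existsP[v /eqP/part_del_agree a]; split=> //; by exists v.
case=> PQ [v /part_del_agree a]; split; first exact/eqP.
by apply/existsP; exists v; apply/eqP.
Qed.

End Bell.

Ltac neqx := match goal with H : ?a <> ?a |- _ => case (H erefl) end.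

Ltac prep := repeat match goal with
  | H : is_true (?a != ?b) |- _ => move/eqP: H => H
  | H : (?a == ?b) = false |- _ => move/eqP: H => H
  | H : is_true (?a == ?b) |- _ => move/eqP: H => H
  end; try subst; try neqx.

(** Most verifications compare explicit Boolean formulas in equalities between named vertices. The
    tactic splits on each equality between variables and discards the cases excluded by known
    disequalities. *)
Ltac deq := prep; repeat (match goal with
  |- context [?a == ?b] => is_var a; is_var b; case: (a =P b) => ? end; try subst; try neqx);
  rewrite ?andbF ?orbT ?orbF ?andbT //=.

(** This relation and the next two have as nontrivial classes an edge, a matching of two edges and a
    triangle. [e2rel] is meant for disjoint pairs; for two edges sharing one vertex it is not
    transitive. *)
Definition erel (V : finType) (a b : V) : rel V := fun x y =>
  [|| x == y, (x == a) && (y == b) | (x == b) && (y == a)].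

Definition e2rel (V : finType) (a b c d : V) : rel V := fun x y =>
  erel a b x y || erel c d x y.

Definition trel (V : finType) (a b c : V) : rel V := fun x y =>
  (x == y) || [|| x == a, x == b | x == c] && [|| y == a, y == b | y == c].

Section BellAdjacency.
Variables (G : sgraph) (k : nat).
Local Notation h := (@nonedge G).
Local Notation B := (bell_geq G k).
Implicit Types (P Q W X Y Z : B) (v w x y : G).

Lemma h_sym x y : h x y = h y x. Proof. exact: (sg_sym (s := compl G)). Qed.
Lemma h_irr x : h x x = false. Proof. exact: (sg_irrefl (s := compl G)). Qed.
Lemma h_neq x y : h x y -> x != y.
Proof. by apply: contraTneq => ->; rewrite h_irr. Qed.

(** The move loses a class only if [v] was a singleton and is put with another vertex; only then
    must [P] have a class to spare. *)
Lemma rl_mv P v w :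
  (w != v -> forall y, y != v -> rl P w y -> h v y) ->
  [|| w == v, ~~ single (rl P) v | k < classes (rl P)] ->
  exists Q, rl Q =2 mv (rl P) v w /\
    classes (rl Q) + single (rl P) v = classes (rl P) + (w == v).
Proof.
move=> hv kP; have cl := classes_mv v w (rl_eqv P).
have [||Q eQ] := @rl_mk G k (mv (rl P) v w) (eqv_mv v w (rl_eqv P)).
- move=> x y; rewrite /mv; case: eqP => [->|/eqP xv].
    case: eqP => [->|/eqP yv] /=; first by rewrite eqxx.
    by move=> /andP[wv wy] _; apply: hv.
  case: eqP => [->|/eqP yv]; last exact: rl_h.
  by move=> /andP[wv wy] _; rewrite h_sym; apply: hv.
- have := rl_ge P; move: kP cl; case: (w == v); case: single => /=; lia.
by exists Q; split=> //; rewrite -(classes_ext eQ) // in cl.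
Qed.

Lemma adj_off P Q v x y :
  agree_off v (rl P) (rl Q) -> rl P x y != rl Q x y -> P -- Q.
Proof.
move=> a d; apply/adjP; split; last by exists v.
by move=> e; rewrite e eqxx in d.
Qed.

Lemma adj_neq P Q : P -- Q -> P <> Q.
Proof. by move/adjP => []. Qed.

(** The pairs on which adjacent partitions differ form a star. Hence two disjoint pairs ([nadj2]) or
    the three sides of a triangle ([nadj3]) certify nonadjacency; these are the only obstructions to
    a common vertex. *)
Lemma adj_cover P Q : P -- Q ->
  exists v, forall x y, rl P x y != rl Q x y -> x = v \/ y = v.
Proof.
move=> /adjP[_ [v a]]; exists v => x y.
case: (eqVneq x v) => [|xv]; first by left.
case: (eqVneq y v) => [|yv]; first by right.
by rewrite a // eqxx.
Qed.

Lemma nadj2 P Q a b c d :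
  rl P a b != rl Q a b -> rl P c d != rl Q c d ->
  a <> c -> a <> d -> b <> c -> b <> d -> ~~ (P -- Q).
Proof.
move=> ab cd ac ad bc bd; apply/negP => /adj_cover[v cv].
by case: (cv _ _ ab) (cv _ _ cd) => [] ? []; congruence.
Qed.

Lemma nadj3 P Q a b c :
  rl P a b != rl Q a b -> rl P b c != rl Q b c -> rl P a c != rl Q a c ->
  a <> b -> b <> c -> a <> c -> ~~ (P -- Q).
Proof.
move=> ab bc ac nab nbc nac; apply/negP => /adj_cover[v cv].
by case: (cv _ _ ab) (cv _ _ bc) (cv _ _ ac) => [] ? [] ? []; congruence.
Qed.

Lemma rl_neq P Q x y : rl P x y != rl Q x y -> P <> Q.
Proof. by move=> + e; rewrite e eqxx. Qed.

Lemma rl_agree P Q v : agree_off v (rl P) (rl Q) ->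
  (forall x, x != v -> rl P v x = rl Q v x) -> P = Q.
Proof.
move=> a e; apply: rl_inj => x y.
case: (eqVneq x v) => [->|xv].
  by case: (eqVneq y v) => [->|yv]; rewrite ?rl_refl ?e.
case: (eqVneq y v) => [->|yv]; last exact: a.
by rewrite rl_sym e // rl_sym.
Qed.

Definition is_zero P := rl P =2 eq_op.

Lemma zero_ex : k <= #|G| -> exists P, is_zero P.
Proof.
move=> kn; apply: rl_mk; rewrite ?classes_eq //; first exact: eqv_eq.
by move=> x y ->.
Qed.

Lemma zero_classes P : is_zero P -> classes (rl P) = #|G|.
Proof. by move=> z; rewrite (classes_ext z) classes_eq. Qed.

Lemma single_eq v : single (@eq_op G) v.
Proof. by apply/singleP => y /eqP. Qed.

Lemma single_ext (r q : rel G) v : r =2 q -> single r v = single q v.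
Proof. by move=> e; apply: eq_forallb => y; rewrite e. Qed.

Lemma edge_ex a b : k + 1 <= #|G| -> h a b ->
  exists X, rl X =2 erel a b /\ classes (rl X) + 1 = #|G|.
Proof.
move=> kn ab; have [|O zO] := zero_ex; first lia.
have nab := h_neq ab.
have [||X [eX cX]] := @rl_mv O a b.
- by move=> _ y ya; rewrite zO => /eqP <-.
- by rewrite (zero_classes zO); apply/or3P/Or33; lia.
exists X; split.
  move=> x y; rewrite eX /mv /erel !zO.
  by deq.
move: cX; rewrite (zero_classes zO) (single_ext _ zO) single_eq.
by rewrite eq_sym (negPf nab) addn0.
Qed.

(** Off the moved vertex [v] the relation is equality, so the class of [v] contains at most one
    further vertex [u]. If there is none, nothing has changed; otherwise [vu] is the edge. *)
Lemma zero_adjP O X : is_zero O ->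
  reflect (exists a b, h a b /\ rl X =2 erel a b) (O -- X).
Proof.
move=> zO; apply: (iffP idP) => [/adjP[OX [v a]]|[a [b [ab eX]]]].
  have [/singleP sv|/nsingleP[u uv vu]] := boolP (single (rl X) v).
    case: OX; apply: rl_agree a _ => x xv; rewrite zO eq_sym (negPf xv).
    by apply/esym/negP => /sv e; rewrite e eqxx in xv.
  exists v, u; split; first by apply: rl_h vu _; rewrite eq_sym.
  have vx x : x != v -> rl X v x = (x == u).
    move=> xv; apply/idP/eqP => [vx|->] //; apply/eqP.
    rewrite -zO a //; apply: rl_trans vu.
    by rewrite rl_sym.
  move=> x y; rewrite /erel; case: (eqVneq x v) => [->|xv].
    case: (eqVneq y v) => [->|yv]; first by rewrite rl_refl.
    by rewrite vx //; deq.
  case: (eqVneq y v) => [->|yv]; first by rewrite rl_sym vx //; deq.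
  by rewrite -a // zO; deq.
have nab := h_neq ab.
apply: (@adj_off _ _ a a b); last by rewrite zO eX /erel !eqxx (negPf nab) orbT.
by move=> x y xa ya; rewrite zO eX /erel; deq.
Qed.

(* A vertex at distance two from zero next to the edge ab is a triangle on ab
   or a matching {ab, cd}. *)
Lemma zero_dist2 O X W a b : is_zero O -> h a b -> rl X =2 erel a b ->
  W <> O -> ~~ (O -- W) -> X -- W ->
  (exists c, [/\ c != a, c != b & rl W =2 trel a b c]) \/
  (exists c d, [/\ h c d, (c != a) && (c != b), (d != a) && (d != b) & rl W =2 e2rel a b c d]).
Proof.
move=> zO ab eX WO nOW /adjP[XW [v ag]]; have nab := h_neq ab.
(* If [v] were an end of [ab], then [W] would agree with [O] off [v] and be adjacent to [O]. *)
have vab : (v != a) && (v != b).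
  rewrite -negb_or; apply/negP => vab; move/negP: nOW; apply.
  apply/adjP; split; first exact: nesym.
  exists v => x y xv yv; rewrite -ag // zO eX /erel.
  by case/orP: vab => /eqP e; rewrite -e (negPf xv) (negPf yv) ?andbF !orbF.
have /andP[va vb] := vab.
have [/singleP sv|/nsingleP[u uv vu]] := boolP (single (rl W) v).
  case: XW; apply: rl_agree ag _ => x xv; rewrite eX /erel.
  rewrite (negPf va) (negPf vb) orbF eq_sym (negPf xv).
  by apply/esym/negP => /sv e; rewrite e eqxx in xv.
have vx x : x != v -> rl W v x = rl W u x.
  by move=> xv; apply/idP/idP; apply: rl_trans; rewrite // rl_sym.
have ux x : x != v -> rl W u x = erel a b u x by move=> xv; rewrite -ag ?eX.
have W_off x y : x != v -> y != v -> rl W x y = erel a b x y.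
  by move=> xv yv; rewrite -ag ?eX.
have Wv x y : rl W x y = if x == v then (y == v) || erel a b u y
    else if y == v then erel a b u x else erel a b x y.
  case: (eqVneq x v) => [->|xv].
    by case: (eqVneq y v) => [->|yv]; rewrite ?rl_refl //= vx // ux.
  case: (eqVneq y v) => [->|yv]; first by rewrite rl_sym vx // ux.
  exact: W_off.
have [/orP uab|] := boolP ((u == a) || (u == b)).
  left; exists v; split=> // x y; rewrite Wv /erel /trel.
  by case: uab => /eqP eu; subst u; deq.
rewrite negb_or => /andP[ua ub]; right; exists v, u; split; rewrite ?ua //.
  by apply: rl_h vu _; rewrite eq_sym.
by move=> x y; rewrite Wv /e2rel /erel; deq.
Qed.

End BellAdjacency.

(** * Vertices locally similar to the finest partition *)

(* The graph-theoretic properties of the finest partition, seen from its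
   neighbourhood, that drive the reconstruction. *)
Record zero_like (B : sgraph) (Q : B) : Prop := ZeroLike {
  zl_ex : forall X Y, Q -- X -> Q -- Y -> X <> Y -> ~~ (X -- Y) ->
    exists W, [/\ X -- W, Y -- W, W <> Q & ~~ (Q -- W)];
  zl_un : forall X Y W W', Q -- X -> Q -- Y -> X <> Y -> ~~ (X -- Y) ->
    X -- W -> Y -- W -> W <> Q -> ~~ (Q -- W) ->
    X -- W' -> Y -- W' -> W' <> Q -> ~~ (Q -- W') -> W = W';
  zl_three : forall W X Y Z, W <> Q -> ~~ (Q -- W) ->
    Q -- X -> Q -- Y -> Q -- Z -> X -- W -> Y -- W -> Z -- W ->
    X <> Y -> X <> Z -> Y <> Z -> X -- Y;
  zl_more : forall W X, W <> Q -> ~~ (Q -- W) -> Q -- X -> X -- W ->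
    (exists Y, [/\ Q -- Y, Y -- W, Y <> X & ~~ (X -- Y)]) \/
    (exists Y Z, [/\ Q -- Y /\ Y -- W, Q -- Z /\ Z -- W, X -- Y, X -- Z & Y -- Z])
}.

Lemma zero_like_iso (B C : sgraph) (f : B -> C) (Q : B) :
  bijective f -> (forall x y, (f x -- f y) = (x -- y)) ->
  zero_like Q -> zero_like (f Q).
Proof.
case=> g fK gK fE [A1 A2 A3 A4].
have gE x y : (g x -- g y) = (x -- y) by rewrite -fE !gK.
have gQ x : (f Q -- x) = (Q -- g x) by rewrite -gE fK.
have gN x y : x <> y -> g x <> g y by move=> n /(can_inj gK).
have gNQ x : x <> f Q -> g x <> Q by move=> n e; apply: n; rewrite -e gK.
have fN x y : x <> y -> f x <> f y by move=> n /(can_inj fK).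
split.
- move=> X Y; rewrite !gQ => QX QY /gN XY nXY.
  have [|W [XW YW WQ nW]] := A1 _ _ QX QY XY; first by rewrite gE.
  exists (f W); rewrite gQ fK -(gK X) -(gK Y) !fE; split=> //; exact: fN.
- move=> X Y W W'; rewrite !gQ -!(gE X) -!(gE Y).
  move=> QX QY /gN XY nXY XW YW /gNQ WQ nW XW' YW' /gNQ WQ' nW'.
  apply: (can_inj gK); exact: (A2 (g X) (g Y)).
- move=> W X Y Z; rewrite !gQ -!(gE X) -!(gE Y) -!(gE Z).
  move=> /gNQ WQ nW QX QY QZ XW YW ZW /gN XY /gN XZ /gN YZ.
  exact: (A3 (g W) _ _ (g Z)).
move=> W X; rewrite !gQ -!(gE X) => /gNQ WQ nW QX XW.
case: (A4 (g W) (g X)) => // [[Y [QY YW YX nXY]]|[Y [Z [[QY YW] [QZ ZW] XY XZ YZ]]]].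
  left; exists (f Y); rewrite gQ -!gE fK; split=> // e; apply: YX.
  by rewrite -(fK Y) e.
by right; exists (f Y), (f Z); rewrite !gQ -!gE !fK.
Qed.

Section ZeroAxioms.
Variables (G : sgraph) (k : nat).
Local Notation h := (@nonedge G).
Local Notation B := (bell_geq G k).
Implicit Types (O W X Y Z : B) (a b c d x y : G).

Lemma erelC (V : finType) (a b : V) : erel a b =2 erel b a.
Proof. by move=> x y; rewrite /erel orbCA orbC -orbA orbCA orbC -orbA; deq. Qed.

Lemma edges_adj X Y a b c : rl X =2 erel a b -> rl Y =2 erel a c ->
  X <> Y -> X -- Y.
Proof.
move=> eX eY XY; apply/adjP; split=> //; exists a => x y xa ya.
by rewrite eX eY /erel (negPf xa) (negPf ya) /= !andbF.
Qed.

Lemma edges_eq X Y a b : rl X =2 erel a b -> rl Y =2 erel a b -> X = Y.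
Proof. by move=> eX eY; apply: rl_inj => x y; rewrite eX eY. Qed.

Lemma edges_nadj X Y a b c d : rl X =2 erel a b -> rl Y =2 erel c d ->
  h a b -> h c d -> X <> Y -> ~~ (X -- Y) ->
  ((c != a) && (c != b)) && ((d != a) && (d != b)).
Proof.
move=> eX eY ab cd XY nXY; apply/andP.
have eX' : rl X =2 erel b a by move=> x y; rewrite eX erelC.
have eY' : rl Y =2 erel d c by move=> x y; rewrite eY erelC.
split; apply/andP; split; apply/negP => /eqP e; subst; move/negP: nXY; apply.
- exact: edges_adj eX eY XY.
- exact: edges_adj eX' eY XY.
- exact: edges_adj eX eY' XY.
- exact: edges_adj eX' eY' XY.
Qed.

Lemma edge_in (V : finType) (a b : V) : erel a b a b.
Proof. by rewrite /erel !eqxx !orbT. Qed.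

Lemma zero_dist2_in O X W a b : is_zero O -> h a b -> rl X =2 erel a b ->
  W <> O -> ~~ (O -- W) -> X -- W -> rl W a b.
Proof.
move=> zO ab eX WO nW XW.
case: (zero_dist2 zO ab eX WO nW XW) => [[c [_ _ eW]]|[c [d [_ _ _ eW]]]].
  by rewrite eW /trel !eqxx !orbT.
by rewrite eW /e2rel edge_in.
Qed.

(** A triple containing [ab] cannot contain the disjoint pair [cd], so of the two shapes at distance
    two only the matching remains. *)
Lemma zero_dist2_matching O X Y W a b c d :
  is_zero O -> h a b -> h c d -> rl X =2 erel a b -> rl Y =2 erel c d ->
  X <> Y -> ~~ (X -- Y) -> W <> O -> ~~ (O -- W) -> X -- W -> Y -- W ->
  rl W =2 e2rel a b c d.
Proof.
move=> zO ab cd eX eY XY nXY WO nW XW YW.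
have Wcd := zero_dist2_in zO cd eY WO nW YW.
have := edges_nadj eX eY ab cd XY nXY => /and3P[/andP[ca cb] da db].
have ncd := h_neq cd; have nab := h_neq ab.
case: (zero_dist2 zO ab eX WO nW XW) => [[p [pa pb eW]]|[p [q [pq pab qab eW]]]].
  by move: Wcd; rewrite eW /trel; deq.
move=> x y; rewrite eW; move: Wcd; rewrite eW /e2rel /erel.
rewrite (negPf ncd) (negPf ca) (negPf cb) /=.
by case/orP=> /andP[/eqP-> /eqP->] //; congr (_ || (_ || _)); rewrite orbC.
Qed.

(** Nonadjacent neighbours of the finest partition are disjoint edges, and their matching is the
    vertex asked for by [zl_ex] and [zl_un]. A matching is next to its own two edges only, so three
    neighbours force a triangle ([zl_three]). Starting from one edge, a matching offers the other,
    disjoint edge and a triangle offers its other two sides ([zl_more]). *)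
Lemma zero_like_zero O : k + 2 <= #|G| -> is_zero O -> zero_like O.
Proof.
move=> kn zO; have kn1 : k + 1 <= #|G| by lia.
split.
- move=> X Y /(zero_adjP _ zO)[a [b [ab eX]]] /(zero_adjP _ zO)[c [d [cd eY]]].
  move=> XY nXY.
  have := edges_nadj eX eY ab cd XY nXY => /and3P[/andP[ca cb] da db].
  have ncd := h_neq cd; have nab := h_neq ab.
  have cX : classes (rl X) + 1 = #|G|.
    have [X' [eX' <-]] := edge_ex kn1 ab; by rewrite (edges_eq eX eX').
  (* [X] has [n - 1] classes; joining a second pair requires [k <= n - 2]. *)
  have [||W [eW _]] := @rl_mv G k X c d.
  + move=> _ y yc; rewrite eX /erel; have [<- //|_] := eqVneq d y.
    by rewrite (negPf da) (negPf db).
  + by apply/or3P/Or33; lia.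
  have We x y : rl W x y = e2rel a b c d x y.
    by rewrite eW /mv /e2rel !eX /erel; deq.
  exists W; split.
  + apply: (@adj_off G k _ _ c c d).
      by move=> x y xc yc; rewrite eX We /e2rel /erel; deq.
    by rewrite eX We /e2rel /erel; deq.
  + apply: (@adj_off G k _ _ a a b).
      by move=> x y xc yc; rewrite eY We /e2rel /erel; deq.
    by rewrite eY We /e2rel /erel; deq.
  + by apply: (@rl_neq G k _ _ a b); rewrite zO We /e2rel /erel; deq.
  + by apply: (@nadj2 G k _ _ a b c d); try (by apply/eqP; rewrite // eq_sym);
      rewrite zO We /e2rel /erel; deq.
- move=> X Y W W' /(zero_adjP _ zO)[a [b [ab eX]]] /(zero_adjP _ zO)[c [d [cd eY]]].
  move=> XY nXY XW YW WO nW XW' YW' WO' nW'; apply: rl_inj => x y.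
  rewrite (zero_dist2_matching zO ab cd eX eY XY nXY WO nW XW YW).
  by rewrite (zero_dist2_matching zO ab cd eX eY XY nXY WO' nW' XW' YW').
- move=> W X Y Z WO nW /(zero_adjP _ zO)[a [b [ab eX]]].
  move=> /(zero_adjP _ zO)[c [d [cd eY]]] /(zero_adjP _ zO)[e [f [ef eZ]]].
  move=> XW YW ZW XY XZ YZ; apply/negPn/negP => nXY.
  have eW := zero_dist2_matching zO ab cd eX eY XY nXY WO nW XW YW.
  have := zero_dist2_in zO ef eZ WO nW ZW; rewrite eW /e2rel /erel.
  rewrite (negPf (h_neq ef)) /= => /or3P[].
  + case/orP => /andP[/eqP ? /eqP ?]; subst; first exact: XZ (edges_eq eX eZ).
    by apply: XZ; apply: (edges_eq eX) => x y; rewrite eZ erelC.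
  + by move=> /andP[/eqP ? /eqP ?]; subst; exact: YZ (edges_eq eY eZ).
  + move=> /andP[/eqP ? /eqP ?]; subst.
    by apply: YZ; apply: (edges_eq eY) => x y; rewrite eZ erelC.
move=> W X WO nW /(zero_adjP _ zO)[a [b [ab eX]]] XW.
have nab := h_neq ab.
have OX : O -- X by apply/(zero_adjP _ zO); exists a, b.
case: (zero_dist2 zO ab eX WO nW XW) => [[c [ca cb eW]]|[c [d [cd /andP[ca cb] /andP[da db]
  eW]]]].
  right.
  have ac : h a c by apply: (@rl_h G k W); rewrite ?eW /trel ?eqxx ?orbT // eq_sym.
  have bc : h b c by apply: (@rl_h G k W); rewrite ?eW /trel ?eqxx ?orbT // eq_sym.
  have [Y [eY _]] := edge_ex kn1 ac; have [Z [eZ _]] := edge_ex kn1 bc.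
  exists Y, Z; split; [split|split| | |].
  + by apply/(zero_adjP _ zO); exists a, c.
  + apply: (@adj_off G k _ _ b a b); last by rewrite eY eW /trel /erel; deq.
    by move=> x y xb yb; rewrite eY eW /trel /erel; deq.
  + by apply/(zero_adjP _ zO); exists b, c.
  + apply: (@adj_off G k _ _ a a b); last by rewrite eZ eW /trel /erel; deq.
    by move=> x y xb yb; rewrite eZ eW /trel /erel; deq.
  + by apply: (edges_adj eX eY); apply: (@rl_neq G k _ _ a b); rewrite eX eY /erel; deq.
  + apply: (@edges_adj _ _ b a c) => //; first by move=> x y; rewrite eX erelC.
    by apply: (@rl_neq G k _ _ a b); rewrite eX eZ /erel; deq.
  + apply: (@edges_adj _ _ c a b) => //; try (by move=> x y; rewrite ?eY ?eZ erelC).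
    by apply: (@rl_neq G k _ _ a c); rewrite eY eZ /erel; deq.
left; have ncd := h_neq cd; have [Y [eY _]] := edge_ex kn1 cd.
exists Y; split.
- by apply/(zero_adjP _ zO); exists c, d.
- apply: (@adj_off G k _ _ a a b); last by rewrite eY eW /e2rel /erel; deq.
  by move=> x y xb yb; rewrite eY eW /e2rel /erel; deq.
- by apply: (@rl_neq G k _ _ a b); rewrite eY eX /erel; deq.
by apply: (@nadj2 G k _ _ a b c d); try (by apply/eqP; rewrite // eq_sym);
  rewrite eX eY /erel; deq.
Qed.

End ZeroAxioms.

Ltac neqs := first [assumption | apply: nesym; assumption].

(** * Parts of a zero-like partition and the edges of H at them *)

Section Structure.
Variables (G : sgraph) (k : nat).
Local Notation h := (@nonedge G).
Local Notation B := (bell_geq G k).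
Implicit Types (P O W X Y Z : B) (a b c d u v x y : G).

(** Isolating a vertex never loses a class, so it needs no room above [k]; splits are therefore the
    safe witnesses in what follows. *)
Lemma out_ex P v : exists Y, rl Y =2 mv (rl P) v v /\
  classes (rl Y) + single (rl P) v = classes (rl P) + 1.
Proof.
have [||Y [eY cY]] := @rl_mv G k P v v; rewrite ?eqxx //.
by exists Y; rewrite cY eqxx.
Qed.

Lemma nsingle_of P a b : a <> b -> rl P a b -> single (rl P) a = false.
Proof. by move=> ab pab; apply/negbTE/nsingleP; exists b; rewrite // eq_sym; apply/eqP. Qed.

Lemma out_lt P Y v u : u <> v -> rl P v u -> rl Y =2 mv (rl P) v v ->
  k < classes (rl Y).
Proof.
move=> uv vu eY; have := classes_mv v v (rl_eqv P).
rewrite -(classes_ext eY) (nsingle_of (nesym uv) vu) eqxx addn0 => ->.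
by rewrite addn1 ltnS rl_ge.
Qed.

Lemma single_rl P c x : single (rl P) c -> rl P c x = (c == x).
Proof.
by move=> /singleP s; apply/idP/eqP => [/s|<-]; rewrite ?rl_refl.
Qed.

Lemma single_rlC P c x : single (rl P) c -> rl P x c = (c == x).
Proof. by rewrite rl_sym; apply: single_rl. Qed.

Variables (Q : B) (zQ : zero_like Q).
Local Notation q := (rl Q).

Lemma adj_move X v x y : rl X =2 mv q v y -> q v x != rl X v x -> Q -- X.
Proof.
move=> eX d; apply: (@adj_off G k Q X v v x) => //.
by move=> z t zv tv; rewrite eX mv_off.
Qed.

(** Let [X] isolate [a] and [X'] isolate [c]. If [ac] were an edge of H, isolating both vertices
    separately ([W]) and joining them to a pair of their own ([W']) would give two common neighbours
    away from [Q], against [zl_un]. The pairs [ab] and [cd] may lie in the same part. *)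
Lemma no_edge_between a b c d :
  q a b -> q c d -> a <> b -> a <> c -> a <> d -> b <> c -> b <> d -> c <> d ->
  h a c = false.
Proof.
move=> qab qcd nab nac nad nbc nbd ncd; apply/negbTE/negP => ac.
have [X [eX _]] := out_ex Q a; have [X' [eX' _]] := out_ex Q c.
have [W [eW _]] := out_ex X c.
have [||W' [eW' _]] := @rl_mv G k X c a.
- by move=> _ y yc; rewrite eX /mv !eqxx /= orbF => /eqP->; rewrite h_sym.
- by apply/or3P/Or33; apply: out_lt qab eX; neqs.
have QX : Q -- X by apply: (@adj_move X a b a) => //; rewrite qab eX /mv; deq.
have QX' : Q -- X' by apply: (@adj_move X' c d c) => //; rewrite qcd eX' /mv; deq.
have XX' : X <> X' by apply: (@rl_neq G k _ _ a b); rewrite eX eX' /mv qab; deq.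
have nXX' : ~~ (X -- X').
  by apply: (@nadj2 G k _ _ a b c d); try neqs; rewrite eX eX' /mv ?qab ?qcd; deq.
have XW : X -- W.
  apply: (@adj_off G k _ _ c c d); first by move=> x y xc yc; rewrite eW mv_off.
  by rewrite eX eW /mv !eX /mv qcd; deq.
have XW' : X -- W'.
  apply: (@adj_off G k _ _ c c d); first by move=> x y xc yc; rewrite eW' mv_off.
  by rewrite eX eW' /mv !eX /mv qcd; deq.
have X'W : X' -- W.
  apply: (@adj_off G k _ _ a a b); last by rewrite eX' eW /mv !eX /mv qab; deq.
  by move=> x y xa ya; rewrite eX' eW /mv !eX /mv; deq.
have X'W' : X' -- W'.
  apply: (@adj_off G k _ _ a a b); last by rewrite eX' eW' /mv !eX /mv qab; deq.
  by move=> x y xa ya; rewrite eX' eW' /mv !eX /mv; deq.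
have WQ : W <> Q by apply: (@rl_neq G k _ _ a b); rewrite eW /mv !eX /mv qab; deq.
have WQ' : W' <> Q by apply: (@rl_neq G k _ _ a b); rewrite eW' /mv !eX /mv qab; deq.
have nQW : ~~ (Q -- W).
  by apply: (@nadj2 G k _ _ a b c d); try neqs; rewrite eW /mv !eX /mv ?qab ?qcd; deq.
have nQW' : ~~ (Q -- W').
  by apply: (@nadj2 G k _ _ a b c d); try neqs; rewrite eW' /mv !eX /mv ?qab ?qcd; deq.
have := zl_un zQ QX QX' XX' nXX' XW X'W WQ nQW XW' X'W' WQ' nQW'.
by apply: (@rl_neq G k _ _ a c); rewrite eW eW' /mv !eX /mv; deq.
Qed.

(** Four vertices of one part would form two pairs with an edge of H between them, which
    [no_edge_between] forbids. *)
Lemma part_le3 a b c d :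
  q a b -> q a c -> q a d -> a <> b -> a <> c -> a <> d -> b <> c -> b <> d ->
  c <> d -> False.
Proof.
move=> ab ac ad nab nac nad nbc nbd ncd.
have cd : q c d by apply: rl_trans ad; rewrite rl_sym.
have := no_edge_between ab cd nab nac nad nbc nbd ncd.
by rewrite (rl_h ac) //; apply/eqP.
Qed.

(** Together with the symmetric statements for [b] and [c] this makes a part of size three a
    component of H. If [d] is not a singleton, [no_edge_between] applies; otherwise three neighbours
    of [Q] next to one [W] violate [zl_three]. *)
Lemma triple_edge a b c d : q a b -> q a c -> a <> b -> a <> c -> b <> c ->
  d <> a -> d <> b -> d <> c -> h a d = false.
Proof.
move=> qab qac nab nac nbc nda ndb ndc.
have [sd|/nsingleP[e ed de]] := boolP (single q d); last first.
  case: (eqVneq e a) => [ea|ea].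
    subst e; case: (part_le3 qab qac _ nab nac (nesym nda) nbc) => //; try neqs.
    by rewrite rl_sym.
  prep; case: (eqVneq e b) => [eb|/eqP eb].
    by subst e; apply: (no_edge_between qac de); neqs.
  by apply: (no_edge_between qab de); neqs.
apply/negbTE/negP => ad.
have qbc : q b c by apply: rl_trans qac; rewrite rl_sym.
have nqd x : q d x = (d == x) by apply: single_rl.
have nqd' x : q x d = (d == x) by apply: single_rlC.
have qN e x : e = b \/ e = c -> x <> a -> x <> b -> x <> c -> q e x = false.
  move=> eb xa xb xc; apply/negP => ex.
  apply: (part_le3 qab qac (_ : q a x)); try neqs.
  by case: eb => ?; subst e; [apply: rl_trans ex|apply: rl_trans ex].
have qbN x : x <> a -> x <> b -> x <> c -> q b x = false by apply: qN; left.
have qcN x : x <> a -> x <> b -> x <> c -> q c x = false by apply: qN; right.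
have qbN' x : x <> a -> x <> b -> x <> c -> q x b = false by rewrite rl_sym; apply: qbN.
have qcN' x : x <> a -> x <> b -> x <> c -> q x c = false by rewrite rl_sym; apply: qcN.
(* On the vertices a, b, c, d the partitions are [Y = ad|bc], [W = ad|b|c], [Xb = ac|b|d] and
   [Xc = ab|c|d]; each of the last two differs from [W] only in the place of [a]. *)
have [||Y [eY _]] := @rl_mv G k Q a d.
- by move=> _ y ya; rewrite nqd => /eqP <-.
- by rewrite (nsingle_of nab qab) orbT.
have [W [eW _]] := out_ex Y b.
have [Xb [eXb _]] := out_ex Q b; have [Xc [eXc _]] := out_ex Q c.
have qba : q b a by rewrite rl_sym.
have qca : q c a by rewrite rl_sym.
have QY : Q -- Y by apply: (@adj_move Y a b d) => //; rewrite eY /mv qab !nqd; deq.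
have QXb : Q -- Xb by apply: (@adj_move Xb b a b) => //; rewrite eXb /mv qba; deq.
have QXc : Q -- Xc by apply: (@adj_move Xc c a c) => //; rewrite eXc /mv qca; deq.
have YW : Y -- W.
  apply: (@adj_off G k _ _ b b c); first by move=> x y xb yb; rewrite eW mv_off.
  by rewrite eW /mv !eY /mv qbc; deq.
have XbW : Xb -- W.
  apply: (@adj_off G k _ _ a a d); last by rewrite eXb eW /mv !eY /mv !nqd !nqd'; deq.
  by move=> x y xa ya; rewrite eXb eW /mv !eY /mv !nqd; deq.
have XcW : Xc -- W.
  apply: (@adj_off G k _ _ a a b); last by rewrite eXc eW /mv !eY /mv !nqd qab; deq.
  move=> x y xa ya; rewrite eXc eW /mv !eY /mv !nqd; deq;
  first [by rewrite rl_refl | apply: qbN; neqs | apply: qbN'; neqs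
    | apply/esym; apply: qcN; neqs | apply/esym; apply: qcN'; neqs].
have WQ : W <> Q.
  by apply: (@rl_neq G k _ _ a b); rewrite eW /mv !eY /mv !nqd qab; deq.
have nQW : ~~ (Q -- W).
  by apply: (@nadj2 G k _ _ a d b c); try neqs; rewrite eW /mv !eY /mv ?nqd ?nqd' ?qbc; deq.
have YXb : Y <> Xb.
  by apply: (@rl_neq G k _ _ b c); rewrite eY eXb /mv qbc; deq.
have YXc : Y <> Xc.
  by apply: (@rl_neq G k _ _ b c); rewrite eY eXc /mv qbc; deq.
have XbXc : Xb <> Xc.
  by apply: (@rl_neq G k _ _ b a); rewrite eXb eXc /mv qba; deq.
have := zl_three zQ WQ nQW QY QXb QXc YW XbW XcW YXb YXc XbXc.
apply/negP.
by apply: (@nadj2 G k _ _ a d b c); try neqs; rewrite eY eXb /mv ?nqd ?nqd' ?qbc; deq.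
Qed.

(** Moving [a] to [c] and moving [a'] to [c] are nonadjacent neighbours of [Q], and neither move
    loses a class. Their common neighbour away from [Q] must join [a], [c] and [a'], so that [a a']
    would be an edge between two nontrivial parts. *)
Lemma two_parts_edge a b a' b' c : single q c ->
  q a b -> q a' b' -> a <> b -> a' <> b' -> ~~ q a a' ->
  h a c -> h a' c -> False.
Proof.
move=> sc qab qab' nab nab' nqaa ac ac'.
have nqc x : q c x = (c == x) by apply: single_rl.
have nqc' x : q x c = (c == x) by apply: single_rlC.
have nac : a <> c by apply/eqP/h_neq.
have nac' : a' <> c by apply/eqP/h_neq.
have nbc : b <> c by move=> e; subst b; move: qab; rewrite nqc'; apply/negP/eqP; neqs.
have nbc' : b' <> c by move=> e; subst b'; move: qab'; rewrite nqc'; apply/negP/eqP; neqs.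
have naa : a <> a' by move=> e; rewrite -e rl_refl in nqaa.
have nab2 : a <> b' by move=> e; move: nqaa; rewrite e rl_sym qab'.
have nba : b <> a' by move=> e; move: nqaa; rewrite -e qab.
have nbb : b <> b'.
  move=> e; case/negP: nqaa; apply: rl_trans qab _; by rewrite e rl_sym.
have [||U [eU _]] := @rl_mv G k Q a c.
- by move=> _ y ya; rewrite nqc => /eqP <-.
- by rewrite (nsingle_of nab qab) orbT.
have [||U' [eU' _]] := @rl_mv G k Q a' c.
- by move=> _ y ya; rewrite nqc => /eqP <-.
- by rewrite (nsingle_of nab' qab') orbT.
have QU : Q -- U by apply: (@adj_move U a b c) => //; rewrite eU /mv qab !nqc; deq.
have QU' : Q -- U' by apply: (@adj_move U' a' b' c) => //; rewrite eU' /mv qab' !nqc; deq.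
have UU' : U <> U'.
  by apply: (@rl_neq G k _ _ a b); rewrite eU eU' /mv qab !nqc; deq.
have nUU' : ~~ (U -- U').
  by apply: (@nadj2 G k _ _ a b a' b'); try neqs; rewrite eU eU' /mv ?qab ?qab' !nqc; deq.
(* [x] and [y] are the vertices moved from [U] and from [U'] to reach [Z]; every pair on which [U]
   and [U'] differ contains one of them. *)
have [Z [/adjP[_ [x ax]] /adjP[_ [y ay]] ZQ nQZ]] := zl_ex zQ QU QU' UU' nUU'.
have nadj z : agree_off z q (rl Z) -> False.
  by move=> az; case/negP: nQZ; apply/adjP; split; [neqs|exists z].
have cov s t : rl U s t != rl U' s t -> [\/ x = s, x = t, y = s | y = t].
  move=> d; case: (eqVneq s x) => [->|sx]; first by constructor 1.
  case: (eqVneq t x) => [->|tx]; first by constructor 2.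
  case: (eqVneq s y) => [->|sy]; first by constructor 3.
  case: (eqVneq t y) => [->|ty]; first by constructor 4.
  by rewrite ax // ay // eqxx in d.
have c1 : [\/ x = a, x = b, y = a | y = b].
  by apply: cov; rewrite eU eU' /mv qab !nqc; deq.
have c2 : [\/ x = a', x = b', y = a' | y = b'].
  by apply: cov; rewrite eU eU' /mv qab' !nqc; deq.
have c3 : [\/ x = a, x = c, y = a | y = c].
  by apply: cov; rewrite eU eU' /mv !nqc !nqc'; deq.
have c4 : [\/ x = a', x = c, y = a' | y = c].
  by apply: cov; rewrite eU eU' /mv !nqc !nqc'; deq.
(* Moving [a] again from [U], or [a'] again from [U'], would leave [Z] adjacent to [Q]. *)
have [xa|xa] := eqVneq x a.
  by rewrite xa in ax; apply: (nadj a) => s t sa ta; rewrite -ax // eU mv_off.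
have [yb|yb] := eqVneq y a'.
  by rewrite yb in ay; apply: (nadj a') => s t sa ta; rewrite -ay // eU' mv_off.
have [xa' ya] : x = a' /\ y = a.
  clear - c1 c2 c3 c4 xa yb naa nac nac' nbc nbc' nab2 nba nbb nab nab'; prep.
  case: c1 => ?; case: c2 => ?; case: c3 => ?; case: c4 => ?; subst; try neqx; try by [].
subst x y.
have Zac : rl Z a c by rewrite -ax; try (by apply/eqP; neqs); rewrite eU /mv !nqc; deq.
have Zac' : rl Z a' c by rewrite -ay; try (by apply/eqP; neqs); rewrite eU' /mv !nqc; deq.
have Zaa : rl Z a a' by apply: (rl_trans Zac); rewrite rl_sym.
have : h a a' by apply: rl_h Zaa _; apply/eqP.
by rewrite (no_edge_between qab qab').
Qed.

End Structure.

Section Structure.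
Variables (G : sgraph) (k : nat).
Local Notation h := (@nonedge G).
Local Notation B := (bell_geq G k).
Implicit Types (P O W X Y Z : B) (a b c d u v x y : G).
Variables (Q : B) (zQ : zero_like Q).
Local Notation q := (rl Q).

Lemma common_cover X Y Z x y s t :
  agree_off x (rl X) (rl Z) -> agree_off y (rl Y) (rl Z) ->
  rl X s t != rl Y s t -> [\/ x = s, x = t, y = s | y = t].
Proof.
move=> ax ay d; case: (eqVneq s x) => [->|sx]; first by constructor 1.
case: (eqVneq t x) => [->|tx]; first by constructor 2.
case: (eqVneq s y) => [->|sy]; first by constructor 3.
case: (eqVneq t y) => [->|ty]; first by constructor 4.
by rewrite ax // ay // eqxx in d.
Qed.

(* A vertex joining the two ends of a pair cannot enter it: otherwise the
   partitions a|b|c and abc would be a nonadjacent pair of neighbours of Q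
   without common neighbour away from Q. *)
Lemma pair_triangle_lt a b c : k < classes q ->
  (forall x, q a x -> x = a \/ x = b) ->
  q a b -> a <> b -> c <> a -> c <> b -> single q c ->
  h a c -> h b c -> False.
Proof.
move=> kq qaN qab nab nca ncb sc ac bc.
have nqc x : q c x = (c == x) by apply: single_rl.
have nqc' x : q x c = (c == x) by apply: single_rlC.
have qba : q b a by rewrite rl_sym.
have qaF x : x <> a -> x <> b -> q a x = false.
  by move=> xa xb; apply/negP => /qaN[].
have qbF x : x <> a -> x <> b -> q b x = false.
  by move=> xa xb; apply/negP => bx; case: (qaN x) => //; apply: rl_trans bx.
have qaF' x : x <> a -> x <> b -> q x a = false by rewrite rl_sym; apply: qaF.
have qbF' x : x <> a -> x <> b -> q x b = false by rewrite rl_sym; apply: qbF.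
have [||Y [eY _]] := @rl_mv G k Q c a.
- move=> _ y yc /qaN[] ->; by rewrite h_sym.
- by rewrite kq !orbT.
have [X [eX _]] := out_ex Q a.
have QY : Q -- Y by apply: (@adj_move _ _ _ Y c a a) => //; rewrite eY /mv ?nqc ?rl_refl; deq.
have QX : Q -- X by apply: (@adj_move _ _ _ X a b a) => //; rewrite eX /mv qab; deq.
have XY : X <> Y by apply: (@rl_neq G k _ _ a b); rewrite eX eY /mv qab; deq.
have nXY : ~~ (X -- Y).
  by apply: (@nadj3 G k _ _ a b c); try neqs; rewrite eX eY /mv ?nqc ?nqc' ?rl_refl ?qab; deq.
have [Z [/adjP[_ [x ax]] /adjP[_ [y ay]] ZQ nQZ]] := zl_ex zQ QX QY XY nXY.
have nadj z : agree_off z q (rl Z) -> False.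
  by move=> az; case/negP: nQZ; apply/adjP; split; [neqs|exists z].
have XQa : agree_off a q (rl X) by move=> s t sa ta; rewrite eX mv_off.
(* In a part of exactly two vertices, isolating [a] and isolating [b] give the same partition, so
   neither vertex can be the one moved from [X] to [Z]. *)
have XQb : agree_off b q (rl X).
  move=> s t sb tb; rewrite eX /mv; deq; rewrite ?rl_refl // ?qaF ?qaF' //; neqs.
have xN z : agree_off z q (rl X) -> x <> z.
  move=> az e; subst z; apply: (nadj x) => s t sx tx; rewrite az //; exact: ax.
have yN : y <> c.
  move=> e; apply: (nadj c) => s t sc' tc; rewrite e in ay; rewrite -ay //.
  by rewrite eY mv_off.
have xa := xN _ XQa; have xb := xN _ XQb.
have c1 : [\/ x = a, x = b, y = a | y = b].
  by apply: common_cover ax ay _; rewrite eX eY /mv qab; deq.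
have c2 : [\/ x = a, x = c, y = a | y = c].
  by apply: common_cover ax ay _; rewrite eX eY /mv ?nqc ?nqc' ?rl_refl; deq.
have c3 : [\/ x = b, x = c, y = b | y = c].
  by apply: common_cover ax ay _; rewrite eX eY /mv ?nqc ?nqc' ?rl_refl ?qab; deq.
have [xc yab] : x = c /\ (y = a \/ y = b).
  clear - c1 c2 c3 xa xb yN nab nca ncb; case: c1 => ?; case: c2 => ?; case: c3 => ?; subst;
    try neqx; try neqx; try (by []);
  by split; auto.
subst x.
(* Here [e] and [f] are [a] and [b] in either order. If [e] is the vertex moved from [Y], then [Z]
   reads [e|cf] on the three vertices and differs from [Q] only at [f]. *)
have main e f : (e = a /\ f = b) \/ (e = b /\ f = a) -> y = e -> False.
  move=> ef ye; subst y; apply: (nadj f).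
  have [nef nec nfc] : [/\ e <> f, e <> c & f <> c] by case: ef => -[-> ->]; split; neqs.
  have qfe : q f e by case: ef => -[-> ->].
  have Zef : rl Z e f = false.
    by rewrite -ax; try (by apply/eqP; neqs); rewrite eX /mv; case: ef => -[-> ->]; deq.
  have Zcf : rl Z c f.
    by rewrite -ay; try (by apply/eqP; neqs); rewrite eY /mv; case: ef => -[_ ->];
      rewrite ?rl_refl ?qab ?qba; deq.
  have Zce : rl Z c e = false.
    apply/negP => ce; move: Zef; have -> // : rl Z e f.
    by apply: rl_trans Zcf; rewrite rl_sym.
  have qfab : agree_off f q (rl X) by case: ef => -[_ ->].
  have Zct t : t <> c -> t <> e -> t <> f -> rl Z c t = false.
    move=> tc te tf; rewrite -ay; try (by apply/eqP; neqs).
    by rewrite eY /mv; deq; apply: qaF; case: ef => -[? ?]; subst.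
  have Zc t : t <> f -> rl Z c t = (c == t).
    move=> tf; case: (c =P t) => [<-|ct]; first by rewrite rl_refl.
    case: (t =P e) => [->|te]; [exact: Zce|apply: Zct; neqs].
  move=> s t sf tf; prep; have [sc'|sc'] := eqVneq s c.
    by subst s; rewrite nqc Zc.
  have [tc'|tc'] := eqVneq t c.
    by subst t; rewrite nqc' rl_sym Zc.
  by rewrite qfab ?ax //; apply/eqP.
by case: yab; apply: main; auto.
Qed.

Hypothesis kn : k + 2 <= #|G|.

(** Were [ab] the only nontrivial part, [Q] would have [n - 1] classes, while [k <= n - 2]. The part
    found here is the one that is split when [Q] has no class to spare. *)
Lemma other_part a b : classes q = k -> q a b -> a <> b ->
  (forall x, q a x -> x = a \/ x = b) ->
  exists u v, [/\ u <> v, q u v & ~~ q a u].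
Proof.
move=> kq qab nab qaN.
case: (pickP (fun p : G * G => [&& p.1 != p.2, q p.1 p.2 & ~~ q a p.1])) => [[u v]|no].
  by case/and3P => /= /eqP uv quv au; exists u, v.
have [Y [eY cY]] := out_ex Q a.
have zY : is_zero Y.
  move=> x y; rewrite eY /mv; case: (x =P a) => [->|xa]; first by deq.
  case: (y =P a) => [->|ya]; first by deq.
  have := no (x, y) => /=; have [->|xy] /= := eqVneq x y; first by rewrite rl_refl.
  case qxy: (q x y) => //= /negbT/negPn ax.
  have ay : q a y by apply: rl_trans qxy.
  case: (qaN _ ax) (qaN _ ay) => [//|?] [//|?]; subst; by rewrite eqxx in xy.
have := zero_classes zY; move: cY kq kn; rewrite (nsingle_of nab qab); lia.
Qed.

(* W arises from Q by isolating v and moving c; the only common neighbours of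
   Q and W besides Y, in which v alone is isolated, put c together with v or
   with its companion u. *)
Lemma common_split u v c x Y Z : q u v -> u <> v -> rl Y =2 mv q v v ->
  single q c -> x = u \/ x = v -> agree_off x q (rl Z) ->
  agree_off c (rl Z) (rl Y) -> Z <> Y -> rl Z x c.
Proof.
move=> quv uv eY sc xuv ax ac ZY; apply/negPn/negP => nxc; apply: ZY.
have nqc z : q c z = (c == z) by apply: single_rl.
have ncu : c <> u by move=> e; subst c; move: quv; rewrite nqc; apply/negP/eqP.
have ncv : c <> v.
  by move=> e; subst c; move: quv; rewrite rl_sym nqc; apply/negP/eqP/nesym.
have ncx : c <> x by case: xuv => ->.
apply: (rl_agree ac) => z zc.
have -> : rl Y c z = false.
  rewrite eY /mv nqc; deq; neqs.
have [->|zx] := eqVneq z x; first by rewrite rl_sym; apply/negbTE.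
by rewrite -ax //; [rewrite nqc eq_sym (negPf zc)|apply/eqP].
Qed.

(** If [Q] has exactly [k] parts, [c] cannot enter the pair directly. A second part containing [u]
    and [v] is split first, giving [Y], and [W] joins [c] to [ab] over [Y]. The further vertex
    between [Q] and [W] that [zl_more] demands must put [c] with [u] or [v], and then [c] is joined
    in H to two nontrivial parts, against [two_parts_edge]. *)
Lemma pair_triangle a b c : q a b -> a <> b -> ~~ q a c ->
  h a c -> h b c -> False.
Proof.
move=> qab nab nac ac bc.
have nca : c <> a by apply/nesym/eqP/h_neq.
have ncb : c <> b by apply/nesym/eqP/h_neq.
have qaN x : q a x -> x = a \/ x = b.
  move=> ax; have [xa|/eqP xa] := eqVneq x a; first by left.
  have [xb|/eqP xb] := eqVneq x b; first by right.
  have cx : c <> x by move=> e; rewrite e ax in nac.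
  by move: ac; rewrite (triple_edge zQ qab ax) //; neqs.
have [sc|/nsingleP[e /eqP ec ce]] := boolP (single q c); last first.
  have ncb' : ~~ q b c by apply: contra nac; apply: rl_trans.
  have nea : e <> a by move=> ?; subst e; rewrite rl_sym ce in nac.
  have neb : e <> b by move=> ?; subst e; rewrite rl_sym ce in ncb'.
  by move: ac; rewrite (no_edge_between zQ qab ce) //; neqs.
have := rl_ge Q; rewrite leq_eqVlt => /orP[/eqP kq|kq]; last first.
  exact: (pair_triangle_lt kq qaN qab nab nca ncb sc ac bc).
have [u [v [nuv quv nau]]] := other_part (esym kq) qab nab qaN.
have nbu : ~~ q b u by apply: contra nau; apply: rl_trans.
have nav : ~~ q a v by apply: contra nau => av; apply: rl_trans av _; rewrite rl_sym.
have nbv : ~~ q b v by apply: contra nav; apply: rl_trans.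
have neqq s t : ~~ q s t -> s <> t by move=> + e; rewrite e rl_refl.
have nqc x : q c x = (c == x) by apply: single_rl.
have nqc' x : q x c = (c == x) by apply: single_rlC.
have ncu : c <> u by move=> e; subst c; move: quv; rewrite nqc; apply/negP/eqP.
have ncv : c <> v.
  by move=> e; subst c; move: quv; rewrite rl_sym nqc; apply/negP/eqP/nesym.
have [nau' nbu' nav' nbv'] := And4 (neqq _ _ nau) (neqq _ _ nbu) (neqq _ _ nav) (neqq _ _ nbv).
have [Y [eY cY]] := out_ex Q v.
have qvu : q v u by rewrite rl_sym.
have [||W [eW _]] := @rl_mv G k Y c a.
- move=> _ y yc; have [->|yv] := eqVneq y v; first by rewrite eY /mv; deq.
  by rewrite eY mv_off //; [case/qaN => ->; rewrite h_sym|apply/eqP].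
- by apply/or3P/Or33; apply: out_lt qvu eY.
have QY : Q -- Y by apply: (@adj_move _ _ _ Y v u v) => //; rewrite eY /mv qvu; deq.
have YW : Y -- W.
  apply: (@adj_off G k _ _ c c a); first by move=> x y xc yc; rewrite eW mv_off.
  by rewrite eW /mv !eY /mv ?nqc ?nqc' ?rl_refl; deq.
have dac : q a c != rl W a c by rewrite eW /mv !eY /mv ?nqc ?nqc' ?rl_refl; deq.
have dbc : q b c != rl W b c by rewrite eW /mv !eY /mv ?nqc ?nqc' ?rl_refl ?qab; deq.
have duv : q u v != rl W u v by rewrite eW /mv !eY /mv ?nqc ?nqc' ?rl_refl ?quv; deq.
have nQW : ~~ (Q -- W) by apply: (nadj2 dac duv); neqs.
have WQ : W <> Q by apply/nesym; apply: rl_neq dac.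
have [Z [QZ ZW ZY]] : exists Z, [/\ Q -- Z, Z -- W & Z <> Y].
  case: (zl_more zQ WQ nQW QY YW) => [[Z [? ? ? _]]|[Z [_ [[? ?] _ YZ _ _]]]]; exists Z;
    split=> //.
  by apply/nesym/adj_neq.
case/adjP: QZ => _ [x ax]; case/adjP: ZW => _ [y ay].
have ay' : agree_off y (rl W) (rl Z) by move=> s t sy ty; rewrite ay.
have c1 := common_cover ax ay' dac; have c2 := common_cover ax ay' dbc.
have c3 := common_cover ax ay' duv.
have [[xc yuv]|[xuv yc]] : (x = c /\ (y = u \/ y = v)) \/ ((x = u \/ x = v) /\ y = c).
  clear - c1 c2 c3 nab nca ncb ncu ncv nau' nbu' nav' nbv'.
  by case: c1 => ?; case: c2 => ?; case: c3 => ?; subst; try neqx; try neqx; auto.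
(* In this case [Z] joins [c] to [ab] with nothing split, so it would have one class fewer than
   [k]. *)
- have mvc := classes_move (rl_eqv Q) (rl_eqv Z) ax.
  have ac' : rl Z a c.
    rewrite ay; first by rewrite eW /mv !eY /mv !rl_refl; deq.
    - by apply/eqP; case: yuv => ->.
    by apply/eqP; case: yuv => ->.
  have ca' : rl Z c a by rewrite rl_sym.
  move: mvc; rewrite xc sc (nsingle_of nca ca') -kq.
  by rewrite addn0 => e; have := rl_ge Z; rewrite [X in X <= _]e addn1 ltnn.
have acY : agree_off c (rl Z) (rl Y).
  by move=> s t sc' tc'; rewrite ay ?yc // eW mv_off.
have Zxc := common_split quv nuv eY sc xuv ax acY ZY.
have nxc : x <> c by case: xuv => ->; neqs.
have hxc : h x c by apply: rl_h Zxc _; apply/eqP.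
case: xuv => ?; subst x.
  exact: (two_parts_edge zQ sc qab quv nab nuv nau ac hxc).
exact: (two_parts_edge zQ sc qab qvu nab (nesym nuv) nav ac hxc).
Qed.

End Structure.

Section Structure.
Variables (G : sgraph) (k : nat).
Local Notation h := (@nonedge G).
Local Notation B := (bell_geq G k).
Implicit Types (P O W X Y Z : B) (a b c d u v x y : G).
Variables (Q : B) (zQ : zero_like Q).
Hypothesis kn : k + 2 <= #|G|.
Local Notation q := (rl Q).

(** [Y] isolates [v], and [W] also joins [cd]. As [Q] has no class to spare, every vertex between
    [Q] and [W] other than [Y] moves one of [u], [v] to one of [c], [d]. Such a vertex is adjacent
    to [Y], so [zl_more] yields two distinct ones. If both used [d], they would coincide or make a
    triangle of [u], [v], [d]; hence one of them uses [c]. *)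
Lemma split_edge u v c d : classes q = k -> u <> v -> q u v ->
  single q c -> single q d -> h c d -> exists2 t, t = u \/ t = v & h t c.
Proof.
move=> kq nuv quv sc sd cd.
have nqc x : q c x = (c == x) by apply: single_rl.
have nqc' x : q x c = (c == x) by apply: single_rlC.
have nqd x : q d x = (d == x) by apply: single_rl.
have nqd' x : q x d = (d == x) by apply: single_rlC.
have qvu : q v u by rewrite rl_sym.
have ncd : c <> d by apply/eqP/h_neq.
have ns x : single q x -> x <> u /\ x <> v.
  move=> sx; split=> e; subst x; move: quv;
  rewrite ?(single_rl _ sx) ?(single_rlC _ sx); apply/negP/eqP; neqs.
have [ncu ncv] := ns _ sc; have [ndu ndv] := ns _ sd.
have [Y [eY _]] := out_ex Q v.
have [||W [eW _]] := @rl_mv G k Y c d.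
- move=> _ y yc; have [->|yv] := eqVneq y v; first by rewrite eY /mv; deq.
  by rewrite eY mv_off ?nqd //; [move/eqP <-|apply/eqP].
- by apply/or3P/Or33; apply: out_lt qvu eY.
have QY : Q -- Y by apply: (@adj_move _ _ _ Y v u v) => //; rewrite eY /mv qvu; deq.
have WYc : agree_off c (rl W) (rl Y) by move=> s t ? ?; rewrite eW mv_off.
have WYd : agree_off d (rl W) (rl Y).
  by move=> s t ? ?; rewrite eW /mv !eY /mv ?nqd; deq; rewrite ?nqc ?nqc'; deq.
have dcd : q c d != rl W c d by rewrite eW /mv !eY /mv ?nqc ?nqd ?rl_refl; deq.
have duv : q u v != rl W u v by rewrite eW /mv !eY /mv ?quv; deq.
have YW : Y -- W.
  apply: (@adj_off G k _ _ c c d); first by move=> s t ? ?; rewrite WYc.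
  by rewrite eW /mv !eY /mv ?nqc ?nqd; deq.
have nQW : ~~ (Q -- W) by apply: (nadj2 dcd duv); neqs.
have WQ : W <> Q by apply/nesym; apply: rl_neq dcd.
have Wcd : rl W c d by rewrite eW /mv !eY /mv ?nqd; deq.
have key Z : Q -- Z -> Z -- W -> Z <> Y -> exists t s,
    [/\ t = u \/ t = v, s = c \/ s = d, agree_off t q (rl Z),
        agree_off s (rl Z) (rl Y) & rl Z t s].
  move=> /adjP[_ [x ax]] /adjP[_ [y ay]] ZY.
  have ay' : agree_off y (rl W) (rl Z) by move=> s t ? ?; rewrite ay.
  have c1 := common_cover ax ay' duv; have c2 := common_cover ax ay' dcd.
  have [[xuv ycd]|[xcd yuv]] : ((x = u \/ x = v) /\ (y = c \/ y = d)) \/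
      ((x = c \/ x = d) /\ (y = u \/ y = v)).
    clear - c1 c2 ncu ncv ndu ndv.
    by case: c1 => ?; case: c2 => ?; subst; try neqx; try neqx; auto.
    exists x, y; split=> //.
      by move=> s t sy ty; rewrite ay //; case: ycd => e; rewrite e in sy ty;
        [rewrite WYc|rewrite WYd].
    case: ycd => e; rewrite e in ay *.
      apply: (common_split quv nuv eY sc xuv ax _ ZY).
      by move=> s t ? ?; rewrite ay // WYc.
    apply: (common_split quv nuv eY sd xuv ax _ ZY).
    by move=> s t ? ?; rewrite ay // WYd.
  have Zcd : rl Z c d.
    by rewrite ay //; apply/eqP; case: yuv => ->.
  have := classes_move (rl_eqv Q) (rl_eqv Z) ax; rewrite kq.
  have -> : single q x by case: xcd => ->.
  have -> : single (rl Z) x = false.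
    case: xcd => ->; [exact: nsingle_of Zcd|].
    by apply: (@nsingle_of _ _ _ d c); [neqs|rewrite rl_sym].
  by rewrite addn0 => e; have := rl_ge Z; rewrite [X in X <= _]e addn1 ltnn.
case: (zl_more zQ WQ nQW QY YW) => [[Z [QZ ZW ZY nYZ]]|].
  have [t [s [_ _ _ ag _]]] := key Z QZ ZW ZY.
  case/negP: nYZ; apply/adjP; split; first neqs.
  by exists s => x y xs ys; rewrite ag.
move=> [Z1 [Z2 [[QZ1 Z1W] [QZ2 Z2W] YZ1 YZ2 Z12]]].
have [t1 [s1 [t1uv s1cd at1 as1 zts1]]] := key _ QZ1 Z1W (nesym (adj_neq YZ1)).
have [t2 [s2 [t2uv s2cd at2 as2 zts2]]] := key _ QZ2 Z2W (nesym (adj_neq YZ2)).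
have nts t s : t = u \/ t = v -> s = c \/ s = d -> t != s.
  by move=> [->|->] [->|->]; apply/eqP; neqs.
have h1 : h t1 s1 by apply: rl_h zts1 _; apply: nts.
have h2 : h t2 s2 by apply: rl_h zts2 _; apply: nts.
case: (s1cd) => e1; first by subst s1; exists t1.
case: (s2cd) => e2; first by subst s2; exists t2.
subst s1 s2; have [e|/eqP nt] := eqVneq t1 t2.
  case: (adj_neq Z12); subst t2; apply: (@rl_agree _ _ _ _ d).
    by move=> s t sd' td; rewrite as1 // as2.
  move=> z zd; have [->|zt] := eqVneq z t1; first by rewrite rl_sym zts1 rl_sym.
  have dt : d != t1 by rewrite eq_sym nts //; right.
  by rewrite -at1 // -at2.
have nqud : ~~ q u d by rewrite nqd'; apply/eqP.
case: (pair_triangle zQ kn quv nuv nqud).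
  by case: t1uv t2uv => e1 [] e2; subst.
by case: t1uv t2uv => e1 [] e2; subst.
Qed.

(** There are two nontrivial parts by [other_part], and [split_edge] joins [c] to both, against
    [two_parts_edge]. So an edge between singletons proves that [Q] has a class to spare. *)
Lemma no_single_edge c d : classes q = k -> single q c -> single q d ->
  h c d -> False.
Proof.
move=> kq sc sd cd.
case: (pickP (fun p : G * G => (p.1 != p.2) && q p.1 p.2)) => [[u v]|no]; last first.
  have zQ0 : is_zero Q.
    move=> x y; have := no (x, y); have [->|xy] /= := eqVneq x y; rewrite ?rl_refl //.
  by have := zero_classes zQ0; lia.
move=> /andP[/= /eqP nuv quv].
have [a [b [qab nab ac]]] : exists a b, [/\ q a b, a <> b & h a c].
  have [t [] -> ht] := split_edge kq nuv quv sc sd cd; first by exists u, v.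
  by exists v, u; split; [rewrite rl_sym|neqs|].
have nac : a <> c by apply/eqP/h_neq.
have ns x : q a x -> x <> c.
  move=> qax e; subst x; move: qax; rewrite (single_rlC _ sc); apply/negP/eqP; neqs.
have qaN x : q a x -> x = a \/ x = b.
  move=> ax; have [xa|/eqP xa] := eqVneq x a; first by left.
  have [xb|/eqP xb] := eqVneq x b; first by right.
  have nxc := ns _ ax; have nbc := ns _ qab.
  by move: ac; rewrite (triple_edge zQ qab ax) //; neqs.
have [u' [v' [nuv' quv' nau]]] := other_part kn kq qab nab qaN.
have [t tuv ht] := split_edge kq nuv' quv' sc sd cd.
case: tuv => e; subst t.
  exact: (two_parts_edge zQ sc qab quv' nab nuv' nau ac ht).
have nav : ~~ q a v'.
  by apply: contra nau => av; apply: rl_trans av _; rewrite rl_sym.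
have qvu' : q v' u' by rewrite rl_sym.
exact: (two_parts_edge zQ sc qab qvu' nab (nesym nuv') nav ac ht).
Qed.

(** On the four vertices, [X = a|b|c|d], [U = ac|b|d] and [M = ab|cd] are next to [W = a|b|cd], yet
    [X] and [M] are nonadjacent, against [zl_three]. Only [M] needs a class to spare, which
    [no_single_edge] provides. Hence the neighbours of a pair are leaves. *)
Lemma pair_leaf a b c d : q a b -> a <> b -> single q c -> single q d ->
  h a c -> h c d -> False.
Proof.
move=> qab nab sc sd ac cd.
have := rl_ge Q; rewrite leq_eqVlt => /orP[/eqP kq|kq].
  exact: (@no_single_edge c d).
have nqc x : q c x = (c == x) by apply: single_rl.
have nqc' x : q x c = (c == x) by apply: single_rlC.
have nqd x : q d x = (d == x) by apply: single_rl.
have nqd' x : q x d = (d == x) by apply: single_rlC.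
have ncd : c <> d by apply/eqP/h_neq.
have qba : q b a by rewrite rl_sym.
have ns x : single q x -> x <> a /\ x <> b.
  move=> sx; split=> e; subst x; move: qab;
  rewrite ?(single_rl _ sx) ?(single_rlC _ sx); apply/negP/eqP; neqs.
have [nca ncb] := ns _ sc; have [nda ndb] := ns _ sd.
have [X [eX _]] := out_ex Q a.
have [||U [eU _]] := @rl_mv G k Q a c.
- by move=> _ y ya; rewrite nqc => /eqP <-.
- by rewrite (nsingle_of nab qab) orbT.
have [||M [eM _]] := @rl_mv G k Q c d.
- by move=> _ y ya; rewrite nqd => /eqP <-.
- by rewrite kq !orbT.
have [||W [eW _]] := @rl_mv G k X c d.
- move=> _ y yc; have [->|ya] := eqVneq y a; first by rewrite eX /mv; deq.
  by rewrite eX mv_off ?nqd //; [move/eqP <-|apply/eqP].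
- by apply/or3P/Or33; apply: out_lt qab eX; neqs.
have QX : Q -- X by apply: (@adj_move _ _ _ X a b a) => //; rewrite eX /mv qab; deq.
have QU : Q -- U by apply: (@adj_move _ _ _ U a b c) => //; rewrite eU /mv qab !nqc; deq.
have QM : Q -- M by apply: (@adj_move _ _ _ M c d d) => //; rewrite eM /mv !nqc !nqd; deq.
have XW : X -- W.
  apply: (@adj_off G k _ _ c c d); first by move=> x y ? ?; rewrite eW mv_off.
  by rewrite eW /mv !eX /mv ?nqc ?nqd; deq.
have MW : M -- W.
  apply: (@adj_off G k _ _ a a b).
    by move=> x y ? ?; rewrite eW eM /mv !eX /mv ?nqd ?nqd'; deq.
  by rewrite eW eM /mv !eX /mv ?nqd ?nqc qab; deq.
have UW : U -- W.
  apply: (@adj_off G k _ _ c c d).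
    by move=> x y ? ?; rewrite eW eU /mv !eX /mv ?nqc; deq.
  by rewrite eW eU /mv !eX /mv ?nqd ?nqc; deq.
have WQ : W <> Q by apply: (@rl_neq G k _ _ a b); rewrite eW /mv !eX /mv qab; deq.
have nQW : ~~ (Q -- W).
  by apply: (@nadj2 G k _ _ a b c d); try neqs;
    rewrite eW /mv !eX /mv ?nqc ?nqd ?qab; deq.
have XM : X <> M by apply: (@rl_neq G k _ _ a b); rewrite eX eM /mv qab; deq.
have XU : X <> U by apply: (@rl_neq G k _ _ a c); rewrite eX eU /mv ?nqc; deq.
have MU : M <> U by apply: (@rl_neq G k _ _ a b); rewrite eM eU /mv ?nqc qab; deq.
have := zl_three zQ WQ nQW QX QM QU XW MW UW XM XU MU.
apply/negP.
by apply: (@nadj2 G k _ _ a b c d); try neqs; rewrite eX eM /mv ?nqc ?nqd ?qab; deq.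
Qed.

End Structure.

(** * The neighbourhood of a zero-like partition *)

Section Tau.
Variables (G : sgraph) (k : nat).
Local Notation h := (@nonedge G).
Local Notation B := (bell_geq G k).
Implicit Types (P O W X Y Z : B) (a b c d u v x y z : G).
Variables (Q : B) (zQ : zero_like Q).
Hypothesis kn : k + 2 <= #|G|.
Local Notation q := (rl Q).

Definition pair_part x y := q x y && [forall z, q x z ==> (z == x) || (z == y)].

(* [base x y] splits the parts of x and y into singletons; [tau x y] then joins
   x and y, unless they already formed a part of Q. *)
Definition base x y : rel G := fun u v =>
  (u == v) || [&& q u v, ~~ q u x & ~~ q u y].

Definition tau x y : rel G := fun u v =>
  base x y u v || (~~ pair_part x y) && erel x y u v.

Lemma pair_partP x y : reflect (q x y /\ forall z, q x z -> z = x \/ z = y)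
  (pair_part x y).
Proof.
apply: (iffP andP) => -[qxy H]; split=> //.
  by move=> z qz; have /orP[/eqP|/eqP] := implyP (forallP H z) qz; auto.
by apply/forallP => z; apply/implyP => /H[] ->; rewrite eqxx ?orbT.
Qed.

Lemma pair_partC x y : pair_part x y = pair_part y x.
Proof.
suff H a b : pair_part a b -> pair_part b a by apply/idP/idP; apply: H.
move=> /pair_partP[ab H]; apply/pair_partP; split; first by rewrite rl_sym.
by move=> z bz; case: (H z (rl_trans ab bz)); auto.
Qed.

Lemma baseC x y : base x y =2 base y x.
Proof. by move=> u v; rewrite /base; congr (_ || (_ && _)); rewrite andbC. Qed.

Lemma tauC x y : tau x y =2 tau y x.
Proof. by move=> u v; rewrite /tau baseC pair_partC erelC. Qed.

Lemma triple_third x y z : q x y -> q x z -> x <> y -> x <> z -> y <> z ->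
  forall u, q x u = [|| u == x, u == y | u == z].
Proof.
move=> xy xz nxy nxz nyz u; apply/idP/idP => [xu|].
  case: (u =P x) => //= ux; case: (u =P y) => //= uy; apply/eqP.
  case: (u =P z) => // uz.
  by case: (part_le3 zQ xy xz xu); neqs.
by case/or3P => /eqP->; rewrite ?rl_refl.
Qed.

(** The three shapes of [tau]: an edge inside a triple isolates the third vertex, a pair that is a
    part is split ([tau_out2]), and any other edge joins its ends ([tau_mv]). By [part_le3] and
    [edge_single] every edge of H is of one of these kinds. *)
Lemma tau_out3 x y z : q x y -> q x z -> x <> y -> x <> z -> y <> z ->
  mv q z z =2 tau x y.
Proof.
move=> xy xz nxy nxz nyz.
have np : pair_part x y = false.
  by apply/negbTE/negP => /pair_partP[_ /(_ z xz)] [] ?; subst.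
have rx := triple_third xy xz nxy nxz nyz.
have rx' u : q u x = [|| u == x, u == y | u == z] by rewrite rl_sym rx.
have ry u : q y u = [|| u == x, u == y | u == z] by rewrite -rx (eqv_class (rl_eqv Q) xy).
have ry' u : q u y = [|| u == x, u == y | u == z] by rewrite rl_sym ry.
have rz u : q z u = [|| u == x, u == y | u == z] by rewrite -rx (eqv_class (rl_eqv Q) xz).
have rz' u : q u z = [|| u == x, u == y | u == z] by rewrite rl_sym rz.
move=> u v; rewrite /mv /tau np /base /erel !rx' !ry'.
by deq; rewrite ?rx ?rx' ?ry ?ry' ?rz ?rz' ?rl_refl; deq.
Qed.

Lemma tau_out2 x y : pair_part x y -> x <> y -> mv q x x =2 tau x y.
Proof.
move=> p nxy; have /pair_partP[xy H] := p.
have rx u : q x u = (u == x) || (u == y).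
  apply/idP/idP => [/H[] ->|/orP[] /eqP->]; rewrite ?eqxx ?orbT ?rl_refl //.
have rx' u : q u x = (u == x) || (u == y) by rewrite rl_sym rx.
have ry u : q y u = (u == x) || (u == y) by rewrite -rx (eqv_class (rl_eqv Q) xy).
have ry' u : q u y = (u == x) || (u == y) by rewrite rl_sym ry.
move=> u v; rewrite /mv /tau p /base /erel !rx' !ry'.
by deq; rewrite ?rx ?rx' ?ry ?ry' ?rl_refl; deq.
Qed.

Lemma tau_mv x y : h x y -> single q y -> mv q x y =2 tau x y.
Proof.
move=> xy sy; have nxy : x <> y by apply/eqP/h_neq.
have ry u : q y u = (y == u) by apply: single_rl.
have ry' u : q u y = (y == u) by apply: single_rlC.
have np : pair_part x y = false by rewrite /pair_part ry'; deq.
have [sx|/nsingleP[z /eqP zx xz]] := boolP (single q x).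
  have rx u : q x u = (x == u) by apply: single_rl.
  have rx' u : q u x = (x == u) by apply: single_rlC.
  move=> u v; rewrite /mv /tau np /base /erel !rx' !ry'.
  by deq; rewrite ?rx ?rx' ?ry ?ry' ?rl_refl; deq.
have nyz : y <> z by move=> e; subst z; move: xz; rewrite ry'; deq.
have rx u : q x u = (u == x) || (u == z).
  apply/idP/idP => [xu|/orP[] /eqP->]; rewrite ?rl_refl //.
  case: (u =P x) => //= ux; case: (u =P z) => // uz.
  have yu : y <> u by move=> e; subst u; move: xu; rewrite ry'; deq.
  by move: xy; rewrite (triple_edge zQ xz xu) //; neqs.
have rx' u : q u x = (u == x) || (u == z) by rewrite rl_sym rx.
have rz u : q z u = (u == x) || (u == z) by rewrite -rx (eqv_class (rl_eqv Q) xz).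
have rz' u : q u z = (u == x) || (u == z) by rewrite rl_sym rz.
move=> u v; rewrite /mv /tau np /base /erel !rx' !ry'.
by deq; rewrite ?rx ?rx' ?ry ?ry' ?rz ?rz' ?rl_refl; deq.
Qed.

Lemma edge_single x y : h x y -> ~~ q x y -> single q x \/ single q y.
Proof.
move=> xy nq; have nxy : x <> y by apply/eqP/h_neq.
have [sx|/nsingleP[x' /eqP xx qx]] := boolP (single q x); first by left.
have [sy|/nsingleP[y' /eqP yy qy]] := boolP (single q y); first by right.
have : h x y = false; last by rewrite xy.
apply: (no_edge_between zQ qx qy); try neqs.
- by move=> e; rewrite e rl_sym qy in nq.
- by move=> e; rewrite -e qx in nq.
by move=> e; case/negP: nq; apply: (rl_trans qx); rewrite e rl_sym.
Qed.

(** Joining two singletons is the only kind of [tau] that loses a class; this is the room it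
    needs. *)
Lemma singles_lt x y : h x y -> single q x -> single q y -> k < classes q.
Proof.
move=> xy sx sy; have := rl_ge Q; rewrite leq_eqVlt => /orP[/eqP kq|//].
by case: (no_single_edge zQ kn (esym kq) sx sy xy).
Qed.

Lemma tau_diag x y : x <> y -> tau x y x y = ~~ pair_part x y.
Proof. by move=> nxy; rewrite /tau /base edge_in rl_refl andbF andbT; deq. Qed.

Lemma tau_ex x y : h x y -> exists Z, Q -- Z /\ rl Z =2 tau x y.
Proof.
wlog : x y / q x y || single q y => [H xy|].
  have [?|nxy] := boolP (q x y || single q y); first exact: H.
  move: nxy; rewrite negb_or => /andP[nq ns].
  have [sx|sy] := edge_single xy nq; last by rewrite sy in ns.
  have [||Z [QZ eZ]] := H y x; rewrite ?sx ?orbT 1?h_sym //.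
  by exists Z; split=> // u v; rewrite eZ tauC.
move=> qs xy; have nxy : x <> y by apply/eqP/h_neq.
case qxy: (q x y); last (have sy : single q y by move: qs; rewrite qxy).
  have [p|np] := boolP (pair_part x y).
    have [Z [eZ _]] := out_ex Q x; have tZ := tau_out2 p nxy.
    exists Z; split; last by move=> u v; rewrite eZ tZ.
    by apply: (@adj_move _ _ _ Z x y x) => //; rewrite eZ /mv qxy; deq.
  have [z [xz nzx nzy]] : exists z, [/\ q x z, z <> x & z <> y].
    move: np; rewrite /pair_part qxy /= negb_forall => /existsP[z].
    by rewrite negb_imply negb_or => /and3P[? /eqP ? /eqP ?]; exists z.
  have [Z [eZ _]] := out_ex Q z; have tZ := tau_out3 qxy xz nxy (nesym nzx) (nesym nzy).
  exists Z; split; last by move=> u v; rewrite eZ tZ.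
  have zx : q z x by rewrite rl_sym.
  by apply: (@adj_move _ _ _ Z z x z) => //; rewrite eZ /mv zx; deq.
have ry u : q y u = (y == u) by apply: single_rl.
have [||Z [eZ _]] := @rl_mv G k Q x y.
- by move=> _ u ux; rewrite ry => /eqP <-.
- have [sx|//] := boolP (single q x); last by rewrite orbT.
  by rewrite (singles_lt xy) ?orbT.
exists Z; split; last by move=> u v; rewrite eZ tau_mv.
by apply: (@adj_move _ _ _ Z x y y) => //; rewrite qxy eZ /mv rl_refl; deq.
Qed.

Lemma move_of_adj Z : Q -- Z -> exists v w, rl Z =2 mv q v w.
Proof.
move=> /adjP[_ [v av]].
have [/singleP sv|/nsingleP[w wv vw]] := boolP (single (rl Z) v).
  exists v, v => x y; rewrite /mv eqxx /=.
  case: (eqVneq x v) => [->|xv].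
    by rewrite orbF; apply/idP/eqP => [/sv|->]; rewrite ?rl_refl.
  case: (eqVneq y v) => [->|yv]; last by rewrite av.
  by rewrite rl_sym; apply/negP => /sv e; rewrite e eqxx in xv.
exists v, w => x y; rewrite /mv wv /=.
have ev := eqv_class (rl_eqv Z) vw.
case: (eqVneq x v) => [->|xv].
  case: (eqVneq y v) => [->|yv]; first by rewrite rl_refl.
  by rewrite ev av.
case: (eqVneq y v) => [->|yv]; last by rewrite av.
by rewrite rl_sym ev av.
Qed.

(** A neighbour isolates [v] or moves it into the class of [w]. Isolation from a pair is [tau] of
    that pair, and from a triple [tau] of the other two vertices. A target class with two vertices
    would form a triangle with [v], against [pair_triangle], so [w] is a singleton and [tau_mv]
    applies. *)
Lemma tau_onto Z : Q -- Z -> exists x y, h x y /\ rl Z =2 tau x y.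
Proof.
move=> QZ; have [v [w eZ]] := move_of_adj QZ.
have [e|nwv] := eqVneq w v.
  subst w; have [sv|/nsingleP[u /eqP uv vu]] := boolP (single q v).
    case: (adj_neq QZ); apply: rl_inj => x y; rewrite eZ /mv eqxx /=.
    case: (eqVneq x v) => [->|xv]; first by rewrite (single_rl _ sv) orbF eq_sym.
    by case: (eqVneq y v) => [->|yv] //; rewrite (single_rlC _ sv) eq_sym (negPf xv).
  have [p|np] := boolP (pair_part v u).
    exists v, u; split; first by apply: rl_h vu _; apply/eqP/nesym.
    by move=> x y; rewrite eZ (tau_out2 p (nesym uv)).
  have [z [vz nzv nzu]] : exists z, [/\ q v z, z <> v & z <> u].
    move: np; rewrite /pair_part vu /= negb_forall => /existsP[z].
    by rewrite negb_imply negb_or => /and3P[? /eqP ? /eqP ?]; exists z.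
  have uz : q u z by apply: rl_trans vz; rewrite rl_sym.
  have uv' : q u v by rewrite rl_sym.
  exists u, z; split; first by apply: rl_h uz _; apply/eqP/nesym.
  by move=> x y; rewrite eZ (@tau_out3 u z v) //; neqs.
have Zvw : rl Z v w by rewrite eZ /mv eqxx nwv rl_refl orbT.
have hvw : h v w by apply: rl_h Zvw _; rewrite eq_sym.
have nqvw : ~~ q v w.
  apply/negP => vw; case: (adj_neq QZ); apply: rl_inj => x y; rewrite eZ /mv nwv /=.
  have ew := eqv_class (rl_eqv Q) vw.
  case: (eqVneq x v) => [->|xv].
    by case: (eqVneq y v) => [->|yv] //=; rewrite ?rl_refl // ew.
  by case: (eqVneq y v) => [->|yv] //=; rewrite rl_sym ew.
have sw : single q w.
  apply/negPn/negP => /nsingleP[w' /eqP ww qww].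
  have wv' : w' != v.
    by apply: contra nqvw => /eqP <-; rewrite rl_sym.
  have Zvw' : rl Z v w' by rewrite eZ /mv eqxx nwv (negPf wv').
  have hvw' : h v w' by apply: rl_h Zvw' _; rewrite eq_sym.
  apply: (@pair_triangle _ _ _ zQ kn w w' v); rewrite 1?h_sym //; try neqs.
  by rewrite rl_sym.
by exists v, w; split=> // x y; rewrite eZ tau_mv.
Qed.

(** All edges at [x] split the same parts, so their images agree off [x]. Otherwise some end, say
    [w], would lie in a nontrivial part not containing [x]. Then [x] is a singleton, and its other
    neighbour [y] contradicts [pair_leaf] or [two_parts_edge]. *)
Lemma base_eq x y w u v : h x y -> h x w -> u <> v -> base x y u v = base x w u v.
Proof.
suff H a b c : h a b -> h a c -> u <> v -> base a b u v -> base a c u v.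
  by move=> *; apply/idP/idP; apply: H.
move=> ab ac nuv; rewrite /base; case: (u =P v) => //= _.
case/and3P => quv nua nub; rewrite quv nua /=; apply/negP => uc.
have [c' nc cc] : exists2 c', c' != c & q c c'.
  case: (eqVneq u c) => [<-|n]; last by exists u; rewrite // rl_sym.
  by exists v; rewrite // eq_sym; apply/eqP.
have nac : ~~ q a c.
  by apply: contra nua => ac'; apply: (rl_trans uc); rewrite rl_sym.
have nbc : ~~ q c b by apply: contra nub; apply: rl_trans.
have sa : single q a.
  have [//|sc] := edge_single ac nac; by rewrite (nsingle_of _ cc) // in sc; apply/eqP;
    rewrite eq_sym.
have ncc : c <> c' by apply/eqP; rewrite eq_sym.
have [sb|/nsingleP[b' /eqP nb bb]] := boolP (single q b).
  by apply: (pair_leaf zQ kn cc ncc sa sb); rewrite // h_sym.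
by apply: (two_parts_edge zQ sa cc bb ncc (nesym nb) nbc); rewrite h_sym.
Qed.

Lemma tau_adj x y w Z Z' : h x y -> h x w -> y <> w ->
  rl Z =2 tau x y -> rl Z' =2 tau x w -> Z -- Z'.
Proof.
move=> xy xw nyw eZ eZ'.
have nxy : x <> y by apply/eqP/h_neq.
have nxw : x <> w by apply/eqP/h_neq.
have ag : agree_off x (rl Z) (rl Z').
  move=> u v ux vx; rewrite eZ eZ'; case: (u =P v) => [->|uv].
    by rewrite /tau /base eqxx.
  rewrite /tau (base_eq xy xw uv) /erel (negPf ux) (negPf vx) !andbF !orbF.
  by case: (u =P v) => //; rewrite !andbF.
have d a b : x <> a -> x <> b -> a <> b -> tau x a x b = false.
  move=> xa xb ab; rewrite /tau /base /erel rl_refl /= !andbF /=; deq.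
have [p|np] := boolP (pair_part x y).
  apply: (adj_off ag (y := w) (x := x)); rewrite eZ eZ' (d y w) //.
  rewrite tau_diag // ; have /pair_partP[qxy _] := p.
  have -> // : pair_part x w = false.
  by apply/negbTE/negP => /pair_partP[_ /(_ y qxy)] [] ?; subst.
by apply: (adj_off ag (y := y) (x := x)); rewrite eZ eZ' (d w y) ?tau_diag ?np //; neqs.
Qed.

(** The two images differ on [xy], which makes [v] an end of it, unless [xy] lies in a triple, where
    both images keep the pair; there they differ on the pairs through the third vertex, which is
    then [v]. Applied to both edges this leaves no candidate for [v], whence [tau_nadj]. *)
Lemma tau_disjoint x y z w Z Z' v : h x y -> h z w ->
  x <> z -> x <> w -> y <> z -> y <> w ->
  rl Z =2 tau x y -> rl Z' =2 tau z w -> agree_off v (rl Z) (rl Z') ->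
  (v = x \/ v = y) \/ [/\ q x y, q x v, v <> x & v <> y] /\ [/\ v <> z, v <> w & ~~ q x z].
Proof.
move=> xy zw nxz nxw nyz nyw eZ eZ' ag.
have nxy : x <> y by apply/eqP/h_neq.
have cov s t : tau x y s t != tau z w s t -> s = v \/ t = v.
  move=> d; case: (eqVneq s v) => [|sv]; first by left.
  case: (eqVneq t v) => [|tv]; first by right.
  by rewrite -eZ -eZ' ag ?eqxx in d.
have ezw s t : s <> t -> s <> z -> s <> w ->
   tau z w s t = [&& q s t, ~~ q s z & ~~ q s w].
  by move=> *; rewrite /tau /base /erel; deq.
case qxy: (q x y); last first.
  left; case: (cov x y) => [|->|->]; auto.
  by rewrite tau_diag // /pair_part qxy ezw // qxy.
have [p|np] := boolP (pair_part x y).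
  left; case: (cov x y) => [|->|->]; auto.
  have /pair_partP[_ H] := p.
  have F t : t <> x -> t <> y -> q x t = false by move=> ? ?; apply/negP => /H[].
  by rewrite tau_diag // p ezw // qxy !F //; neqs.
have [t [xt ntx nty]] : exists t, [/\ q x t, t <> x & t <> y].
  move: np; rewrite /pair_part qxy /= negb_forall => /existsP[t].
  by rewrite negb_imply negb_or => /and3P[? /eqP ? /eqP ?]; exists t.
have tx : q t x by rewrite rl_sym.
have ty : q t y by apply: rl_trans qxy.
have ntz : t <> z.
  move=> e; subst z; have ntw : t <> w by apply/eqP/h_neq.
  by move: zw; rewrite (triple_edge zQ tx ty) //; neqs.
have ntw : t <> w.
  move=> e; subst w; have ntz' : z <> t by apply/eqP/h_neq.
  by move: zw; rewrite h_sym (triple_edge zQ tx ty) //; neqs.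
have rx := triple_third qxy xt nxy (nesym ntx) (nesym nty).
have ry u : q y u = [|| u == x, u == y | u == t] by rewrite -rx (eqv_class (rl_eqv Q) qxy).
have vt : v = t.
  have c1 : x = v \/ t = v.
    apply: cov; rewrite ezw; try neqs; rewrite xt !rx /tau /base /erel rl_refl.
    by deq.
  have c2 : y = v \/ t = v.
    apply: cov; rewrite ezw; try neqs; rewrite !ry /tau /base /erel rl_refl.
    by deq.
  by case: c1 c2 => ? [] ?; subst; try neqx.
by right; rewrite vt; split; split; rewrite // rx; deq.
Qed.

Lemma tau_nadj x y z w Z Z' : h x y -> h z w ->
  x <> z -> x <> w -> y <> z -> y <> w ->
  rl Z =2 tau x y -> rl Z' =2 tau z w -> ~~ (Z -- Z') /\ Z <> Z'.
Proof.
move=> xy zw nxz nxw nyz nyw eZ eZ'.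
have main v : agree_off v (rl Z) (rl Z') -> False.
  move=> ag; have ag' : agree_off v (rl Z') (rl Z) by move=> s t ? ?; rewrite ag.
  have [c1|[[qxy qxv vx vy] [vz vw nqxz]]] := tau_disjoint xy zw nxz nxw nyz nyw eZ eZ' ag;
  have [c2|[[qzw qzv vz' vw'] [vx' vy' _]]] :=
    tau_disjoint zw xy (nesym nxz) (nesym nyz) (nesym nxw) (nesym nyw) eZ' eZ ag'.
  - by case: c1 c2 => ? [] ?; subst; try neqx.
  - by case: c1 => ?; subst; try neqx.
  - by case: c2 => ?; subst; try neqx.
  by case/negP: nqxz; apply: (rl_trans qxv); rewrite rl_sym.
split; first by apply/negP => /adjP[_ [v /main]].
by move=> e; subst Z'; apply: (main x).
Qed.

End Tau.

(** * Common neighbours of the three edges of a star *)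

Section Stars.
Variables (G : sgraph) (k : nat).
Local Notation h := (@nonedge G).
Local Notation B := (bell_geq G k).
Implicit Types (P O W X Y Z T : B) (a b c d u v x y z s p : G).

Section Common.
Variables (r : rel G) (W : B) (s : G).
Hypotheses (r_refl : forall x, r x x) (r_s : forall x, r s x = (s == x)).

(** [T2] adds nothing to [r], so a vertex moved from both [T1] and [T2] must be [a1]. Then the
    vertex moved from [T3] is [a3], and the changed pair is [a1 a3], where [W] is assumed to agree
    with [r]. *)
Lemma star_case T1 T2 T3 a1 a2 a3 x1 x2 x3 p u :
  (forall x y, rl T1 x y = r x y || erel s a1 x y) ->
  (forall x y, rl T2 x y = r x y) ->
  (forall x y, rl T3 x y = r x y || erel s a3 x y) ->
  a1 <> a2 -> a1 <> a3 -> a2 <> a3 -> s <> a1 -> s <> a2 -> s <> a3 ->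
  agree_off x1 (rl T1) (rl W) -> agree_off x2 (rl T2) (rl W) ->
  agree_off x3 (rl T3) (rl W) ->
  x1 <> s -> x3 <> s -> x1 = x2 -> r p u != rl W p u ->
  x1 = p \/ x1 = u -> x3 = p \/ x3 = u ->
  rl W a1 a3 = r a1 a3 -> rl W a3 a1 = r a3 a1 -> False.
Proof.
move=> e1 e2 e3 n12 n13 n23 s1 s2 s3 g1 g2 g3 xs1 xs3 x12 d c1 c3 w13 w31.
have xa1 : x1 = a1.
  apply/eqP/negPn/negP => n1.
  have := g1 s a1; rewrite -g2 -?x12 1?eq_sym //; try (by apply/eqP; neqs).
  by rewrite e1 e2 edge_in orbT r_s; deq => /(_ isT isT).
have Wsa3 : rl W s a3 = false.
  rewrite -g1; try (by apply/eqP; rewrite ?xa1; neqs).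
  by rewrite e1 r_s /erel; deq.
have xa3 : x3 = a3.
  apply/eqP/negPn/negP => n3.
  have := g3 s a3; rewrite Wsa3 e3 edge_in orbT => /(_ _ _)/negP; apply.
  - by apply/eqP; neqs.
  - by rewrite eq_sym.
  by [].
rewrite xa1 xa3 in c1 c3.
by case: c1 c3 d => ? [] ?; subst; rewrite ?w13 ?w31 ?eqxx; try neqx.
Qed.

(** [r] is the background shared by the three partitions, with the centre [s] isolated; a flag is
    false when [s] and the leaf form a part of [Q], since [tau] then joins nothing. If a pair [p u]
    away from [s] changed, each of the three moved vertices would be [p] or [u], so two of them
    would coincide. *)
Lemma star_common T1 T2 T3 a1 a2 a3 (b1 b2 b3 : bool) :
  (forall x y, rl T1 x y = r x y || b1 && erel s a1 x y) ->
  (forall x y, rl T2 x y = r x y || b2 && erel s a2 x y) ->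
  (forall x y, rl T3 x y = r x y || b3 && erel s a3 x y) ->
  a1 <> a2 -> a1 <> a3 -> a2 <> a3 -> s <> a1 -> s <> a2 -> s <> a3 ->
  T1 -- W -> T2 -- W -> T3 -- W ->
  b1 || b2 -> b1 || b3 -> b2 || b3 ->
  ([&& b1, b2 & b3] \/
   forall x y, x \in [:: a1; a2; a3] -> y \in [:: a1; a2; a3] -> rl W x y = r x y) ->
  agree_off s r (rl W).
Proof.
move=> e1 e2 e3 n12 n13 n23 s1 s2 s3 /adjP[_ [x1 g1]] /adjP[_ [x2 g2]].
move=> /adjP[_ [x3 g3]] b12 b13 b23 Hb p u ps us.
apply/eqP/negPn/negP => d.
have puT T a (b : bool) : (forall x y, rl T x y = r x y || b && erel s a x y) ->
    rl T p u = r p u.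
  move=> e; rewrite e /erel (negPf ps) (negPf us) !andbF !orbF.
  by case: (p =P u) => [->|]; rewrite ?r_refl ?andbF ?orbF.
have cov T a (b : bool) x : (forall x y, rl T x y = r x y || b && erel s a x y) ->
    agree_off x (rl T) (rl W) -> x <> s /\ (x = p \/ x = u).
  move=> e g; split.
    by move=> xs; subst x; move: d; rewrite -(puT _ _ _ e) g ?eqxx.
  case: (eqVneq p x) => [|px]; first by auto.
  case: (eqVneq u x) => [|ux]; first by auto.
  by move: d; rewrite -(puT _ _ _ e) g ?eqxx.
have [xs1 c1] := cov _ _ _ _ e1 g1; have [xs2 c2] := cov _ _ _ _ e2 g2.
have [xs3 c3] := cov _ _ _ _ e3 g3.
(* A vertex moved from both [T] and [T'] would have to be [a], because only [T] relates [s] to [a],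
   and for the same reason [a']. *)
have two T T' a a' x x' : a <> a' -> s <> a -> s <> a' ->
    (forall x y, rl T x y = r x y || erel s a x y) ->
    (forall x y, rl T' x y = r x y || erel s a' x y) ->
    agree_off x (rl T) (rl W) -> agree_off x' (rl T') (rl W) ->
    x <> s -> x = x' -> False.
  move=> naa sa sa' e e' g g' xs xx; subst x'.
  have xa : x = a.
    apply/eqP/negPn/negP => n.
    have := g s a; rewrite -g' 1?eq_sym //; try (by apply/eqP; neqs).
    by rewrite e e' r_s /erel; deq => /(_ isT isT).
  have := g s a'; rewrite -g' xa; try (by apply/eqP; neqs).
  rewrite e e' edge_in r_s /erel orbT; deq.
  by move=> /(_ isT isT).
have eb T a (b : bool) : b -> (forall x y, rl T x y = r x y || b && erel s a x y) ->
  forall x y, rl T x y = r x y || erel s a x y by move=> ->.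
have ebF T a (b : bool) : ~~ b -> (forall x y, rl T x y = r x y || b && erel s a x y) ->
  forall x y, rl T x y = r x y by move=> /negPf-> e x y; rewrite e orbF.
have Hw x y (bF : ~~ [&& b1, b2 & b3]) : x \in [:: a1; a2; a3] -> y \in [:: a1; a2; a3] ->
   rl W x y = r x y by case: Hb bF => [->|H _] //; apply: H.
have step T T' T'' a a' a'' (b b' b'' : bool) x x' x'' :
   (forall x y, rl T x y = r x y || b && erel s a x y) ->
   (forall x y, rl T' x y = r x y || b' && erel s a' x y) ->
   (forall x y, rl T'' x y = r x y || b'' && erel s a'' x y) ->
   a <> a' -> a <> a'' -> a' <> a'' -> s <> a -> s <> a' -> s <> a'' ->
   agree_off x (rl T) (rl W) -> agree_off x' (rl T') (rl W) ->
   agree_off x'' (rl T'') (rl W) -> x <> s -> x'' <> s ->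
   (x = p \/ x = u) -> (x'' = p \/ x'' = u) ->
   (~~ b || ~~ b' -> ~~ [&& b1, b2 & b3]) ->
   {subset [:: a; a'; a''] <= [:: a1; a2; a3]} ->
   b || b' -> b || b'' -> b' || b'' -> x = x' -> False.
  move=> e e' e'' naa' naa'' na'a'' sa sa' sa'' g g' g'' xs xs'' c c'' bF sub bb' bb'' b'b'' xx.
  have ia : a \in [:: a1; a2; a3] by apply: sub; rewrite !inE eqxx.
  have ia' : a' \in [:: a1; a2; a3] by apply: sub; rewrite !inE eqxx orbT.
  have ia'' : a'' \in [:: a1; a2; a3] by apply: sub; rewrite !inE eqxx !orbT.
  have [Eb|Eb] := boolP b; have [Eb'|Eb'] := boolP b'.
  - exact: (two _ _ _ _ _ _ naa' sa sa' (eb _ _ _ Eb e) (eb _ _ _ Eb' e') g g').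
  - have bF' := bF (introT orP (or_intror Eb')).
    rewrite (negPf Eb') /= in b'b''.
    apply: (star_case (eb _ _ _ Eb e) (ebF _ _ _ Eb' e') (eb _ _ _ b'b'' e'') naa' naa''
      na'a'' sa sa' sa'' g g' g'' xs xs'' xx d c c''); exact: Hw.
  - have bF' := bF (introT orP (or_introl Eb)).
    rewrite (negPf Eb) /= in bb''; subst x'.
    apply: (star_case (eb _ _ _ Eb' e') (ebF _ _ _ Eb e) (eb _ _ _ bb'' e'') (nesym naa')
      na'a'' naa'' sa' sa sa'' g' g g'' xs xs'' erefl d c c''); exact: Hw.
  by rewrite (negPf Eb) (negPf Eb') in bb'.
have bF1 : ~~ b1 || ~~ b2 -> ~~ [&& b1, b2 & b3] by rewrite !negb_and => /orP[]->;
  rewrite ?orbT.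
have bF2 : ~~ b1 || ~~ b3 -> ~~ [&& b1, b2 & b3] by rewrite !negb_and => /orP[]->;
  rewrite ?orbT.
have bF3 : ~~ b2 || ~~ b3 -> ~~ [&& b1, b2 & b3] by rewrite !negb_and => /orP[]->;
  rewrite ?orbT.
have [x12|[x13|x23]] : x1 = x2 \/ x1 = x3 \/ x2 = x3.
  by case: c1 c2 c3 => -> [] -> [] ->; auto.
- by apply: (step _ _ _ _ _ _ _ _ _ _ _ _ e1 e2 e3 n12 n13 n23 s1 s2 s3 g1 g2 g3 xs1 xs3 c1 c3
  bF1).
- apply: (step _ _ _ _ _ _ _ _ _ _ _ _ e1 e3 e2 n13 n12 (nesym n23) s1 s3 s2 g1 g3 g2 xs1 xs2
  c1 c2 bF2) => //; last by rewrite orbC.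
  by move=> z; rewrite !inE => /or3P[]->; rewrite ?orbT.
apply: (step _ _ _ _ _ _ _ _ _ _ _ _ e2 e3 e1 n23 (nesym n12) (nesym n13) s2 s3 s1 g2 g3 g1
  xs2 xs1 c2 c1 bF3) => //.
- by move=> z; rewrite !inE => /or3P[]->; rewrite ?orbT.
- by rewrite orbC.
by rewrite orbC.
Qed.

End Common.
End Stars.

(** The test for the sides of a triangle: [W] joins the triangle if its vertices are singletons of
    [Q], and splits it completely if it is a part of [Q]. *)
Definition common_away (B : sgraph) (Q X1 X2 X3 : B) :=
  exists W, [/\ W <> Q, ~~ (Q -- W), X1 -- W, X2 -- W & X3 -- W].

(** [T] is the change [X] performed after the change [Y]; for neighbours [X], [Y] of a zero-like [Q]
    it is unique by [zl_un]. Three such [T] next to one [W] repeat [common_away] around [Y]. *)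
Definition joint (B : sgraph) (Q Y W X T : B) :=
  [/\ Y <> X, ~~ (Y -- X), Y -- T, X -- T & [/\ T <> Q, ~~ (Q -- T) & T -- W]].

(* The second alternative serves when Q has one part too few for the partition
   joining a triangle to exist next to its three edges: a part of Q is split
   first. *)
Definition triangle_like (B : sgraph) (Q X1 X2 X3 : B) :=
  common_away Q X1 X2 X3 \/
  exists Y W, [/\ Q -- Y, W <> Y, ~~ (Y -- W) &
    exists T1 T2 T3, [/\ joint Q Y W X1 T1, joint Q Y W X2 T2 & joint Q Y W X3 T3]].

Section Iso.
Variables (B C : sgraph) (f : B -> C).
Hypotheses (f_bij : bijective f) (fE : forall x y, (f x -- f y) = (x -- y)).

Lemma common_away_iso Q X1 X2 X3 :
  common_away Q X1 X2 X3 -> common_away (f Q) (f X1) (f X2) (f X3).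
Proof.
case=> W [WQ QW XW1 XW2 XW3]; exists (f W); rewrite !fE; split=> //.
by move/(bij_inj f_bij).
Qed.

Lemma joint_iso Q Y W X T :
  joint Q Y W X T -> joint (f Q) (f Y) (f W) (f X) (f T).
Proof.
case=> YX nYX YT XT [TQ QT TW]; split; rewrite ?fE //.
  by move/(bij_inj f_bij).
by split=> //; move/(bij_inj f_bij).
Qed.

Lemma triangle_like_iso Q X1 X2 X3 :
  triangle_like Q X1 X2 X3 -> triangle_like (f Q) (f X1) (f X2) (f X3).
Proof.
case=> [/common_away_iso|[Y [W [QY WY YW [T1 [T2 [T3 [J1 J2 J3]]]]]]]]; first by left.
right; exists (f Y), (f W); rewrite !fE; split=> //.
  by move/(bij_inj f_bij).
by exists (f T1), (f T2), (f T3); split; apply: joint_iso.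
Qed.

End Iso.

Section Triangles.
Variables (G : sgraph) (k : nat).
Local Notation h := (@nonedge G).
Local Notation B := (bell_geq G k).
Implicit Types (P O W X Y Z T : B) (a b c d u v x y z s p : G).

Lemma zero_star O X1 X2 X3 s a1 a2 a3 : is_zero O ->
  h s a1 -> h s a2 -> h s a3 -> a1 <> a2 -> a1 <> a3 -> a2 <> a3 ->
  rl X1 =2 erel s a1 -> rl X2 =2 erel s a2 -> rl X3 =2 erel s a3 ->
  ~ triangle_like O X1 X2 X3.
Proof.
move=> zO h1 h2 h3 n12 n13 n23 e1 e2 e3.
have s1 : s <> a1 by apply/eqP/h_neq.
have s2 : s <> a2 by apply/eqP/h_neq.
have s3 : s <> a3 by apply/eqP/h_neq.
have OX X a : h s a -> rl X =2 erel s a -> O -- X.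
  by move=> ha e; apply/(zero_adjP _ zO); exists s, a.
case=> [[W [WO nW W1 W2 W3]]|[Y [W [OY WY nYW [T1 [T2 [T3 [J1 J2 J3]]]]]]]].
  have i2 := zero_dist2_in zO h2 e2 WO nW W2.
  have i3 := zero_dist2_in zO h3 e3 WO nW W3.
  have [[c [ca cb eW]]|[c [d [cd /andP[ca cb] /andP[da db] eW]]]] := zero_dist2 zO h1 e1 WO nW
    W1.
    by move: i2 i3; rewrite !eW /trel; deq.
  by move: i2; rewrite eW /e2rel /erel; deq.
have /(zero_adjP _ zO)[c [d [cd eY]]] := OY.
have T_eq X T a : h s a -> rl X =2 erel s a -> joint O Y W X T ->
    forall x y, rl T x y = rl Y x y || erel s a x y.
  move=> ha eX [YX nYX YT XT [TO OT _]] x y.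
  by rewrite (zero_dist2_matching zO cd ha eY eX YX nYX TO OT YT XT) eY.
have sY x : rl Y s x = (s == x).
  case: J1 => YX1 nYX1 _ _ _.
  have := edges_nadj eY e1 cd h1 YX1 nYX1 => /and3P[/andP[sc sd] _ _].
  by rewrite eY /erel (negPf sc) (negPf sd) orbF.
have TW X T : joint O Y W X T -> T -- W by case=> _ _ _ _ [].
case: WY; apply/esym/eqP/negPn/negP => /eqP YW; case/negP: nYW; apply/adjP.
split=> //; exists s.
apply: (@star_common G k (rl Y) W s _ sY T1 T2 T3 a1 a2 a3 true true true) => //.
- exact: rl_refl.
- exact: T_eq h1 e1 J1.
- exact: T_eq h2 e2 J2.
- exact: T_eq h3 e3 J3.
- exact: TW J1.
- exact: TW J2.
- exact: TW J3.
by left.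
Qed.

Lemma zero_triangle O X1 X2 X3 x y z : k + 2 <= #|G| -> is_zero O ->
  h x y -> h y z -> h x z ->
  rl X1 =2 erel x y -> rl X2 =2 erel y z -> rl X3 =2 erel x z ->
  common_away O X1 X2 X3.
Proof.
move=> kn zO xy yz xz e1 e2 e3.
have nxy : x <> y by apply/eqP/h_neq.
have nyz : y <> z by apply/eqP/h_neq.
have nxz : x <> z by apply/eqP/h_neq.
have [||W [eW _]] := @rl_mv G k X1 z x.
- by move=> _ u _; rewrite e1 /erel => /or3P[/eqP<-|/andP[_ /eqP->]|/andP[_ /eqP->]];
    rewrite h_sym.
- have [|X [eX cX]] := edge_ex (_ : k + 1 <= #|G|) xy; first lia.
  by rewrite (edges_eq e1 eX); apply/or3P/Or33; lia.
have We u v : rl W u v = trel x y z u v.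
  by rewrite eW /mv !e1 /trel /erel; deq.
exists W; split.
- by apply: (@rl_neq G k _ _ x y); rewrite We zO /trel; deq.
- by apply: (@nadj3 G k _ _ x y z) => //; rewrite We zO /trel; deq.
- apply: (@adj_off G k _ _ z x z); last by rewrite We e1 /trel /erel; deq.
  by move=> u v ? ?; rewrite We e1 /trel /erel; deq.
- apply: (@adj_off G k _ _ x x z); last by rewrite We e2 /trel /erel; deq.
  by move=> u v ? ?; rewrite We e2 /trel /erel; deq.
apply: (@adj_off G k _ _ y x y); last by rewrite We e3 /trel /erel; deq.
by move=> u v ? ?; rewrite We e3 /trel /erel; deq.
Qed.

(** Joining three singletons loses two classes, which is the room assumed. [P] is arbitrary because
    the construction is used both at [Q] and at a partition obtained by splitting a part of [Q]. *)
Lemma triangle_over P x y z : h x y -> h y z -> h x z ->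
  single (rl P) x -> single (rl P) y -> single (rl P) z ->
  k + 1 < classes (rl P) ->
  exists T1 T2 T3 W, [/\ rl T1 =2 mv (rl P) x y, rl T2 =2 mv (rl P) y z,
    rl T3 =2 mv (rl P) x z, [/\ T1 -- W, T2 -- W & T3 -- W] &
    (forall u v, rl W u v = rl P u v ||
       (u \in [:: x; y; z]) && (v \in [:: x; y; z]))].
Proof.
move=> xy yz xz sx sy sz kP.
have nxy : x <> y by apply/eqP/h_neq.
have nyz : y <> z by apply/eqP/h_neq.
have nxz : x <> z by apply/eqP/h_neq.
have rx u : rl P x u = (x == u) by apply: single_rl.
have rx' u : rl P u x = (x == u) by apply: single_rlC.
have ry u : rl P y u = (y == u) by apply: single_rl.
have ry' u : rl P u y = (y == u) by apply: single_rlC.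
have rz u : rl P z u = (z == u) by apply: single_rl.
have rz' u : rl P u z = (z == u) by apply: single_rlC.
have kP' : k < classes (rl P) by apply: leq_ltn_trans kP; apply: leq_addr.
have [||T1 [e1 c1]] := @rl_mv G k P x y.
- by move=> _ u _; rewrite ry => /eqP <-.
- by rewrite kP' !orbT.
have [||T2 [e2 _]] := @rl_mv G k P y z.
- by move=> _ u _; rewrite rz => /eqP <-.
- by rewrite kP' !orbT.
have [||T3 [e3 _]] := @rl_mv G k P x z.
- by move=> _ u _; rewrite rz => /eqP <-.
- by rewrite kP' !orbT.
have [||W [eW _]] := @rl_mv G k T1 z x.
- move=> _ u _; rewrite e1 /mv eqxx ry; case: eqP => [->|_] /=; first by rewrite h_sym.
  by rewrite andbC; case: eqP => //= <- _; rewrite h_sym.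
- apply/or3P/Or33; move: c1; rewrite sx.
  have -> : (y == x) = false by apply/eqP; neqs.
  by clear -kP; lia.
have We u v : rl W u v = rl P u v ||
       (u \in [:: x; y; z]) && (v \in [:: x; y; z]).
  rewrite eW /mv !e1 /mv !inE; deq; rewrite ?rx ?rx' ?ry ?ry' ?rz ?rz' ?rl_refl; deq.
exists T1, T2, T3, W; split=> //; split.
- apply: (@adj_off G k _ _ z x z); last by rewrite We e1 /mv !inE ?ry ?rx; deq;
  rewrite ?rx ?ry ?rz; deq.
  by move=> u v ? ?; rewrite We e1 /mv !inE; deq; rewrite ?rx ?rx' ?ry ?ry'; deq.
- apply: (@adj_off G k _ _ x x z); last by rewrite We e2 /mv !inE; deq; rewrite ?rx ?ry ?rz;
  deq.
  by move=> u v ? ?; rewrite We e2 /mv !inE; deq; rewrite ?rz ?rz' ?ry ?ry'; deq.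
apply: (@adj_off G k _ _ y x y); last by rewrite We e3 /mv !inE; deq; rewrite ?rx ?ry ?rz; deq.
by move=> u v ? ?; rewrite We e3 /mv !inE; deq; rewrite ?rx ?rx' ?rz ?rz'; deq.
Qed.

Variables (Q : B) (zQ : zero_like Q).
Hypothesis kn : k + 2 <= #|G|.
Local Notation q := (rl Q).

(** By [base_eq] the three images share the background [base Q s a1], so [star_common] shows that a
    common neighbour changes only at [s]; it is then adjacent to [Q]. *)
Lemma tau_star s a1 a2 a3 Z1 Z2 Z3 :
  h s a1 -> h s a2 -> h s a3 -> a1 <> a2 -> a1 <> a3 -> a2 <> a3 ->
  rl Z1 =2 tau Q s a1 -> rl Z2 =2 tau Q s a2 -> rl Z3 =2 tau Q s a3 ->
  ~ common_away Q Z1 Z2 Z3.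
Proof.
move=> h1 h2 h3 n12 n13 n23 e1 e2 e3 [W [WQ nW W1 W2 W3]].
have s1 : s <> a1 by apply/eqP/h_neq.
have s2 : s <> a2 by apply/eqP/h_neq.
have s3 : s <> a3 by apply/eqP/h_neq.
have be a : h s a -> forall u v, base Q s a u v = base Q s a1 u v.
  move=> ha u v; case: (u =P v) => [->|uv]; first by rewrite /base eqxx.
  exact: base_eq.
have bs x : base Q s a1 s x = (s == x) by rewrite /base rl_refl andbF orbF.
have br x : base Q s a1 x x by rewrite /base eqxx.
have np a b : pair_part Q s a -> pair_part Q s b -> s <> b -> a = b.
  by move=> /pair_partP[_ H] /pair_partP[qsb _] sb; case: (H b qsb) => // e; case: sb.
have np' a b : s <> b -> a <> b -> ~~ pair_part Q s a || ~~ pair_part Q s b.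
  by move=> sb nab; rewrite -negb_and; apply/negP => /andP[pa pb]; exact: nab (np _ _ pa pb sb).
(* If [s] and [a] form a part, [W] cannot join two neighbours of [s]: joining one to [a] would
   contradict [pair_triangle], and joining two leaves would contradict [pair_leaf]. *)
have pairW a : h s a -> pair_part Q s a -> forall x y,
    x <> y -> h s x -> h s y -> rl W x y = base Q s a1 x y.
  move=> ha pa x y nxy hx hy; have /pair_partP[qsa H] := pa.
  have sna : s <> a by apply/eqP/h_neq.
  have nsx t : h s t -> t <> a -> ~~ q s t /\ single q t.
    move=> ht ta; have nq : ~~ q s t.
      by apply/negP => /H[] // e; have := h_neq ht; rewrite e eqxx.
    split=> //; have [ss|//] := edge_single zQ ht nq.
    by rewrite (nsingle_of sna qsa) in ss.
  have nW_a t : h s t -> t <> a -> rl W a t = false.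
    move=> ht ta; apply/negP => wat; have [nq st] := nsx _ ht ta.
    apply: (pair_triangle zQ kn qsa sna nq ht); apply: rl_h wat _.
    by apply/eqP; neqs.
  have qas : q a s by rewrite rl_sym.
  have [xa|/eqP xa] := eqVneq x a.
    by subst x; rewrite nW_a ?/base ?qas ?andbF ?orbF; [deq|..|neqs].
  have [ya|/eqP ya] := eqVneq y a.
    subst y; rewrite rl_sym nW_a //; symmetry; rewrite /base; deq.
    apply/negP => /and3P[qxa nxs _]; case/negP: nxs; exact: rl_trans qas.
  have [nqx sx] := nsx _ hx xa; have [nqy sy] := nsx _ hy ya.
  rewrite /base (single_rl _ sx); deq.
  apply/negP => wxy; apply: (pair_leaf zQ kn qsa sna sx sy hx).
  by apply: rl_h wxy _; apply/eqP.
have inl x : x \in [:: a1; a2; a3] -> h s x.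
  by rewrite !inE => /or3P[] /eqP->.
have Hb : [&& ~~ pair_part Q s a1, ~~ pair_part Q s a2 & ~~ pair_part Q s a3] \/
   forall x y, x \in [:: a1; a2; a3] -> y \in [:: a1; a2; a3] -> rl W x y = base Q s a1 x y.
  have H a : h s a -> pair_part Q s a -> forall x y, x \in [:: a1; a2; a3] -> y \in [:: a1;
    a2; a3] -> rl W x y = base Q s a1 x y.
    move=> ha pa x y /inl hx /inl hy; have [->|/eqP nxy] := eqVneq x y;
      first by rewrite rl_refl br.
    exact: pairW ha pa _ _ _ _ _.
  case p1: (pair_part Q s a1); first by right; apply: (H a1).
  case p2: (pair_part Q s a2); first by right; apply: (H a2).
  case p3: (pair_part Q s a3); first by right; apply: (H a3).
  by left.
have ag := @star_common G k (base Q s a1) W s br bs Z1 Z2 Z3 a1 a2 a3 _ _ _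
  (fun x y => e1 x y) (fun x y => etrans (e2 x y) (congr1 (orb^~ _) (be a2 h2 x y)))
  (fun x y => etrans (e3 x y) (congr1 (orb^~ _) (be a3 h3 x y)))
  n12 n13 n23 s1 s2 s3 W1 W2 W3 (np' _ _ s2 n12) (np' _ _ s3 n13) (np' _ _ s3 n23) Hb.
(* It remains to replace the background by [Q]. Off [s] they can differ only in the parts of [s] and
   of [a1]. A part with [s] and two more vertices is a component of H, too small for three leaves;
   and by [base_eq] the part of [a1] would also contain [a2], forming a triangle with [s]. *)
case/negP: nW; apply/adjP; split; first neqs; exists s => u v us vs.
rewrite -ag // /base; case: (u =P v) => [->|uv]; first by rewrite rl_refl.
case quv: (q u v) => //=; symmetry.
have nus : ~~ q u s.
  apply/negP => qus; have qsu : q s u by rewrite rl_sym.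
  have qsv : q s v by apply: rl_trans quv.
  have tri a : h s a -> a = u \/ a = v.
    move=> ha; have [?|/eqP au] := eqVneq a u; first by left.
    have [?|/eqP av] := eqVneq a v; first by right.
    have sa : a <> s by apply/eqP; rewrite eq_sym h_neq.
    by move: ha; rewrite (triple_edge zQ qsu qsv) //; apply/eqP; rewrite // eq_sym.
  by case: (tri _ h1) (tri _ h2) (tri _ h3) => ? [] ? [] ?; subst; neqx.
rewrite nus /=; apply/negP => qu1.
have : base Q s a2 u v = false.
  by rewrite be // /base qu1 !andbF; apply/orP => -[/eqP|].
rewrite /base quv nus; case: (u =P v) => //= _ /negbT/negPn qu2.
have q12 : q a1 a2 by apply: rl_trans qu2; rewrite rl_sym.
have n1s : ~~ q a1 s by apply: contra nus; apply: rl_trans.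
by apply: (pair_triangle zQ kn q12 n12 n1s); rewrite h_sym.
Qed.

(** When the triangle is a part, the image of each side isolates one vertex, and the partition
    isolating all three is next to every image. *)
Lemma tau_triangle_part x y z Z1 Z2 Z3 : q x y -> q x z ->
  x <> y -> x <> z -> y <> z ->
  rl Z1 =2 tau Q x y -> rl Z2 =2 tau Q y z -> rl Z3 =2 tau Q x z ->
  common_away Q Z1 Z2 Z3.
Proof.
move=> qxy qxz nxy nxz nyz e1 e2 e3.
have qyx : q y x by rewrite rl_sym.
have qzx : q z x by rewrite rl_sym.
have qyz : q y z by apply: rl_trans qxz.
have f1 u v : rl Z1 u v = mv q z z u v by rewrite e1 (@tau_out3 _ _ _ zQ x y z).
have f2 u v : rl Z2 u v = mv q x x u v.
  by rewrite e2 (@tau_out3 _ _ _ zQ y z x) //; neqs.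
have f3 u v : rl Z3 u v = mv q y y u v.
  by rewrite e3 (@tau_out3 _ _ _ zQ x z y) //; neqs.
have rx := triple_third zQ qxy qxz nxy nxz nyz.
have rx' u : q u x = [|| u == x, u == y | u == z] by rewrite rl_sym rx.
have ry u : q y u = [|| u == x, u == y | u == z] by rewrite -rx (eqv_class (rl_eqv Q) qxy).
have ry' u : q u y = [|| u == x, u == y | u == z] by rewrite rl_sym ry.
have rz u : q z u = [|| u == x, u == y | u == z] by rewrite -rx (eqv_class (rl_eqv Q) qxz).
have rz' u : q u z = [|| u == x, u == y | u == z] by rewrite rl_sym rz.
have [W [eW _]] := out_ex Z2 y.
have We u v : rl W u v = (u == v) || q u v && (u \notin [:: x; y; z]).
  rewrite eW /mv !f2 /mv !inE; deq; rewrite ?rx ?rx' ?ry ?ry' ?rz ?rz' ?rl_refl; deq.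
exists W; split.
- by apply: (@rl_neq G k _ _ x y); rewrite We qxy !inE; deq.
- by apply: (@nadj3 G k _ _ x y z) => //; rewrite We !inE ?qxy ?qyz ?qxz; deq.
- apply: (@adj_off G k _ _ x x y); last by rewrite We f1 /mv !inE qxy; deq.
  by move=> u v ? ?; rewrite We f1 /mv !inE; deq; rewrite ?ry ?ry' ?rz ?rz' ?rl_refl; deq.
- apply: (@adj_off G k _ _ y y z); last by rewrite We f2 /mv !inE qyz; deq.
  by move=> u v ? ?; rewrite We f2 /mv !inE; deq; rewrite ?rx ?rx' ?rz ?rz' ?rl_refl; deq.
apply: (@adj_off G k _ _ z x z); last by rewrite We f3 /mv !inE qxz; deq.
by move=> u v ? ?; rewrite We f3 /mv !inE; deq; rewrite ?ry ?ry' ?rx ?rx' ?rl_refl; deq.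
Qed.

(** If [x] lay in a nontrivial part, [y] and [z] would be singletons joined to it and to each other,
    against [pair_leaf]. *)
Lemma triangle_single x y z : h x y -> h x z -> h y z ->
  ~~ q x y -> ~~ q x z -> ~~ q y z -> single q x.
Proof.
move=> xy xz yz nxy nxz nyz; apply/negPn/negP => nx.
have /nsingleP[x' /eqP xx qxx] := nx.
have [sx|sy] := edge_single zQ xy nxy; first by rewrite sx in nx.
have [sx|sz] := edge_single zQ xz nxz; first by rewrite sx in nx.
exact: (pair_leaf zQ kn qxx (nesym xx) sy sz xy yz).
Qed.

(** By [pair_triangle] a triangle lies inside one part or meets three, and then consists of
    singletons. Its sides show [k < classes q], while the join needs one class more. If that is
    lacking, [k + 1 < n] still provides a nontrivial part; splitting it gives [Y], and the second
    alternative of [triangle_like] holds. *)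
Lemma tau_triangle x y z Z1 Z2 Z3 : h x y -> h y z -> h x z ->
  rl Z1 =2 tau Q x y -> rl Z2 =2 tau Q y z -> rl Z3 =2 tau Q x z ->
  triangle_like Q Z1 Z2 Z3.
Proof.
move=> xy yz xz e1 e2 e3.
have nxy : x <> y by apply/eqP/h_neq.
have nyz : y <> z by apply/eqP/h_neq.
have nxz : x <> z by apply/eqP/h_neq.
have yx : h y x by rewrite h_sym.
have zx : h z x by rewrite h_sym.
have zy : h z y by rewrite h_sym.
have [/andP[qxy qxz]|nq] := boolP (q x y && q x z).
  by left; apply: (tau_triangle_part qxy qxz).
have PT a b c : q a b -> ~~ q a c -> h a b -> h a c -> h b c -> False.
  by move=> ab ac hab hac hbc; apply: (pair_triangle zQ kn ab _ ac); rewrite //;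
    apply/eqP/h_neq.
have nqxy : ~~ q x y.
  apply/negP => qxy; rewrite qxy /= in nq; exact: PT qxy nq xy xz yz.
have nqxz : ~~ q x z.
  by apply/negP => qxz; apply: PT qxz nqxy xz xy zy.
have nqyz : ~~ q y z.
  by apply/negP => qyz; apply: PT qyz _ yz yx zx; rewrite rl_sym.
have nqyx : ~~ q y x by rewrite rl_sym.
have nqzx : ~~ q z x by rewrite rl_sym.
have nqzy : ~~ q z y by rewrite rl_sym.
have sx := triangle_single xy xz yz nqxy nqxz nqyz.
have sy := triangle_single yx yz xz nqyx nqyz nqxz.
have sz := triangle_single zx zy xy nqzx nqzy nqxy.
have kq := singles_lt zQ kn xy sx sy.
have f1 u v : rl Z1 u v = mv q x y u v by rewrite e1 tau_mv.
have f2 u v : rl Z2 u v = mv q y z u v by rewrite e2 tau_mv.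
have f3 u v : rl Z3 u v = mv q x z u v by rewrite e3 tau_mv.
case: (leqP (classes q) (k + 1)) => [kq1|kq1]; last first.
  have [T1 [T2 [T3 [W [g1 g2 g3 [W1 W2 W3] We]]]]] :=
    triangle_over xy yz xz sx sy sz kq1.
  have <- : T1 = Z1 by apply: rl_inj => u v; rewrite f1 g1.
  have <- : T2 = Z2 by apply: rl_inj => u v; rewrite f2 g2.
  have <- : T3 = Z3 by apply: rl_inj => u v; rewrite f3 g3.
  left; exists W; split=> //.
    by apply: (@rl_neq G k _ _ x y); rewrite We (negPf nqxy) !inE; deq.
  by apply: (@nadj3 G k _ _ x y z) => //;
    rewrite We ?(negPf nqxy) ?(negPf nqyz) ?(negPf nqxz) !inE; deq.
case: (pickP (fun p : G * G => (p.1 != p.2) && q p.1 p.2)) => [[u v]|no]; last first.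
  have zQ0 : is_zero Q.
    move=> a b; have := no (a, b); have [->|ab] /= := eqVneq a b; rewrite ?rl_refl //.
  by have := zero_classes zQ0; clear -kn kq1; lia.
move=> /andP[/= /eqP nuv quv]; have qvu : q v u by rewrite rl_sym.
have nse t : single q t -> t <> u /\ t <> v.
  move=> st; split=> e; subst t; [move: quv|move: qvu]; rewrite (single_rl _ st);
    apply/negP/eqP; neqs.
have [nxu nxv] := nse _ sx; have [nyu nyv] := nse _ sy; have [nzu nzv] := nse _ sz.
have [Y [eY cY]] := out_ex Q v.
have sY t : single q t -> single (rl Y) t.
  move=> st; apply/singleP => b; have [_ ntv] := nse _ st.
  rewrite eY /mv; case: eqP => [//|_]; case: eqP => [_|_]; first by rewrite eqxx.
  by rewrite (single_rl _ st) => /eqP.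
have kY : k + 1 < classes (rl Y).
  by move: cY; rewrite (nsingle_of (nesym nuv) qvu); clear -kq; lia.
have [T1 [T2 [T3 [W [g1 g2 g3 [W1 W2 W3] We]]]]] :=
  triangle_over xy yz xz (sY _ sx) (sY _ sy) (sY _ sz) kY.
have nqF a b : a <> b -> single q a -> q a b = false.
  by move=> ab sa; rewrite (single_rl _ sa); apply/eqP.
have nYF a b : a <> b -> single q a -> rl Y a b = false.
  by move=> ab sa; rewrite (single_rl _ (sY _ sa)); apply/eqP.
have J a b Z T : a <> b -> h a b -> single q a -> single q b ->
    rl Z =2 mv q a b -> rl T =2 mv (rl Y) a b -> T -- W -> joint Q Y W Z T.
  move=> nab ab sa sb f g TW.
  have [nau nav] := nse _ sa; have [nbu nbv] := nse _ sb.
  have Zab : rl Z a b by rewrite f /mv rl_refl; deq.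
  have Tab : rl T a b by rewrite g /mv rl_refl; deq.
  have Zuv : rl Z u v by rewrite f /mv quv; deq.
  have Tuv : rl T u v = false by rewrite g /mv !eY /mv; deq.
  have Yuv : rl Y u v = false by rewrite eY /mv; deq.
  have nqab := nqF _ _ nab sa; have nYab := nYF _ _ nab sa.
  split.
  - by apply: (@rl_neq G k _ _ a b); rewrite nYab Zab.
  - by apply: (@nadj2 G k _ _ a b u v); try neqs; rewrite ?nYab ?Zab ?Zuv ?Yuv.
  - apply: (@adj_off G k _ _ a a b); last by rewrite nYab Tab.
    by move=> c d ? ?; rewrite g mv_off.
  - apply: (@adj_off G k _ _ v u v); last by rewrite Zuv Tuv.
    move=> c d ? ?; rewrite f g /mv; deq; rewrite ?eY /mv; deq.
  split=> //.
    by apply: (@rl_neq G k _ _ a b); rewrite nqab Tab.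
  by apply: (@nadj2 G k _ _ a b u v); try neqs; rewrite ?nqab ?Tab ?quv ?Tuv.
right; exists Y, W; split.
- by apply: (@adj_move _ _ _ Y v u v) => //; rewrite eY /mv qvu; deq.
- by apply: (@rl_neq G k _ _ x y); rewrite We nYF // !inE; deq.
- by apply: (@nadj3 G k _ _ x y z) => //; rewrite We nYF // !inE; deq.
by exists T1, T2, T3; split; [apply: (J x y)|apply: (J y z)|apply: (J x z)].
Qed.

End Triangles.

(** * Line graphs and Whitney's theorem *)

Section Line.
Variable H : sgraph.
Implicit Types (x y z u v : H) (A : {set H}).

Definition is_edge A := [exists x, exists y, (x -- y) && (A == [set x; y])].

Definition edges : finType := {A : {set H} | is_edge A}.

Definition line_rel : rel edges := fun e f =>
  (e != f) && [exists v, (v \in val e) && (v \in val f)].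

Lemma line_sym : symmetric line_rel.
Proof.
move=> e f; rewrite /line_rel eq_sym; congr (_ && _).
by apply: eq_existsb => v; rewrite andbC.
Qed.

Lemma line_irrefl : irreflexive line_rel.
Proof. by move=> e; rewrite /line_rel eqxx. Qed.

Definition line : sgraph := SGraph line_sym line_irrefl.

Implicit Types e f g : line.

Definition star e f g :=
  [exists v, [&& v \in val e, v \in val f & v \in val g]].

Lemma edge_neq x y : x -- y -> x != y.
Proof. by apply: contraTneq => ->; rewrite sg_irrefl. Qed.

Lemma edge_ends e : exists x y, x -- y /\ val e = [set x; y].
Proof.
have /existsP[x /existsP[y /andP[xy /eqP ->]]] := valP e.
by exists x, y.
Qed.

Lemma ex_edge x y : x -- y -> exists e, val e = [set x; y].
Proof.
move=> xy; have p : is_edge [set x; y].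
  by apply/existsP; exists x; apply/existsP; exists y; rewrite xy eqxx.
by exists (Sub [set x; y] p); rewrite SubK.
Qed.

Lemma edge_at e v : v \in val e -> exists w, v -- w /\ val e = [set v; w].
Proof.
have [x [y [xy ->]]] := edge_ends e; rewrite !inE => /orP[]/eqP ->.
  by exists y.
by exists x; rewrite sg_sym setUC.
Qed.

Lemma edge_eq2 e x y : x \in val e -> y \in val e -> x != y -> val e = [set x; y].
Proof.
move=> /edge_at[w [_ ->]]; rewrite !inE => /orP[]/eqP->; last by [].
by rewrite eqxx.
Qed.

Lemma edge_inj2 e f x y : x \in val e -> y \in val e -> x \in val f ->
  y \in val f -> x != y -> e = f.
Proof.
by move=> xe ye xf yf n; apply: val_inj; rewrite (edge_eq2 xe ye n) -(edge_eq2 xf yf n).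
Qed.

Lemma line_adjP e f : reflect (e <> f /\ exists v, v \in val e /\ v \in val f) (e -- f).
Proof.
apply: (iffP andP) => [[/eqP n /existsP[v /andP[ve vf]]]|[/eqP n [v [ve vf]]]].
  by split=> //; exists v.
by split=> //; apply/existsP; exists v; rewrite ve vf.
Qed.

Lemma line_adj e f v : e <> f -> v \in val e -> v \in val f -> e -- f.
Proof. by move=> n ve vf; apply/line_adjP; split=> //; exists v. Qed.

Lemma line_share e f u v : e -- f -> u \in val e -> u \in val f ->
  v \in val e -> v \in val f -> u = v.
Proof.
move=> /line_adjP[n _] ue uf ve vf; apply/eqP/negPn/negP => uv.
exact: n (edge_inj2 ue ve uf vf uv).
Qed.

Lemma starP e f g : reflect (exists v, [/\ v \in val e, v \in val f & v \in val g])
  (star e f g).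
Proof.
apply: (iffP existsP) => [[v /and3P[]]|[v [a b c]]]; exists v => //.
by rewrite a b c.
Qed.

(** For the complement of [G] this is the complement of [del_universal G]; isolated vertices leave
    no trace in the line graph. *)
Definition core := induced [set x : H | 0 < degree x].

Lemma degree_gt0P x : reflect (exists y, x -- y) (0 < degree x).
Proof.
rewrite card_gt0; apply: (iffP (set0Pn _)) => -[y]; first by rewrite inE; exists y.
by exists y; rewrite inE.
Qed.

End Line.

Definition line_iso (H K : sgraph) (f : line H -> line K) :=
  bijective f /\ forall e e', (f e -- f e') = (e -- e').

Definition star_iso (H K : sgraph) (f : line H -> line K) :=
  forall e1 e2 e3, e1 -- e2 -> e1 -- e3 -> e2 -- e3 ->
    star (f e1) (f e2) (f e3) = star e1 e2 e3.

(* A line graph isomorphism that respects stars comes from a bijection of the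
   nonisolated vertices. *)
Section Induced.
Variables (H K : sgraph) (f : line H -> line K).
Hypotheses (fi : line_iso f) (fs : star_iso f).

Local Lemma f_inj : injective f. Proof. exact: bij_inj fi.1. Qed.
Local Lemma fE e e' : (f e -- f e') = (e -- e'). Proof. exact: fi.2. Qed.

(** The clauses fix the image in three cases. A vertex of degree at least two goes to the common
    vertex of the images of its edges; a leaf goes to the end of its image edge that no adjacent
    edge uses; for an isolated edge the choice is free and is made by the orientations [oH] and
    [oK]. *)
Definition image_vertex (oH : line H -> H) (oK : line K -> K * K) (v : H) (u : K) :=
  [/\ forall e : line H, v \in val e -> u \in val (f e),
      forall e e' : line H, v \in val e ->
        (forall e'' : line H, v \in val e'' -> e'' = e) ->
        e -- e' -> u \notin val (f e')
    & forall e : line H, v \in val e -> (forall e', ~~ (e -- e')) ->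
        u = if v == oH e then (oK (f e)).1 else (oK (f e)).2].

(** The images of two edges at [v] meet in one vertex, and preservation of stars keeps all other
    edges at it. If [v] is a leaf, all edges meeting [e] pass through its other end; their images
    share a vertex [z] with [f e], and the image of [v] is the other end of [f e]. *)
Local Lemma image_ex oH oK v :
  (forall e : line K, val e = [set (oK e).1; (oK e).2]) ->
  0 < degree v -> exists u, image_vertex oH oK v u.
Proof.
move=> oKE /degree_gt0P[w vw]; have [e eE] := ex_edge vw.
have ve : v \in val e by rewrite eE !inE eqxx.
case: (pickP (fun e' : line H => (v \in val e') && (e' != e))) => [e' /andP[ve' ne']|no].
  have ee' : e -- e' by apply: line_adj ve ve'; apply/nesym/eqP.
  have /line_adjP[_ [u [ue ue']]] : f e -- f e' by rewrite fE.
  exists u; split.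
  - move=> g vg; have [->//|/eqP ge] := eqVneq g e; have [->//|/eqP ge'] := eqVneq g e'.
    have eg : e -- g by apply: line_adj ve vg; apply/nesym.
    have e'g : e' -- g by apply: line_adj ve' vg; apply/nesym.
    have /starP[z [ze ze' zg]] : star (f e) (f e') (f g).
      by rewrite fs //; apply/starP; exists v.
    by have -> : u = z by apply: (@line_share _ (f e) (f e')) => //; rewrite fE.
  - by move=> g g' vg u1 _; rewrite (u1 _ ve) -(u1 _ ve') eqxx in ne'.
  move=> g vg iso; have [ge|/eqP ge] := eqVneq g e.
    by have := iso e'; rewrite ge ee'.
  by have := iso e; rewrite (line_adj ge vg ve).
have uniq (g : line H) : v \in val g -> g = e.
  by move=> vg; apply/eqP; have := no g; rewrite vg /= => /negbFE.
case: (pickP (fun e' : line H => e -- e')) => [e' ee'|iso].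
  have /line_adjP[ff [z [ze ze']]] : f e -- f e' by rewrite fE.
  have [u [zu uE]] := edge_at ze; have ue : u \in val (f e) by rewrite uE !inE eqxx orbT.
  have nzu : z != u by apply: edge_neq.
  have nv (g : line H) : e -- g -> w \in val g /\ v \notin val g.
    move=> eg; have nvg : v \notin val g.
      by apply/negP => /uniq ge; move: eg; rewrite ge sg_irrefl.
    split=> //; have /line_adjP[_ [t []]] := eg.
    by rewrite eE !inE => /orP[] /eqP-> // vg; rewrite vg in nvg.
  exists u; split.
  - by move=> g /uniq ->.
  - move=> g g' /uniq -> _ eg'; apply/negP => ug'.
    have : f e -- f g' by rewrite fE.
    have [ge|/eqP ge] := eqVneq g' e'.
      by subst g' => fg; move: nzu; rewrite (line_share fg ze ze' ue ug') eqxx.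
    move=> fg; have [we' _] := nv _ ee'; have [wg' _] := nv _ eg'.
    have we : w \in val e by rewrite eE !inE eqxx orbT.
    have e'g' : e' -- g' by apply: line_adj we' wg'; apply/nesym.
    have /starP[t [te te' tg]] : star (f e) (f e') (f g').
      by rewrite fs //; apply/starP; exists w.
    have ffe : f e -- f e' by rewrite fE.
    have zt := line_share ffe ze ze' te te'; subst t.
    by move: nzu; rewrite (line_share fg ze tg ue ug') eqxx.
  by move=> g /uniq -> /(_ e'); rewrite ee'.
exists (if v == oH e then (oK (f e)).1 else (oK (f e)).2); split.
- by move=> g /uniq ->; rewrite oKE !inE; case: ifP; rewrite eqxx ?orbT.
- by move=> g g' /uniq -> _; rewrite iso.
by move=> g /uniq ->.
Qed.

(** Suppose both ends of [e] had one image. If both have a further edge, these and [e] would be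
    mapped to a star without being one; if only one has, the leaf clause is violated; if none has,
    the orientation separates the ends. *)
Local Lemma image_neq oH oK (e : line H) x y u v :
  (forall e : line H, exists2 t, e = e & val e = [set oH e; t]) ->
  (forall e : line K, val e = [set (oK e).1; (oK e).2] /\ (oK e).1 != (oK e).2) ->
  val e = [set x; y] -> x != y ->
  image_vertex oH oK x u -> image_vertex oH oK y v -> u <> v.
Proof.
move=> oHE oKE eE nxy [x1 x2 x3] [y1 y2 y3] uv; subst v.
have xe : x \in val e by rewrite eE !inE eqxx.
have ye : y \in val e by rewrite eE !inE eqxx orbT.
have nx (e' : line H) : y \in val e' -> e' != e -> x \notin val e'.
  by move=> ye' ne; apply: contra ne => xe'; apply/eqP; apply: edge_inj2 nxy.
have ny (e' : line H) : x \in val e' -> e' != e -> y \notin val e'.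
  by move=> xe' ne; apply: contra ne => ye'; apply/eqP; apply: edge_inj2 nxy.
case: (pickP (fun e' : line H => (x \in val e') && (e' != e))) => [e' /andP[xe' ne']|nox];
case: (pickP (fun e' : line H => (y \in val e') && (e' != e))) => [e2 /andP[ye2 ne2]|noy].
- have e'e2 : e' <> e2 by move=> e3; subst e2; have := ny _ xe' ne'; rewrite ye2.
  have fe'e2 : f e' -- f e2.
    by apply: (@line_adj _ _ _ u); [move/f_inj|apply: x1|apply: y1].
  have ee' : e -- e' by apply: line_adj xe xe'; apply/nesym/eqP.
  have ee2 : e -- e2 by apply: line_adj ye ye2; apply/nesym/eqP.
  have : star e e' e2.
    rewrite -fs // -?fE //; apply/starP; exists u; split; [exact: x1|exact: x1|exact: y1].
  case/starP=> t []; rewrite eE !inE => /orP[]/eqP ->.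
    by move=> _; apply/negP; apply: nx.
  by move=> ye'; have := ny _ xe' ne'; rewrite ye'.
- have uniq (g : line H) : y \in val g -> g = e.
    by move=> vg; apply/eqP; have := noy g; rewrite vg /= => /negbFE.
  have ee' : e -- e' by apply: line_adj xe xe'; apply/nesym/eqP.
  by have := y2 e e' ye uniq ee'; rewrite x1.
- have uniq (g : line H) : x \in val g -> g = e.
    by move=> vg; apply/eqP; have := nox g; rewrite vg /= => /negbFE.
  have ee' : e -- e2 by apply: line_adj ye ye2; apply/nesym/eqP.
  by have := x2 e e2 xe uniq ee'; rewrite y1.
have iso e' : ~~ (e -- e').
  apply/negP => /line_adjP[n [t []]]; rewrite eE !inE => /orP[]/eqP-> te'.
    by have := nox e'; rewrite te' /= => /negbFE/eqP e3; case: n.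
  by have := noy e'; rewrite te' /= => /negbFE/eqP e3; case: n.
have := x3 e xe iso; rewrite (y3 e ye iso).
have [_ n12] := oKE (f e); have [t _ oe] := oHE e.
have : oH e \in val e by rewrite oe !inE eqxx.
rewrite eE !inE => xo.
case: (x =P oH e) => ex; case: (y =P oH e) => ey e1.
- by rewrite ex -ey eqxx in nxy.
- by rewrite e1 eqxx in n12.
- by rewrite e1 eqxx in n12.
by case/orP: xo => /eqP e2; [case: ex|case: ey].
Qed.

Lemma line_iso_core : core H ~= core K.
Proof.
have [oK oKE] : exists oK : line K -> K * K, forall e : line K,
    val e = [set (oK e).1; (oK e).2] /\ (oK e).1 -- (oK e).2.
  have H0 (e : line K) : exists o : K * K, val e = [set o.1; o.2] /\ o.1 -- o.2.
    by have [x [y [xy eE]]] := edge_ends e; exists (x, y).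
  exact: fin_all_exists H0.
have [oH oHE] : exists oH : line H -> H, forall e : line H,
    exists2 t, e = e & val e = [set oH e; t].
  have H0 (e : line H) : exists o, exists2 t, e = e & val e = [set o; t].
    by have [x [y [xy eE]]] := edge_ends e; exists x, y.
  exact: fin_all_exists H0.
have oKE' (e : line K) : val e = [set (oK e).1; (oK e).2] /\ (oK e).1 != (oK e).2.
  by have [? /edge_neq] := oKE e.
have [F FE] : exists F : core H -> K, forall x, image_vertex oH oK (val x) (F x).
  have H0 (x : core H) : exists u, image_vertex oH oK (val x) u.
    apply: image_ex; first by move=> e; case: (oKE e).
    by have := valP x; rewrite inE.
  exact: fin_all_exists H0.
have FfE (x y : core H) (e : line H) : val e = [set val x; val y] -> val x != val y ->
    val (f e) = [set F x; F y].
  move=> eE nxy; have nF := image_neq oHE oKE' eE nxy (FE x) (FE y).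
  apply: edge_eq2; last exact/eqP.
    by have [H1 _ _] := FE x; apply: H1; rewrite eE !inE eqxx.
  by have [H1 _ _] := FE y; apply: H1; rewrite eE !inE eqxx orbT.
have edge_mem (x : core H) : exists (y : core H) (e : line H),
    (val x -- val y) /\ val e = [set val x; val y].
  have := valP x; rewrite inE => /degree_gt0P[y xy].
  have y0 : y \in [set y : H | 0 < degree y].
    by rewrite inE; apply/degree_gt0P; exists (val x); rewrite sg_sym.
  by have [e eE] := ex_edge xy; exists (Sub y y0), e; rewrite SubK.
have noloop (x y : core H) (e : line H) :
    val e = [set val x; val y] -> val x != val y -> F x <> F y.
  by move=> eE nxy; apply: image_neq oHE oKE' eE nxy (FE x) (FE y).
(* For [F x = F y] take edges [xx'] and [yy']. Their images meet at [F x], so they meet as well;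
   this leaves only [x' = y'], and then their images coincide. *)
have Finj : injective F.
  move=> x y Fxy; apply/eqP/negPn/negP => nxy.
  have nxy' : val x != val y by rewrite val_eqE.
  have [x' [e [xx eE]]] := edge_mem x; have [y' [e' [yy e'E]]] := edge_mem y.
  have fe := FfE _ _ _ eE (edge_neq xx); have fe' := FfE _ _ _ e'E (edge_neq yy).
  have nxe' : val x' != val y.
    by apply/eqP => xy'; rewrite xy' in eE; apply: (noloop x y e).
  have nye : val y' != val x.
    by apply/eqP => xy'; rewrite xy' in e'E; apply: (noloop y x e') => //; rewrite eq_sym.
  have [ee|/eqP ee] := eqVneq e e'.
    have : val y \in val e by rewrite ee e'E !inE eqxx.
    by rewrite eE !inE eq_sym (negPf nxy') /= eq_sym (negPf nxe').
  have /line_adjP[_ [t [te te']]] : e -- e'.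
    rewrite -fE; apply: (@line_adj _ _ _ (F x)).
    - by move/f_inj.
    - by rewrite fe !inE eqxx.
    by rewrite fe' Fxy !inE eqxx.
  move: te te'; rewrite eE e'E !inE => /orP[] /eqP->.
    by rewrite (negPf nxy') /= eq_sym (negPf nye).
  rewrite (negPf nxe') /= => /eqP xy'.
  have xy2 : x' = y' by apply: val_inj.
  by apply: ee; apply: f_inj; apply: val_inj; rewrite fe fe' Fxy xy2.
have Fadj (x y : core H) : (F x -- F y) = (val x -- val y).
  apply/idP/idP => [FF|xy]; last first.
    have [e eE] := ex_edge xy; have fe := FfE _ _ _ eE (edge_neq xy).
    have Fx : F x \in val (f e) by rewrite fe !inE eqxx.
    have [w [Fw]] := edge_at Fx; rewrite fe => /setP/(_ w).
    rewrite !inE eqxx orbT => /orP[] /eqP wE; last by rewrite -wE.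
    by rewrite wE sg_irrefl in Fw.
  have [e' e'E] := ex_edge FF; have [g gK fK] := fi.1.
  have [z [w [zw ezw]]] := edge_ends (g e').
  have z0 : z \in [set y : H | 0 < degree y] by rewrite inE; apply/degree_gt0P; exists w.
  have w0 : w \in [set y : H | 0 < degree y].
    by rewrite inE; apply/degree_gt0P; exists z; rewrite sg_sym.
  pose Z : core H := Sub z z0; pose W : core H := Sub w w0.
  have := FfE Z W (g e') ezw (edge_neq zw); rewrite fK e'E => /setP s.
  have := s (F x); have := s (F y); rewrite !inE !eqxx orbT /=.
  have nF := edge_neq FF.
  move=> /esym/orP[]/eqP/Finj ey /esym/orP[]/eqP/Finj ex; subst x y.
  - by rewrite eqxx in nF.
  - by rewrite /= sg_sym.
  - by [].
  by rewrite eqxx in nF.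
have F0 (x : core H) : F x \in [set y : K | 0 < degree y].
  have := valP x; rewrite inE => /degree_gt0P[y xy].
  have y0 : y \in [set y : H | 0 < degree y].
    by rewrite inE; apply/degree_gt0P; exists (val x); rewrite sg_sym.
  rewrite inE; apply/degree_gt0P; exists (F (Sub y y0)).
  by rewrite Fadj SubK.
pose F' (x : core H) : core K := Sub (F x) (F0 x).
apply/isoP; exists F'; split=> [|x y]; last by rewrite /= -Fadj.
have F'inj : injective F' by move=> x y /(congr1 val); rewrite !SubK => /Finj.
have F'onto (u : core K) : exists x, F' x = u.
  have := valP u; rewrite inE => /degree_gt0P[v uv].
  have [e' e'E] := ex_edge uv; have [g gK fK] := fi.1.
  have [z [w [zw ezw]]] := edge_ends (g e').
  have z0 : z \in [set y : H | 0 < degree y] by rewrite inE; apply/degree_gt0P; exists w.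
  have w0 : w \in [set y : H | 0 < degree y].
    by rewrite inE; apply/degree_gt0P; exists z; rewrite sg_sym.
  have := FfE (Sub z z0) (Sub w w0) (g e') ezw (edge_neq zw).
  rewrite fK e'E => /setP/(_ (val u)); rewrite !inE eqxx /= => /esym/orP[]/eqP uE.
    by exists (Sub z z0); apply: val_inj; rewrite SubK.
  by exists (Sub w w0); apply: val_inj; rewrite SubK.
have [g gE] := fin_all_exists F'onto.
by exists g => // x; apply: F'inj; rewrite gE.
Qed.

End Induced.

(** * Whitney's theorem: repairing isomorphisms that exchange stars and triangles *)

Definition no_triangle_component (H : sgraph) :=
  forall a b c : H, a -- b -> a -- c -> b -- c ->
  exists t d, [/\ t \in [:: a; b; c], d \notin [:: a; b; c] & t -- d].

Lemma nonstar_triangle (H : sgraph) (e1 e2 e3 : line H) :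
  e1 -- e2 -> e1 -- e3 -> e2 -- e3 -> ~~ star e1 e2 e3 ->
  exists a b c, [/\ val e1 = [set a; b], val e2 = [set a; c], val e3 = [set b; c] &
    [/\ a -- b, a -- c & b -- c]].
Proof.
move=> a12 a13 a23 ns.
have /line_adjP[n12 [a [ae1 ae2]]] := a12.
have /line_adjP[n13 [b [be1 be3]]] := a13.
have /line_adjP[n23 [c [ce2 ce3]]] := a23.
have nab : a != b.
  by apply: contra ns => /eqP e; apply/starP; exists a; split; rewrite // e.
have nac : a != c.
  by apply: contra ns => /eqP e; apply/starP; exists a; split; rewrite // e.
have nbc : b != c.
  by apply: contra ns => /eqP e; apply/starP; exists b; split; rewrite // e.
have adj (e : line H) u v : u \in val e -> v \in val e -> u != v -> u -- v.
  move=> ue ve uv; have [w [uw eE]] := edge_at ue.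
  by move: ve; rewrite eE !inE eq_sym (negPf uv) /= => /eqP->.
exists a, b, c; split; [exact: edge_eq2|exact: edge_eq2|exact: edge_eq2|].
by split; [exact: adj ae1 be1 nab|exact: adj ae2 ce2 nac|exact: adj be3 ce3 nbc].
Qed.

(** Empty exactly when [f] respects stars; its size is the measure by which the repair
    terminates. *)
Definition bad_triples (H K : sgraph) (f : line H -> line K) :
    {set line H * line H * line H} :=
  [set t | [&& t.1.1 -- t.1.2, t.1.1 -- t.2, t.1.2 -- t.2 &
     star (f t.1.1) (f t.1.2) (f t.2) != star t.1.1 t.1.2 t.2]].

Lemma starC12 (H : sgraph) (e f g : line H) : star e f g = star f e g.
Proof. by apply: eq_existsb => v; rewrite andbCA. Qed.

Lemma starC23 (H : sgraph) (e f g : line H) : star e f g = star e g f.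
Proof. by apply: eq_existsb => v; congr (_ && _); rewrite andbC. Qed.

Section Swap.
Variables (H K : sgraph) (f : line H -> line K).
Hypothesis fi : line_iso f.
Variables (a b c d : H) (e1 e2 e3 g : line H).
Hypotheses (E1 : val e1 = [set a; b]) (E2 : val e2 = [set a; c])
  (E3 : val e3 = [set b; c]) (Eg : val g = [set a; d]).
Hypotheses (nab : a != b) (nac : a != c) (nbc : b != c)
  (nda : d != a) (ndb : d != b) (ndc : d != c).
Hypothesis fstar : star (f e1) (f e2) (f e3).

Local Lemma finj : injective f. Proof. exact: bij_inj fi.1. Qed.

(** A triangle [abc] with a further edge [ad] whose triangle is sent to a star is the shape of
    Whitney's exceptional isomorphisms. Exchanging the opposite edges [bc] and [ad] undoes them. *)
Definition swap (e : line H) : line H :=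
  if e == e3 then g else if e == g then e3 else e.

Local Lemma ge3 : g != e3.
Proof.
apply/eqP => e; have : a \in val e3 by rewrite -e Eg !inE eqxx.
by rewrite E3 !inE (negPf nab) (negPf nac).
Qed.

Local Lemma swapK : involutive swap.
Proof.
move=> e; rewrite /swap; have n := ge3.
case: (eqVneq e e3) => [->|n1]; first by rewrite (negPf n) eqxx.
case: (eqVneq e g) => [->|n2]; first by rewrite eqxx.
by rewrite (negPf n1) (negPf n2).
Qed.

Local Lemma e12 : e1 -- e2.
Proof.
apply: (@line_adj _ _ _ a); rewrite ?E1 ?E2 ?inE ?eqxx //.
move=> e; have : b \in val e2 by rewrite -e E1 !inE eqxx orbT.
by rewrite E2 !inE eq_sym (negPf nab) (negPf nbc).
Qed.

Local Lemma e13 : e1 -- e3.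
Proof.
apply: (@line_adj _ _ _ b); rewrite ?E1 ?E3 ?inE ?eqxx ?orbT //.
move=> e; have : a \in val e3 by rewrite -e E1 !inE eqxx.
by rewrite E3 !inE (negPf nab) (negPf nac).
Qed.

Local Lemma e23 : e2 -- e3.
Proof.
apply: (@line_adj _ _ _ c); rewrite ?E2 ?E3 ?inE ?eqxx ?orbT //.
move=> e; have : a \in val e3 by rewrite -e E2 !inE eqxx.
by rewrite E3 !inE (negPf nab) (negPf nac).
Qed.

Local Lemma star_leaves : exists s p q r,
  [/\ val (f e1) = [set s; p], val (f e2) = [set s; q], val (f e3) = [set s; r]
    & [/\ s != p, s != q, s != r & [/\ p != q, p != r & q != r]]].
Proof.
have /starP[s [s1 s2 s3]] := fstar.
have [p [sp P]] := edge_at s1; have [q [sq Q]] := edge_at s2; have [r [sr R]] := edge_at s3.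
exists s, p, q, r; split=> //; split; try exact: edge_neq.
have nf (e e' : line H) x y : e -- e' -> val (f e) = [set s; x] -> val (f e') = [set s;
  y] -> x != y.
  move=> ee ex ey; apply/eqP => xy; case/line_adjP: ee => n _; apply: n.
  by apply: finj; apply: val_inj; rewrite ex ey xy.
by split; [exact: nf e12 P Q|exact: nf e13 P R|exact: nf e23 Q R].
Qed.

(** The image of [t] avoids the centre [s], since it would otherwise meet the image of [w]; so it
    passes through both leaves [p] and [q]. *)
Local Lemma two_legs s p q r (t u v w : line H) :
  val (f u) = [set s; p] -> val (f v) = [set s; q] -> val (f w) = [set s; r] ->
  p != q -> t -- u -> t -- v -> ~~ (t -- w) -> t <> w ->
  val (f t) = [set p; q].
Proof.
move=> U V W npq tu tv tw ntw.
have nst : s \notin val (f t).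
  apply: contra tw => st; rewrite -fi.2; apply: (@line_adj _ _ _ s) => //.
    by move/finj.
  by rewrite W !inE eqxx.
have leg (x : line H) y : t -- x -> val (f x) = [set s; y] -> y \in val (f t).
  rewrite -fi.2 => /line_adjP[_ [z [zt]]] + xE; rewrite xE !inE => /orP[]/eqP e.
    by rewrite -e zt in nst.
  by rewrite -e.
by apply: edge_eq2 npq; [apply: leg tu U|apply: leg tv V].
Qed.

Local Lemma legs_adj1 : g -- e1.
Proof.
apply: (@line_adj _ _ _ a); rewrite ?E1 ?Eg ?inE ?eqxx ?orbT //.
move=> e; have : d \in val e1 by rewrite -e Eg !inE eqxx orbT.
by rewrite E1 !inE (negPf nda) (negPf ndb).
Qed.

Local Lemma legs_adj2 : g -- e2.
Proof.
apply: (@line_adj _ _ _ a); rewrite ?E2 ?Eg ?inE ?eqxx ?orbT //.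
move=> e; have : d \in val e2 by rewrite -e Eg !inE eqxx orbT.
by rewrite E2 !inE (negPf nda) (negPf ndc).
Qed.

Local Lemma legs_nadj : ~~ (g -- e3).
Proof.
apply/negP => /line_adjP[_ [x []]]; rewrite Eg E3 !inE => /orP[]/eqP->.
  by rewrite (negPf nab) (negPf nac).
by rewrite (negPf ndb) (negPf ndc).
Qed.

Local Lemma line_sym' (e e' : line H) : (e -- e') = (e' -- e).
Proof. exact: sg_sym. Qed.

(** The exceptional piece is closed: [two_legs] determines the image of an edge meeting [bc] but not
    [a], this image meets that of [g = ad], and so the edge itself must end in [d]. All edges
    meeting [bc] or [ad] thus live on the four vertices a, b, c, d. *)
Local Lemma leg_cases s p q r : val (f e1) = [set s; p] -> val (f e2) = [set s; q] ->
  val (f e3) = [set s; r] -> p != q -> p != r -> q != r ->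
  val (f g) = [set p; q] /\ forall t : line H, t -- e3 \/ (t -- g /\ t <> e3) ->
    [\/ t = e1, t = e2, val t = [set b; d] /\ val (f t) = [set p; r]
      | val t = [set c; d] /\ val (f t) = [set q; r]].
Proof.
move=> P Q R npq npr nqr.
have gE : val (f g) = [set p; q].
  apply: (two_legs P Q R npq legs_adj1 legs_adj2 legs_nadj); exact/eqP/ge3.
split=> // t.
have meet (x y : line H) z : f x <> f y -> z \in val (f x) -> z \in val (f y) -> x -- y.
  by move=> n zx zy; rewrite -fi.2; apply: line_adj zx zy.
have ffn (x y : line H) : x <> y -> f x <> f y by move=> n /finj.
(* an edge at b or c away from a must go to d *)
have far (x y : H) (e : line H) p' q' : val e = [set a; y] -> x != a -> x != y ->
    val (f e) = [set s; q'] ->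
    (exists e' : line H, [/\ val e' = [set a; x], val (f e') = [set s; p'] &
      (p' == p) || (p' == q)]) -> (x == b) || (x == c) ->
    (forall z, z \in val e3 -> (z == x) || (z == y)) ->
    p' != r ->
    x \in val t -> a \notin val t -> y \notin val t -> t -- e3 ->
    val t = [set x; d] /\ val (f t) = [set p'; r].
  move=> eE xa xy fe [e' [e'E fe' p'pq]] xbc e3xy p'r xt nat nyt te3.
  have te' : t -- e'.
    apply: (line_adj _ xt); last by rewrite e'E !inE eqxx orbT.
    by move=> e0; case/negP: nat; rewrite e0 e'E !inE eqxx.
  have nte : ~~ (t -- e).
    apply/negP => /line_adjP[_ [z [zt]]]; rewrite eE !inE => /orP[]/eqP ez; subst z.
      by rewrite zt in nat.
    by rewrite zt in nyt.
  have tE : val (f t) = [set p'; r].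
    apply: (two_legs fe' R fe p'r te' te3 nte).
    by move=> e0; case/negP: nat; rewrite e0 eE !inE eqxx.
  split=> //.
  have ntg : t <> g by move=> e0; case/negP: nat; rewrite e0 Eg !inE eqxx.
  have /line_adjP[_ [z [zt]]] : t -- g.
    apply: (meet t g p'); first exact: ffn.
      by rewrite tE !inE eqxx.
    by rewrite gE !inE.
  rewrite Eg !inE => /orP[]/eqP ez; subst z; first by rewrite zt in nat.
  apply: edge_eq2 => //.
  by case/orP: xbc => /eqP->; rewrite eq_sym.
have e3case : t -- e3 -> [\/ t = e1, t = e2, val t = [set b; d] /\ val (f t) = [set p; r]
      | val t = [set c; d] /\ val (f t) = [set q; r]].
  move=> te3; have /line_adjP[nte3 [x [xt]]] := te3; rewrite E3 !inE => xbc.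
  have [at_|nat] := boolP (a \in val t).
    case/orP: xbc => /eqP ex; subst x.
      by constructor 1; apply: (@edge_inj2 _ t e1 a b) => //; rewrite E1 !inE eqxx ?orbT.
    by constructor 2; apply: (@edge_inj2 _ t e2 a c) => //; rewrite E2 !inE eqxx ?orbT.
  case/orP: xbc => /eqP ex; subst x.
    constructor 3; apply: (far b c e2 p q) => //; try by rewrite eq_sym.
    - by exists e1; rewrite eqxx.
    - by rewrite eqxx.
    - by move=> z; rewrite E3 !inE.
    by apply/negP => ct; apply: nte3; apply: (@edge_inj2 _ t e3 b c) => //;
      rewrite E3 !inE eqxx ?orbT.
  constructor 4; apply: (far c b e1 q p) => //; try by rewrite eq_sym.
  - by exists e2; rewrite eqxx orbT.
  - by rewrite eqxx orbT.
  - by move=> z; rewrite E3 !inE orbC.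
  by apply/negP => ct; apply: nte3; apply: (@edge_inj2 _ t e3 b c) => //;
    rewrite E3 !inE eqxx ?orbT.
case=> [/e3case //|[tg nte3]].
have [/e3case //|nt3] := boolP (t -- e3).
have [->|/eqP nt1] := eqVneq t e1; first by constructor 1.
have [->|/eqP nt2] := eqVneq t e2; first by constructor 2.
have /line_adjP[ntg [x [xt]]] := tg; rewrite Eg !inE => /orP[]/eqP ex; subst x.
  case: ntg; apply: finj; apply: val_inj; rewrite gE.
  apply: (two_legs P Q R npq _ _ nt3 nte3).
    by apply: (line_adj _ xt); rewrite // E1 !inE eqxx.
  by apply: (line_adj _ xt); rewrite // E2 !inE eqxx.
have nat : a \notin val t.
  apply/negP => at_; apply: ntg; apply: (@edge_inj2 _ t g a d) => //;
  by rewrite ?Eg ?inE ?eqxx ?orbT // eq_sym.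
have /line_adjP[_ [z [zt]]] : f t -- f g by rewrite fi.2.
have no x (e : line H) : e = e1 \/ e = e2 -> z \in val (f e) -> val e = [set a;
  x] -> x \in val e3 -> False.
  move=> e12' ze eE xe3.
  have nte : t <> e by case: e12' => ->.
  have /line_adjP[_ [y [yt]]] : t -- e by apply: (meet t e z) => //; exact: ffn.
  rewrite eE !inE => /orP[]/eqP ey; subst y; first by rewrite yt in nat.
  by case/negP: nt3; apply: line_adj yt xe3.
rewrite gE !inE => /orP[]/eqP ez; subst z.
  by case: (no b e1); [left|rewrite P !inE eqxx orbT| |rewrite E3 !inE eqxx].
by case: (no c e2); [right|rewrite Q !inE eqxx orbT| |rewrite E3 !inE eqxx orbT].
Qed.

(** By [leg_cases] the edges [e3] and [g] have the same neighbours, so exchanging them is an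
    automorphism of the line graph. No triple avoiding both edges changes, those containing one of
    them become good, and the bad triple [e1 e2 e3] is among these. *)
Lemma swap_iso : line_iso (f \o swap) /\
  #|bad_triples (f \o swap)| < #|bad_triples f|.
Proof.
have [s [p [q [r [P Q R [sp sq sr [npq npr nqr]]]]]]] := star_leaves.
have [gE cases] := leg_cases P Q R npq npr nqr.
have n3 := legs_nadj; have ng3 := ge3; have a1 := legs_adj1; have a2 := legs_adj2.
have twin t : t != e3 -> t != g -> (t -- g) = (t -- e3).
  move=> /eqP t3 /eqP tg; apply/idP/idP => tt.
    case: (cases t (or_intror (conj tt t3))) => [->|->|[tE _]|[tE _]].
    - exact: e13.
    - exact: e23.
    - by apply: (@line_adj _ _ _ b) => //; rewrite ?tE ?E3 !inE eqxx ?orbT.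
    by apply: (@line_adj _ _ _ c) => //; rewrite ?tE ?E3 !inE eqxx ?orbT.
  case: (cases t (or_introl tt)) => [->|->|[tE _]|[tE _]].
  - by rewrite line_sym'.
  - by rewrite line_sym'.
  - by apply: (@line_adj _ _ _ d) => //; rewrite ?tE ?Eg !inE eqxx ?orbT.
  by apply: (@line_adj _ _ _ d) => //; rewrite ?tE ?Eg !inE eqxx ?orbT.
have swapE x y : (swap x -- swap y) = (x -- y).
  rewrite /swap; case: (eqVneq x e3) => [->|x3]; case: (eqVneq y e3) => [->|y3].
  - by rewrite !sg_irrefl.
  - case: (eqVneq y g) => [->|yg]; first by rewrite line_sym'.
    by rewrite line_sym' twin // line_sym'.
  - case: (eqVneq x g) => [->|xg]; first by rewrite line_sym'.
    by rewrite twin.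
  case: (eqVneq x g) => [->|xg]; case: (eqVneq y g) => [->|yg] //.
  - by rewrite !sg_irrefl.
  - by rewrite line_sym' -twin // line_sym'.
  by rewrite -twin.
have iso : line_iso (f \o swap).
  split; last by move=> x y; rewrite -swapE; apply: fi.2.
  by apply: bij_comp fi.1 _; exists swap; apply: swapK.
split=> //.
(* After the exchange the edges near [e3] and [g] are mapped by this injection of a, b, c, d to s,
   p, q, r; a map induced by vertices respects stars. *)
pose m v := if v == a then s else if v == b then p else if v == c then q else r.
have ma : m a = s by rewrite /m eqxx.
have mb : m b = p by rewrite /m eq_sym (negPf nab) eqxx.
have mc : m c = q by rewrite /m eq_sym (negPf nac) eq_sym (negPf nbc) eqxx.
have md : m d = r by rewrite /m (negPf nda) (negPf ndb) (negPf ndc).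
pose S := [set a; b; c; d].
have m_inj : {in S &, injective m}.
  move=> x y; rewrite !inE -!orbA => /or4P[]/eqP-> /or4P[]/eqP->;
  rewrite ?ma ?mb ?mc ?md // => e; move: sp sq sr npq npr nqr;
  by rewrite ?e ?eqxx // -?e ?eqxx.
have near t : (t == e3) || (t == g) || (t -- e3) ->
    (val t \subset S) && (val (f (swap t)) == m @: val t).
  have im x y : m @: [set x; y] = [set m x; m y] by rewrite imsetU1 imset_set1.
  have sub x y : x \in S -> y \in S -> [set x; y] \subset S.
    by move=> xS yS; apply/subsetP => z /set2P[] ->.
  have [aS bS cS dS] : [/\ a \in S, b \in S, c \in S & d \in S].
    by rewrite !inE !eqxx ?orbT.
  move=> tt; have [->|t3] := eqVneq t e3.
    by rewrite /swap eqxx gE E3 im mb mc eqxx sub.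
  have [->|tg] := eqVneq t g.
    by rewrite /swap (negPf ng3) eqxx R Eg im ma md eqxx sub.
  rewrite (negPf t3) (negPf tg) /= in tt.
  rewrite /swap (negPf t3) (negPf tg).
  case: (cases t (or_introl tt)) => [->|->|[tE ft]|[tE ft]].
  - by rewrite P E1 im ma mb eqxx sub.
  - by rewrite Q E2 im ma mc eqxx sub.
  - by rewrite ft tE im mb md eqxx sub.
  by rewrite ft tE im mc md eqxx sub.
have star_near t u v : (t == e3) || (t == g) -> t -- u -> t -- v ->
    star (f (swap t)) (f (swap u)) (f (swap v)) = star t u v.
  move=> t3g tu tv.
  have near' w : t -- w -> (val w \subset S) && (val (f (swap w)) == m @: val w).
    move=> tw; apply: near; case/orP: t3g => /eqP e; subst t.
      by rewrite line_sym' tw !orbT.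
    have [//|w3] := eqVneq w e3; have [//|wg] := eqVneq w g.
    by rewrite orbC -twin // line_sym' tw.
  have /andP[tS /eqP tE] : (val t \subset S) && (val (f (swap t)) == m @: val t).
    by apply: near; rewrite t3g.
  have /andP[uS /eqP uE] := near' _ tu; have /andP[vS /eqP vE] := near' _ tv.
  apply/starP/starP => [[z []]|[z [zt zu zv]]]; rewrite tE uE vE.
    move=> /imsetP[x xt ->] /imsetP[y yu e] /imsetP[w wv e'].
    exists x; split=> //.
      by rewrite (m_inj x y (subsetP tS x xt) (subsetP uS y yu) e).
    by rewrite (m_inj x w (subsetP tS x xt) (subsetP vS w wv) e').
  by exists (m z); split; apply: imset_f.
apply: proper_card; apply/properP; split.
  apply/subsetP => -[[t u] v]; rewrite !inE /= => /and4P[tu tv uv].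
  rewrite tu tv uv /=.
  have [t3|nt] := boolP ((t == e3) || (t == g)); first by rewrite star_near // eqxx.
  have [u3|nu] := boolP ((u == e3) || (u == g)).
    by rewrite starC12 [star t _ _]starC12 star_near ?eqxx // line_sym'.
  have [v3|nv] := boolP ((v == e3) || (v == g)).
    rewrite starC23 starC12 [star t u v]starC23 [star t v u]starC12.
    by rewrite star_near ?eqxx // line_sym'.
  have sw w : ~~ ((w == e3) || (w == g)) -> swap w = w.
    by rewrite negb_or /swap => /andP[/negPf-> /negPf->].
  by rewrite !sw.
exists (e1, e2, e3).
  rewrite inE; apply/and4P; split; [exact: e12|exact: e13|exact: e23|].
  rewrite /= fstar eq_sym eqb_id; apply/starP => -[z []]; rewrite E1 E2 E3 !inE.
  move=> /orP[]/eqP->; first by rewrite (negPf nab) (negPf nac).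
  by rewrite eq_sym (negPf nab) (negPf nbc).
rewrite inE; apply/negP => /and4P[_ _ _ /eqP]; apply.
change (star (f (swap e1)) (f (swap e2)) (f (swap e3)) = star e1 e2 e3).
rewrite starC23 starC12 [star e1 e2 e3]starC23 [star e1 e3 e2]starC12.
apply: star_near; first by rewrite eqxx.
  by rewrite line_sym' e13.
by rewrite line_sym' e23.
Qed.

End Swap.

(** [f] carries its bad triples to those of its inverse. A star sent to a triangle is a triangle
    sent to a star by the inverse, so one kind of repair suffices. *)
Lemma bad_triples_inv (H K : sgraph) (f : line H -> line K) (g : line K -> line H) :
  line_iso f -> cancel f g -> cancel g f ->
  line_iso g /\ #|bad_triples g| = #|bad_triples f|.
Proof.
move=> [_ fE] fK gK.
have gE x y : (g x -- g y) = (x -- y) by rewrite -fE !gK.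
split; first by split=> //; exists f.
pose F (t : line H * line H * line H) := (f t.1.1, f t.1.2, f t.2).
have FI : injective F.
  by move=> [[a b] c] [[a' b'] c'] [/(can_inj fK)-> /(can_inj fK)-> /(can_inj fK)->].
rewrite -(card_imset _ FI); apply: eq_card => -[[a b] c].
apply/idP/imsetP => [|[[[x y] z]]].
  rewrite inE => /and4P[ab ac bc s]; exists (g a, g b, g c); last by rewrite /F !gK.
  rewrite inE; apply/and4P; split; rewrite ?gE //=.
  by move: s; rewrite /= !gK eq_sym.
rewrite inE => /and4P[xy xz yz s] [-> -> ->].
rewrite inE; apply/and4P; split; rewrite ?fE //=.
by move: s; rewrite /= !fK eq_sym.
Qed.

Lemma bad_triple_swap (H K : sgraph) (f : line H -> line K) (e1 e2 e3 : line H) :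
  line_iso f -> no_triangle_component H ->
  e1 -- e2 -> e1 -- e3 -> e2 -- e3 -> ~~ star e1 e2 e3 ->
  star (f e1) (f e2) (f e3) ->
  exists2 f' : line H -> line K, line_iso f' & #|bad_triples f'| < #|bad_triples f|.
Proof.
move=> fi nt a12 a13 a23 ns fs.
have [a [b [c [E1 E2 E3 [ab ac bc]]]]] := nonstar_triangle a12 a13 a23 ns.
have [nab nac nbc] := And3 (edge_neq ab) (edge_neq ac) (edge_neq bc).
have [t [d [tT]]] := nt _ _ _ ab ac bc.
rewrite !inE !negb_or => /and3P[da db dc] td; have [g Eg] := ex_edge td.
have conc (x y z : H) (u v w : line H) : val u = [set x; y] -> val v = [set x; z] ->
    val w = [set y; z] -> x != y -> x != z -> y != z -> d != x -> d != y -> d != z ->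
    t = x -> star (f u) (f v) (f w) ->
    exists2 f' : line H -> line K, line_iso f' & #|bad_triples f'| < #|bad_triples f|.
  move=> U V W xy xz yz dx dy dz tx fst'; rewrite tx in Eg.
  have [] := swap_iso fi U V W Eg xy xz yz dx dy dz fst'.
  by exists (f \o swap w g).
move: tT; rewrite !inE => /or3P[]/eqP tE.
- exact: (conc a b c e1 e2 e3).
- apply: (conc b a c e1 e3 e2); rewrite // 1?setUC //; first by rewrite eq_sym.
  by rewrite starC23.
apply: (conc c a b e2 e3 e1); rewrite // 1?setUC // 1?eq_sym //.
by rewrite starC23 starC12.
Qed.

(** Induction on the number of bad triples: a triangle sent to a star has an edge leaving it, which
    permits a swap, and a star sent to a triangle is repaired on the side of [K]. Triangle
    components must be excluded because a triangle and a claw have the same line graph. *)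
Theorem line_iso_star (H K : sgraph) (f : line H -> line K) :
  no_triangle_component H -> no_triangle_component K -> line_iso f ->
  exists2 f' : line H -> line K, line_iso f' & star_iso f'.
Proof.
move=> nH nK; have [n] := ubnP #|bad_triples f|.
elim: n => // n IH in f * => lt fi.
case: (set_0Vmem (bad_triples f)) => [b0|[[[e1 e2] e3]]].
  exists f => // x y z xy xz yz; have [//|s] := eqVneq (star (f x) (f y) (f z)) (star x y z).
  have : (x, y, z) \in bad_triples f by rewrite inE; apply/and4P; split.
  by rewrite b0 inE.
rewrite inE => /and4P[a12 a13 a23];
  rewrite [(e1, e2, e3).1.1]/= [(e1, e2, e3).1.2]/= [(e1, e2, e3).2]/= in a12 a13 a23 *.
case: (boolP (star e1 e2 e3)) => [s|ns]; case fs: (star _ _ _) => // _; last first.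
  have [f' fi' lt'] := bad_triple_swap fi nH a12 a13 a23 ns fs.
  by apply: IH fi'; apply: leq_trans lt' _.
have [g fK gK] := fi.1; have [gi gb] := bad_triples_inv fi fK gK.
have [g' gi' lt'] : exists2 g' : line K -> line H,
  line_iso g' & #|bad_triples g'| < #|bad_triples g|.
  apply: (@bad_triple_swap _ _ g (f e1) (f e2) (f e3)) => //; rewrite ?fi.2 ?fs ?fK //.
have [f' gK' fK'] := gi'.1; have [fi' fb'] := bad_triples_inv gi' gK' fK'.
apply: (IH f') => //; rewrite fb'; apply: leq_trans lt' _.
by rewrite gb.
Qed.

(** * Claws in place of triangle components *)

Lemma iso_sym (G H : sgraph) : G ~= H -> H ~= G.
Proof.
move=> /isoP[f [[g fK gK] fE]]; apply/isoP; exists g; split; first by exists f.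
by move=> x y; rewrite -fE !gK.
Qed.

Lemma iso_trans (G H K : sgraph) : G ~= H -> H ~= K -> G ~= K.
Proof.
move=> /isoP[f [fB fE]] /isoP[g [gB gE]]; apply/isoP; exists (g \o f).
split; first exact: bij_comp.
by move=> x y; rewrite /= gE fE.
Qed.

Lemma iso_card (G H : sgraph) : G ~= H -> #|G| = #|H|.
Proof. by move=> /isoP[f [fB _]]; apply: bij_eq_card fB. Qed.

Lemma bij_of_onto (A B : finType) (f : A -> B) :
  injective f -> (forall y, exists x, f x = y) -> bijective f.
Proof.
move=> fI /fin_all_exists[g gE]; exists g => // x.
by apply: fI; rewrite gE.
Qed.

Lemma iso_enum (I : finType) (G H : sgraph) (p : I -> G) (r : I -> H) :
  injective p -> injective r -> (forall x, exists i, p i = x) ->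
  (forall y, exists i, r i = y) ->
  (forall i j, (p i -- p j) = (r i -- r j)) -> G ~= H.
Proof.
move=> pI rI pO rO pr; have [p' pK p'K] := bij_of_onto pI pO.
apply/isoP; exists (r \o p'); split; last by move=> x y; rewrite /= -pr !p'K.
by apply: bij_comp (bij_of_onto rI rO) _; exists p.
Qed.

Lemma compl_iso (G H : sgraph) : G ~= H -> compl G ~= compl H.
Proof.
move=> /isoP[f [fB fE]]; apply/isoP; exists f; split=> // x y /=.
by rewrite fE (inj_eq (bij_inj fB)).
Qed.

Lemma compl_iso_inv (G H : sgraph) : compl G ~= compl H -> G ~= H.
Proof.
move=> /isoP[f [fB fE]]; apply/isoP; exists f; split=> // x y.
have [->|n] := eqVneq x y; first by rewrite !sg_irrefl.
have := fE x y; rewrite /= (inj_eq (bij_inj fB)) n /=.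
by move/(congr1 negb); rewrite !negbK.
Qed.

Section Components.
Variable H : sgraph.
Implicit Types (x y z : H) (C : {set H}).

Lemma induced_triangle (a b c : H) : a -- b -> a -- c -> b -- c ->
  induced [set a; b; c] ~= complete 3.
Proof.
move=> ab ac bc.
have [nab nac nbc] := And3 (edge_neq ab) (edge_neq ac) (edge_neq bc).
have [ia ib ic] : [/\ a \in [set a; b; c], b \in [set a; b; c] & c \in [set a; b; c]].
  by rewrite !inE !eqxx !orbT.
pose p (i : 'I_3) : induced [set a; b; c] :=
  match val i with 0 => Sub a ia | 1 => Sub b ib | _ => Sub c ic end.
apply: (@iso_enum _ _ (complete 3) p id) => //.
- case=> [[|[|[|//]]] i] [[|[|[|//]]] j] /(congr1 val) /= e; apply/val_inj => //=;
  by move: nab nac nbc; rewrite e eqxx.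
- move=> x; have := valP x; rewrite !inE -orbA => /or3P[]/eqP xE.
  + by exists (Ordinal (isT : 0 < 3)); apply: val_inj.
  + by exists (Ordinal (isT : 1 < 3)); apply: val_inj.
  by exists (Ordinal (isT : 2 < 3)); apply: val_inj.
- by move=> y; exists y.
have [ba ca cb] : [/\ b -- a, c -- a & c -- b] by rewrite ![_ -- a]sg_sym ![c -- b]sg_sym.
by case=> [[|[|[|//]]] i] [[|[|[|//]]] j] /=; rewrite ?sg_irrefl.
Qed.

(** Connectedness is traded for closure under edges, the form in which components are used from here
    on. *)
Lemma triangle_componentP C :
  reflect (exists a b c, [/\ C = [set a; b; c], a -- b, a -- c, b -- c &
             forall x y, x \in C -> x -- y -> y \in C])
    (triangle_component C).
Proof.
have cs : connect_sym (@sedge H) by apply: sym_connect_sym; apply: sg_sym.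
apply: (iffP andP) => [[/imsetP[x _ CE] /iso_sym/isoP[f [[g fK gK] fE]]]|].
  pose o i (lt : i < 3) := Ordinal lt.
  pose a := val (f (o 0 isT)); pose b := val (f (o 1 isT)); pose c := val (f (o 2 isT)).
  exists a, b, c; split.
  - apply/setP => y; rewrite !inE -orbA; apply/idP/or3P.
      move=> yC; have -> : y = val (f (g (Sub y yC))) by rewrite gK.
      case: (g _) => -[|[|[|//]]] i; [constructor 1|constructor 2|constructor 3];
      by apply/eqP; congr (val (f _)); apply: val_inj.
    by case=> /eqP ->; apply: valP.
  - by have := fE (o 0 isT) (o 1 isT).
  - by have := fE (o 0 isT) (o 2 isT).
  - by have := fE (o 1 isT) (o 2 isT).
  move=> y z; rewrite CE !inE /= => xy yz.
  exact: connect_trans xy (connect1 yz).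
case=> a [b [c [CE ab ac bc cl]]]; split; last by rewrite CE; apply: induced_triangle.
apply/imsetP; exists a => //; apply/setP => y; rewrite [in RHS]inE in_setT /=.
have aC : a \in C by rewrite CE !inE eqxx.
have clo : closed (@sedge H) (mem C).
  by apply: intro_closed => // u v uv uC; apply: cl uv.
apply/idP/idP => [|ay]; last by rewrite -(closed_connect clo ay).
rewrite CE !inE -orbA => /or3P[]/eqP->; [exact: connect0|exact: connect1|exact: connect1].
Qed.

Lemma component_closed C x y : triangle_component C -> x \in C -> x -- y -> y \in C.
Proof. by move=> /triangle_componentP[a [b [c [_ _ _ _ cl]]]]; apply: cl. Qed.

Lemma component_clique C x y : triangle_component C -> x \in C -> y \in C ->
  x != y -> x -- y.
Proof.
move=> /triangle_componentP[a [b [c [-> ab ac bc _]]]].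
have [ba ca cb] : [/\ b -- a, c -- a & c -- b] by rewrite ![_ -- a]sg_sym ![c -- b]sg_sym.
by rewrite !inE -!orbA => /or3P[]/eqP-> /or3P[]/eqP->; rewrite ?eqxx.
Qed.

Lemma component_eq C D x : triangle_component C -> triangle_component D ->
  x \in C -> x \in D -> C = D.
Proof.
move=> tC tD xC xD; apply/setP => y; have [->|n] := eqVneq y x; first by rewrite xC xD.
apply/idP/idP => yy.
  by apply: (component_closed tD xD); apply: (component_clique tC); rewrite // eq_sym.
by apply: (component_closed tC xC); apply: (component_clique tD); rewrite // eq_sym.
Qed.

Lemma component_deg C x : triangle_component C -> x \in C -> 0 < degree x.
Proof.
move=> /triangle_componentP[a [b [c [-> ab ac bc _]]]].
rewrite !inE -orbA => xx; apply/degree_gt0P; case/or3P: xx => /eqP->.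
- by exists b.
- by exists a; rewrite sg_sym.
by exists a; rewrite sg_sym.
Qed.

Local Notation TC := (triangles_to_claws H).
Local Notation in_vertex := ({x : H | 0 < degree x}).

Lemma claw_nonisolated (u : TC) : exists v, u -- v.
Proof.
case: u => [x|C].
  have /degree_gt0P[y xy] := valP x.
  have y0 : 0 < degree y by apply/degree_gt0P; exists (val x); rewrite sg_sym.
  case: (boolP [exists C : {set H}, [&& triangle_component C, val x \in C & y \in C]]).
    by move=> /existsP[C /and3P[tC xC _]]; exists (inr (Sub C tC)).
  by move=> n; exists (inl (Sub y y0)); apply/andP.
have /triangle_componentP[a [b [c [CE _ _ _ _]]]] := valP C.
have aC : a \in val C by rewrite CE !inE eqxx.
by exists (inl (Sub a (component_deg (valP C) aC))).
Qed.

(** A centre lies in no triangle, as its neighbours are pairwise nonadjacent. A triangle of old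
    vertices with no edge leaving it would have been a triangle component of [H], whose edges were
    removed. *)
Lemma claw_no_triangle_component : no_triangle_component TC.
Proof.
have no_inr (C : {C : {set H} | triangle_component C}) (v w : TC) :
    (inr C : TC) -- v -> (inr C : TC) -- w -> v -- w -> False.
  case: v => [x|//] /=; case: w => [y|//] /= xC yC /andP[_] /existsP[].
  by exists (val C); rewrite (valP C) xC yC.
move=> [x|C]; last by move=> b c ab ac bc; case: (no_inr C b c).
move=> [y|C]; last by move=> c ab ac bc; case: (no_inr C (inl x) c) => //; rewrite sg_sym.
move=> [z|C]; last first.
  by move=> ab ac bc; case: (no_inr C (inl x) (inl y)) => //; rewrite sg_sym.
move=> /andP[xy nxy] /andP[xz _] /andP[yz _].
case: (pickP (fun p : H * H => [&& p.1 \in [set val x; val y; val z],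
   p.2 \notin [set val x; val y; val z] & p.1 -- p.2])) => [[t d]|cl]; last first.
  case/negP: nxy; apply/existsP; exists [set val x; val y; val z].
  rewrite !inE !eqxx !orbT /= andbT; apply/triangle_componentP.
  exists (val x), (val y), (val z); split=> // t d tT td; apply/negPn/negP => nd.
  by have := cl (t, d); rewrite [_ && _]/= tT nd td.
move=> /and3P[/= tT dT td].
have t0 : 0 < degree t by apply/degree_gt0P; exists d.
have d0 : 0 < degree d by apply/degree_gt0P; exists t; rewrite sg_sym.
exists (inl (Sub t t0)), (inl (Sub d d0)); split.
- move: tT; rewrite !inE -orbA => /or3P[]/eqP e; apply/or3P;
  [constructor 1|constructor 2|constructor 3]; apply/eqP; congr inl; exact: val_inj.
- move: dT; rewrite !inE -orbA; apply: contra => /or3P[]/eqP[] /(congr1 val) /= ->;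
  by rewrite eqxx ?orbT.
apply/andP; split; first exact: td.
apply/existsP => -[C /and3P[tC tinC _]]; rewrite /= in tinC.
have TinC u : u \in [set val x; val y; val z] -> u \in C.
  move=> uT; have [->//|nut] := eqVneq u t.
  apply: (component_closed tC tinC); rewrite eq_sym in nut.
  move: tT uT nut; rewrite !inE -!orbA.
  have [yx zx zy] : [/\ val y -- val x, val z -- val x & val z -- val y].
    by rewrite ![_ -- val x]sg_sym ![val z -- val y]sg_sym.
  by case/or3P=> /eqP-> /or3P[]/eqP->; rewrite ?eqxx.
case/negP: nxy; apply/existsP; exists C; rewrite tC.
by rewrite !TinC ?inE ?eqxx ?orbT.
Qed.

(** In a triangle component each side corresponds to the claw edge at the opposite vertex, and any
    two edges meet on either side of the correspondence. All other edges correspond to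
    themselves. *)
Lemma line_claw : line H ~= line TC.
Proof.
pose R (e : line H) (e' : line TC) :=
  (exists (C : {C : {set H} | triangle_component C}) (z : in_vertex),
    [/\ val z \in val C, val e = val C :\ val z & val e' = [set inl z; inr C]]) \/
  ((forall C, triangle_component C -> ~~ (val e \subset C)) /\
   exists x y : in_vertex, val e = [set val x; val y] /\ val e' = [set inl x; inl y]).
have tri3 C x y : triangle_component C -> x \in C -> y \in C -> x != y ->
    exists z, [/\ z \in C, z != x, z != y & [set x; y] = C :\ z].
  move=> /triangle_componentP[a [b [c [-> ab ac bc _]]]].
  have [nab nac nbc] := And3 (edge_neq ab) (edge_neq ac) (edge_neq bc).
  have [nba nca ncb] : [/\ b != a, c != a & c != b].
    by rewrite ![_ == a]eq_sym ![c == b]eq_sym.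
  rewrite !inE -!orbA => /or3P[]/eqP-> /or3P[]/eqP->; rewrite ?eqxx // => _;
  [exists c|exists b|exists c|exists a|exists b|exists a];
  (split=> //; first by rewrite !inE eqxx ?orbT);
  apply/setP => t; rewrite !inE; deq.
have mkE (e : line H) : exists e' : line TC, R e e'.
  have [x [y [xy eE]]] := edge_ends e; have nxy := edge_neq xy.
  have x0 : 0 < degree x by apply/degree_gt0P; exists y.
  have y0 : 0 < degree y by apply/degree_gt0P; exists x; rewrite sg_sym.
  case: (boolP [exists C : {set H}, [&& triangle_component C, x \in C & y \in C]]).
    move=> /existsP[C /and3P[tC xC yC]].
    have [z [zC zx zy eC]] := tri3 C x y tC xC yC nxy.
    have z0 := component_deg tC zC.
    have [|e' e'E] := @ex_edge TC (inl (Sub z z0)) (inr (Sub C tC)); first by [].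
    exists e'; left; exists (Sub C tC), (Sub z z0); split=> //.
    by rewrite eE eC.
  move=> nC; have [|e' e'E] := @ex_edge TC (inl (Sub x x0)) (inl (Sub y y0)).
    by apply/andP.
  exists e'; right; split; last by exists (Sub x x0), (Sub y y0).
  move=> C tC; apply: contra nC; rewrite eE subUset !sub1set => /andP[xC yC].
  by apply/existsP; exists C; rewrite tC xC yC.
have [f fR] := fin_all_exists mkE.
pose enc (A : {set H}) : {set TC} :=
  [set u : TC | match u with inl t => val t \in A | inr _ => false end].
have encE (x y : in_vertex) : [set inl x; inl y] = enc [set val x; val y].
  by apply/setP => -[t|C]; rewrite !inE.
have encI (A B : {set H}) : (forall t, t \in A -> 0 < degree t) ->
    (forall t, t \in B -> 0 < degree t) -> enc A = enc B -> A = B.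
  move=> dA dB e; apply/setP => t; apply/idP/idP => tt.
    have /setP/(_ (inl (Sub t (dA _ tt)))) := e.
    by rewrite !inE /= tt => /esym.
  have /setP/(_ (inl (Sub t (dB _ tt)))) := e.
  by rewrite !inE /= tt.
have dset (x y : in_vertex) t : t \in [set val x; val y] -> 0 < degree t.
  by rewrite !inE => /orP[]/eqP->; [exact: (valP x)|exact: (valP y)].
have mixE (z z' : in_vertex) (C C' : {C : {set H} | triangle_component C}) :
    [set inl z; inr C] = [set inl z'; inr C'] :> {set TC} -> z = z' /\ C = C'.
  move=> /setP e; have := e (inl z); have := e (inr C).
  by rewrite !inE !eqxx orbT /= orbF => /esym/eqP[->] /esym/eqP[->].
have mixN (z x y : in_vertex) (C : {C : {set H} | triangle_component C}) :
    [set inl z; inr C] = [set inl x; inl y] :> {set TC} -> False.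
  by move=> /setP/(_ (inr C)); rewrite !inE eqxx orbT.
have fI : injective f.
  move=> e e' ee; apply: val_inj.
  case: (fR e) (fR e') => [[C [z [zC eE fe]]]|[nC [x [y [eE fe]]]]]
    [[C' [z' [zC' eE' fe']]]|[nC' [x' [y' [eE' fe']]]]].
  - by move: fe'; rewrite -ee fe => /mixE[ez eC]; rewrite eE eE' ez eC.
  - by move: fe'; rewrite -ee fe => /mixN.
  - by move: fe; rewrite ee fe' => /mixN.
  rewrite eE eE'; apply: encI; [exact: dset|exact: dset|].
  by rewrite -!encE -fe -fe' ee.
have RE e a : R e a -> f e = a.
  move=> Rea; apply: val_inj.
  case: Rea (fR e) => [[C [z [zC eE fe]]]|[nC [x [y [eE fe]]]]]
    [[C' [z' [zC' eE' fe']]]|[nC' [x' [y' [eE' fe']]]]].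
  - have CC : C = C'.
      have [x [y [_ xy]]] := edge_ends e.
      have xe : x \in val e by rewrite xy !inE eqxx.
      apply: val_inj; apply: (@component_eq _ _ x); rewrite ?(valP C) ?(valP C') //.
        by move: xe; rewrite eE !inE => /andP[].
      by move: xe; rewrite eE' !inE => /andP[].
    have zz : z = z'.
      apply/eqP; rewrite -val_eqE; apply/negPn/negP => n.
      have : val z \in val e by rewrite eE' !inE n -CC zC.
      by rewrite eE !inE eqxx.
    by rewrite fe fe' CC zz.
  - by case/negP: (nC' _ (valP C)); rewrite eE; apply: subD1set.
  - by case/negP: (nC _ (valP C')); rewrite eE'; apply: subD1set.
  by rewrite fe fe' !encE -eE -eE'.
have fO a : exists e, f e = a.
  have [u [v [uv aE]]] := edge_ends a.
  have mix (z : in_vertex) (C : {C : {set H} | triangle_component C}) :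
      val z \in val C -> val a = [set inl z; inr C] -> exists e, f e = a.
    move=> zC aE'; have [p [q [r [CE pq pr qr cl]]]] := triangle_componentP _ (valP C).
    have [x [y [xy eC]]] : exists x y, x -- y /\ val C :\ val z = [set x; y].
      have [qp rp rq] : [/\ q -- p, r -- p & r -- q] by rewrite ![_ -- p]sg_sym ![r -- q]sg_sym.
      move: (zC); rewrite {1}CE !inE -orbA => /or3P[]/eqP e.
      + have [|||t [tC tq tr te]] := tri3 (val C) q r (valP C);
        rewrite ?CE ?inE ?eqxx ?orbT ?edge_neq //.
        move: tC tq tr te; rewrite CE !inE -orbA => /or3P[]/eqP->; rewrite ?eqxx // => _ _ te.
        by exists q, r; rewrite e -te.
      + have [|||t [tC tq tr te]] := tri3 (val C) p r (valP C);
        rewrite ?CE ?inE ?eqxx ?orbT ?edge_neq //.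
        move: tC tq tr te; rewrite CE !inE -orbA => /or3P[]/eqP->; rewrite ?eqxx // => _ _ te.
        by exists p, r; rewrite e -te.
      have [|||t [tC tq tr te]] := tri3 (val C) p q (valP C);
        rewrite ?CE ?inE ?eqxx ?orbT ?edge_neq //.
      move: tC tq tr te; rewrite CE !inE -orbA => /or3P[]/eqP->; rewrite ?eqxx // => _ _ te.
      by exists p, q; rewrite e -te.
    have [e eE] := ex_edge xy; exists e; apply: RE; left; exists C, z.
    by split; rewrite ?eE ?eC.
  case: u v uv aE => [x|C] [y|D] //=; last first.
  - by move=> xC aE; apply: (mix y C xC); apply: etrans aE (setUC _ _).
  - exact: mix.
  move=> /andP[xy nC] aE; have [e eE] := ex_edge xy; exists e; apply: RE; right; split.
    move=> C tC; apply: contra nC; rewrite eE subUset !sub1set => /andP[xC yC].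
    by apply/existsP; exists C; rewrite tC xC yC.
  by exists x, y.
apply/isoP; exists f; split; first exact: bij_of_onto.
(* Components are closed, so an edge outside the triangle components never meets a side of one. *)
have away (e e' : line H) (x y z : in_vertex) (C : {C : {set H} | triangle_component C}) :
    val e = val C :\ val z -> val z \in val C -> val e' = [set val x; val y] ->
    (forall C, triangle_component C -> ~~ (val e' \subset C)) ->
    forall t, t \in val e' -> t \notin val C.
  move=> eE zC e'E nC t te'; have := nC _ (valP C); apply: contra => tC.
  have [w [tw e'w]] := edge_at te'.
  rewrite e'w subUset !sub1set tC /=; exact: (component_closed (valP C) tC).
move=> e e'; apply/line_adjP/line_adjP => -[n [v [ve ve']]]; split.
- by move=> ee; apply: n; rewrite ee.
- case: (fR e) (fR e') => [[C [z [zC eE fe]]]|[nC [x [y [eE fe]]]]]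
    [[C' [z' [zC' eE' fe']]]|[nC' [x' [y' [eE' fe']]]]].
  + have CC : C = C'.
      move: ve ve'; rewrite fe fe' !inE => /orP[]/eqP-> /orP[]/eqP [] // e0.
      apply: val_inj; apply: (@component_eq _ _ (val z)); rewrite ?(valP C) ?(valP C') //.
      by rewrite e0.
    have nzz : val z != val z'.
      by apply/eqP => /val_inj zz; apply: n; apply: val_inj; rewrite fe fe' CC zz.
    subst C'.
    have [t [tC tz tz' te]] := tri3 (val C) (val z) (val z') (valP C) zC zC' nzz.
    by exists t; rewrite eE eE' !inE tz tz' tC.
  + have aw := away e e' x' y' z C eE zC eE' nC'.
    move: ve ve'; rewrite fe fe' !inE => /orP[]/eqP-> /orP[]/eqP [] // e0.
      by have := aw (val z); rewrite eE' e0 !inE eqxx -e0 zC => /(_ isT).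
    by have := aw (val z); rewrite eE' e0 !inE eqxx orbT -e0 zC => /(_ isT).
  + have aw := away e' e x y z' C' eE' zC' eE nC.
    move: ve' ve; rewrite fe fe' !inE => /orP[]/eqP-> /orP[]/eqP [] // e0.
      by have := aw (val z'); rewrite eE e0 !inE eqxx -e0 zC' => /(_ isT).
    by have := aw (val z'); rewrite eE e0 !inE eqxx orbT -e0 zC' => /(_ isT).
  case: v ve ve' => [t|C] ve ve'; last by move: ve; rewrite fe !inE.
  by exists (val t); move: ve ve'; rewrite fe fe' eE eE' !encE !inE.
- by move=> /fI.
case: (fR e) (fR e') => [[C [z [zC eE fe]]]|[nC [x [y [eE fe]]]]]
    [[C' [z' [zC' eE' fe']]]|[nC' [x' [y' [eE' fe']]]]].
- have CC : C = C'.
    apply: val_inj; apply: (@component_eq _ _ v); rewrite ?(valP C) ?(valP C') //.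
      by move: ve; rewrite eE !inE => /andP[].
    by move: ve'; rewrite eE' !inE => /andP[].
  by exists (inr C); rewrite fe fe' CC !inE eqxx !orbT.
- have := away e e' x' y' z C eE zC eE' nC' v ve'.
  by move: ve; rewrite eE !inE => /andP[_ ->].
- have := away e' e x y z' C' eE' zC' eE nC v ve.
  by move: ve'; rewrite eE' !inE => /andP[_ ->].
have v0 : 0 < degree v by apply: (dset x y); rewrite -eE.
exists (inl (Sub v v0)); rewrite fe fe' !encE.
by rewrite -eE -eE' !inE.
Qed.

End Components.

(** * Recovering the core of the complement *)

Lemma core_full (H : sgraph) : (forall x : H, exists y, x -- y) -> core H ~= H.
Proof.
move=> full; apply/isoP; exists val; split=> //.
have d x : x \in [set x : H | 0 < degree x].
  by rewrite inE; apply/degree_gt0P; apply: full.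
by apply: bij_of_onto; [exact: val_inj|move=> y; exists (Sub y (d y))].
Qed.

Lemma line_functor (H K : sgraph) : H ~= K -> line H ~= line K.
Proof.
move=> /isoP[f [fB fE]]; have fI := bij_inj fB; have [g fK gK] := fB.
have im x y : f @: [set x; y] = [set f x; f y] by rewrite imsetU1 imset_set1.
have ex (e : line H) : exists e' : line K, val e' = f @: val e.
  have [x [y [xy ->]]] := edge_ends e; rewrite im.
  by apply: ex_edge; rewrite fE.
have [F FE] := fin_all_exists ex.
have FI : injective F.
  move=> e e' ee; apply: val_inj; apply: (imset_inj fI).
  by rewrite -!FE ee.
apply/isoP; exists F; split.
  apply: bij_of_onto => // a; have [u [v [uv aE]]] := edge_ends a.
  have [|e eE] := @ex_edge H (g u) (g v); first by rewrite -fE !gK.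
  by exists e; apply: val_inj; rewrite FE eE im !gK aE.
move=> e e'; apply/line_adjP/line_adjP => -[n [v [ve ve']]]; split.
- by move=> ee; apply: n; rewrite ee.
- move: ve ve'; rewrite !FE => /imsetP[x xe ->] /imsetP[y ye /fI xy].
  by exists x; rewrite xy in xe *; rewrite -xy in ye *; split; rewrite // xy.
- by move/FI.
by exists (f v); rewrite !FE; split; apply: imset_f.
Qed.

(** Replacing triangles by claws leaves the line graph unchanged and removes the only obstruction to
    Whitney's theorem; the resulting graphs have no isolated vertices, so their cores are the whole
    graphs. *)
Theorem claw_graph_line (G1 G2 : sgraph) :
  claw_graph G1 ~= claw_graph G2 <-> line (compl G1) ~= line (compl G2).
Proof.
split=> [/compl_iso_inv/line_functor l|l].
  apply: iso_trans (line_claw (compl G1)) _.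
  exact: iso_trans l (iso_sym (line_claw (compl G2))).
apply: compl_iso.
have : line (triangles_to_claws (compl G1)) ~= line (triangles_to_claws (compl G2)).
  apply: iso_trans (iso_sym (line_claw _)) _.
  exact: iso_trans l (line_claw (compl G2)).
case/isoP=> f fi.
have [f' fi' fs'] := line_iso_star (@claw_no_triangle_component _)
  (@claw_no_triangle_component _) fi.
have c := line_iso_core fi' fs'.
apply: iso_trans (iso_sym (core_full (@claw_nonisolated _))) _.
exact: iso_trans c (core_full (@claw_nonisolated _)).
Qed.

Lemma induced_compl_iso (G1 G2 : sgraph) (A1 : {set G1}) (A2 : {set G2}) :
  induced A1 ~= induced A2 <->
  @induced (compl G1) A1 ~= @induced (compl G2) A2.
Proof.
split=> /isoP[f [fB fE]]; apply/isoP; exists f; split=> // x y.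
  have := fE x y; rewrite /= => ->.
  by rewrite !val_eqE (inj_eq (bij_inj fB)).
have [->|n] := eqVneq x y; first by rewrite !sg_irrefl.
have := fE x y; rewrite /= !val_eqE (inj_eq (bij_inj fB)) n /=.
by move/(congr1 negb); rewrite !negbK.
Qed.

Lemma universal_compl (G : sgraph) (x : G) :
  ~~ universal x = (0 < @degree (compl G) x).
Proof.
rewrite /universal /degree.
have : #|[set y : G | x -- y]| + #|[set y : compl G | @sedge (compl G) x y]| + 1 = #|G|.
  rewrite -(cardsC [set y : G | x -- y]) -addnA; congr (_ + _).
  rewrite [RHS](cardsD1 x) !inE sg_irrefl addnC; congr (_ + _).
  by apply: eq_card => y; rewrite !inE (eq_sym (y : G)).
move: #|[set y : G | _]| #|[set y : compl G | _]| => a b <-.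
by rewrite addn1 /=; apply/idP/idP; lia.
Qed.

Lemma del_universal_core (G1 G2 : sgraph) :
  del_universal G1 ~= del_universal G2 <-> core (compl G1) ~= core (compl G2).
Proof.
have -> : core (compl G1) = @induced (compl G1) [set x : G1 | ~~ universal x].
  by congr induced; apply/setP => x; rewrite !inE universal_compl.
have -> : core (compl G2) = @induced (compl G2) [set x : G2 | ~~ universal x].
  by congr induced; apply/setP => x; rewrite !inE universal_compl.
exact: induced_compl_iso.
Qed.

(** * Neighbourhoods of partitions identified with line graphs *)

Definition nbhd_map (L B : sgraph) (Q : B) (b : L -> B) :=
  [/\ injective b, forall e, Q -- b e, forall X, Q -- X -> exists e, b e = X
    & forall e f, (b e -- b f) = (e -- f)].

Lemma nbhd_iso (L1 L2 B1 B2 : sgraph) (f : B1 -> B2) (Q : B1) b1 b2 :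
  bijective f -> (forall x y, (f x -- f y) = (x -- y)) ->
  @nbhd_map L1 B1 Q b1 -> @nbhd_map L2 B2 (f Q) b2 ->
  exists a : L1 -> L2, [/\ bijective a, forall e e', (a e -- a e') = (e -- e')
    & forall e, b2 (a e) = f (b1 e)].
Proof.
move=> fB fE [b1I Q1 on1 E1] [b2I Q2 on2 E2]; have [g fK gK] := fB.
have ex e : exists e', b2 e' = f (b1 e) by apply: on2; rewrite fE.
have [a aE] := fin_all_exists ex; exists a; split=> //.
  apply: bij_of_onto => [e e' ee|e'].
    by apply/b1I/(bij_inj fB); rewrite -!aE ee.
  have [|e eE] := on1 (g (b2 e')); first by rewrite -fE gK.
  by exists e; apply: b2I; rewrite aE eE gK.
by move=> e e'; rewrite -E2 !aE fE E1.
Qed.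

Section Maps.
Variables (G : sgraph) (k : nat).
Local Notation h := (@nonedge G).
Local Notation B := (bell_geq G k).
Local Notation L := (line (compl G)).

Lemma set2_eq (V : finType) (x y z w : V) : x != y -> [set x; y] = [set z; w] ->
  (x = z /\ y = w) \/ (x = w /\ y = z).
Proof.
move=> xy e; have : x \in [set z; w] by rewrite -e !inE eqxx.
have : y \in [set z; w] by rewrite -e !inE eqxx orbT.
rewrite !inE => /orP[]/eqP ? /orP[]/eqP ?; subst; rewrite ?eqxx // in xy; auto.
Qed.

(** Used with [erel] at the finest partition and with [tau Q] at its image. Symmetry of [r] makes
    the partition depend on the unordered edge only, and the two hypotheses on adjacency also give
    injectivity. *)
Lemma nbhd_map_ex (Q : B) (r : G -> G -> rel G) :
  (forall x y, r x y =2 r y x) ->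
  (forall x y, h x y -> exists Z, Q -- Z /\ rl Z =2 r x y) ->
  (forall Z, Q -- Z -> exists x y, h x y /\ rl Z =2 r x y) ->
  (forall x y w (Z Z' : B), h x y -> h x w -> y <> w ->
     rl Z =2 r x y -> rl Z' =2 r x w -> Z -- Z') ->
  (forall x y z w (Z Z' : B), h x y -> h z w ->
     x <> z -> x <> w -> y <> z -> y <> w ->
     rl Z =2 r x y -> rl Z' =2 r z w -> ~~ (Z -- Z') /\ Z <> Z') ->
  exists b : L -> B, nbhd_map Q b /\
    forall e x y, val e = [set x; y] -> h x y -> rl (b e) =2 r x y.
Proof.
move=> rC ex on ad na.
have H0 (e : L) : exists Z, Q -- Z /\
    forall x y, val e = [set x; y] -> h x y -> rl Z =2 r x y.
  have [x [y [xy eE]]] := edge_ends e; have [Z [QZ ZE]] := ex _ _ xy.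
  exists Z; split=> // x' y'; rewrite eE => e2 xy' u v.
  have [[<- <-]|[<- <-]] := set2_eq (h_neq xy) e2; first exact: ZE.
  by rewrite rC; apply: ZE.
have [b bE] := fin_all_exists H0; exists b.
have bS e x y : val e = [set x; y] -> h x y -> rl (b e) =2 r x y by case: (bE e) => _; apply.
split=> //.
have badj e f : e -- f -> b e -- b f.
  move=> /line_adjP[n [x [/edge_at[y [xy eE]] /edge_at[z [xz fE]]]]].
  apply: (ad x y z) => //; [|exact: bS|exact: bS].
  by move=> yz; apply: n; apply: val_inj; rewrite eE fE yz.
have bnadj e f : e <> f -> ~~ (e -- f) -> ~~ (b e -- b f) /\ b e <> b f.
  move=> n ef; have [x [y [xy eE]]] := edge_ends e; have [z [w [zw fE]]] := edge_ends f.
  have dis t : t \in val e -> t \in val f -> False.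
    by move=> te tf; case/negP: ef; apply: line_adj te tf.
  apply: (na x y z w) => //; try exact: bS.
  - by move=> xz; apply: (dis x); rewrite ?eE ?fE !inE ?xz eqxx ?orbT.
  - by move=> xz; apply: (dis x); rewrite ?eE ?fE !inE ?xz eqxx ?orbT.
  - by move=> xz; apply: (dis y); rewrite ?eE ?fE !inE ?xz eqxx ?orbT.
  by move=> xz; apply: (dis y); rewrite ?eE ?fE !inE ?xz eqxx ?orbT.
have bI : injective b.
  move=> e f ef; apply/eqP/negPn/negP => /eqP n.
  case: (boolP (e -- f)) => [/badj|nef]; first by rewrite ef sg_irrefl.
  by case: (bnadj _ _ n nef).
split=> //.
- by move=> e; case: (bE e).
- move=> X /on[x [y [xy XE]]]; have [e eE] := @ex_edge (compl G) x y xy.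
  by exists e; apply: rl_inj => u v; rewrite (bS e x y) // XE.
move=> e f; apply/idP/idP; last exact: badj.
move=> bef; apply/negPn/negP => nef.
have [ee|/eqP n] := eqVneq e f; first by rewrite ee sg_irrefl in bef.
by have [] := bnadj _ _ n nef; rewrite bef.
Qed.

Lemma zero_map (O : B) : k + 1 <= #|G| -> is_zero O ->
  exists b : L -> B, nbhd_map O b /\
    forall e x y, val e = [set x; y] -> h x y -> rl (b e) =2 erel x y.
Proof.
move=> kn zO; apply: nbhd_map_ex.
- exact: erelC.
- move=> x y xy; have [X [eX _]] := edge_ex kn xy; exists X; split=> //.
  by apply/(zero_adjP _ zO); exists x, y.
- by move=> Z /(zero_adjP _ zO).
- move=> x y w Z Z' xy xw yw e e'; apply: (edges_adj e e').
  have nxy := h_neq xy; have nxw := h_neq xw.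
  by apply: (@rl_neq G k _ _ x y); rewrite e e' /erel; deq.
move=> x y z w Z Z' xy zw xz xw yz yw e e'.
have nxy := h_neq xy; have nzw := h_neq zw; split.
  by apply: (@nadj2 G k _ _ x y z w) => //; rewrite e e' /erel; deq.
by apply: (@rl_neq G k _ _ x y); rewrite e e' /erel; deq.
Qed.

Lemma tau_map (Q : B) : zero_like Q -> k + 2 <= #|G| ->
  exists b : L -> B, nbhd_map Q b /\
    forall e x y, val e = [set x; y] -> h x y -> rl (b e) =2 tau Q x y.
Proof.
move=> zQ kn; apply: nbhd_map_ex.
- exact: tauC.
- exact: tau_ex.
- exact: tau_onto.
- by move=> x y w Z Z' xy xw yw; apply: tau_adj.
by move=> x y z w Z Z' xy zw xz xw yz yw; apply: tau_nadj.
Qed.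

End Maps.

Lemma star_ends (H : sgraph) (e1 e2 e3 : line H) :
  e1 -- e2 -> e1 -- e3 -> e2 -- e3 -> star e1 e2 e3 ->
  exists s a1 a2 a3, [/\ [/\ val e1 = [set s; a1], val e2 = [set s; a2] & val e3 = [set s; a3]],
    [/\ s -- a1, s -- a2 & s -- a3] & [/\ a1 <> a2, a1 <> a3 & a2 <> a3]].
Proof.
move=> /line_adjP[n12 _] /line_adjP[n13 _] /line_adjP[n23 _].
case/starP=> s [/edge_at[a1 [s1 E1]] /edge_at[a2 [s2 E2]] /edge_at[a3 [s3 E3]]].
exists s, a1, a2, a3; split=> //; split=> e.
- by apply: n12; apply: val_inj; rewrite E1 E2 e.
- by apply: n13; apply: val_inj; rewrite E1 E3 e.
by apply: n23; apply: val_inj; rewrite E2 E3 e.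
Qed.

(** The two neighbourhood maps turn [f] into an isomorphism of line graphs, and two different tests
    show that it respects stars. A star sent to a triangle fails [triangle_like], which holds at the
    image and is pulled back. A triangle sent to a star fails [common_away], which the finest
    partition always provides and [tau_star] forbids. *)
Theorem bell_core (G1 G2 : sgraph) (k1 k2 : nat) (f : bell_geq G1 k1 -> bell_geq G2 k2) :
  k1 + 2 <= #|G1| -> k2 + 2 <= #|G2| ->
  bijective f -> (forall x y, (f x -- f y) = (x -- y)) ->
  core (compl G1) ~= core (compl G2).
Proof.
move=> kn1 kn2 fB fE.
have [|O zO] := @zero_ex G1 k1; first lia.
have zQ := zero_like_iso fB fE (zero_like_zero kn1 zO).
have [|b1 [m1 s1]] := zero_map _ zO; first lia.
have [b2 [m2 s2]] := tau_map zQ kn2.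
have [a [aB aE ab]] := nbhd_iso fB fE m1 m2.
apply: (@line_iso_core _ _ a); first by [].
have [g fK gK] := fB.
have gE x y : (g x -- g y) = (x -- y) by rewrite -fE !gK.
have gB : bijective g by exists f.
move=> e1 e2 e3 a12 a13 a23.
have [a12' a13' a23'] : [/\ a e1 -- a e2, a e1 -- a e3 & a e2 -- a e3] by rewrite !aE.
case se: (star e1 e2 e3).
  have [//|nsf] := boolP (star (a e1) (a e2) (a e3)); exfalso.
  have [x [y [z [E1 E2 E3 [xy xz yz]]]]] := nonstar_triangle a12' a13' a23' nsf.
  have [s [t1 [t2 [t3 [[F1 F2 F3] [h1 h2 h3] [n12 n13 n23]]]]]] := star_ends a12 a13 a23 se.
  apply: (zero_star zO h1 h2 h3 n12 n13 n23 (s1 _ _ _ F1 h1) (s1 _ _ _ F2 h2) (s1 _ _ _ F3 h3)).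
  have yx : @nonedge G2 y x by rewrite h_sym.
  have E1' : val (a e1) = [set y; x] by rewrite E1 setUC.
  have := tau_triangle zQ kn2 yx xz yz (s2 _ _ _ E1' yx) (s2 _ _ _ E2 xz) (s2 _ _ _ E3 yz).
  by move/(triangle_like_iso gB gE); rewrite !ab !fK.
have [sf|/negPf //] := boolP (star (a e1) (a e2) (a e3)); exfalso.
have [x [y [z [E1 E2 E3 [xy xz yz]]]]] := nonstar_triangle a12 a13 a23 (negbT se).
have [s [t1 [t2 [t3 [[F1 F2 F3] [h1 h2 h3] [n12 n13 n23]]]]]] := star_ends a12' a13' a23' sf.
apply: (tau_star zQ kn2 h1 h2 h3 n12 n13 n23 (s2 _ _ _ F1 h1) (s2 _ _ _ F2 h2) (s2 _ _ _ F3
  h3)).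
have yx : @nonedge G1 y x by rewrite h_sym.
have E1' : val e1 = [set y; x] by rewrite E1 setUC.
have := zero_triangle kn1 zO yx xz yz (s1 _ _ _ E1' yx) (s1 _ _ _ E2 xz) (s1 _ _ _ E3 yz).
by move/(common_away_iso fB fE); rewrite !ab.
Qed.

(** * Partitions along isomorphisms of cores *)

(* Clique partitions of the complement, as relations. *)
Definition admissible (G : sgraph) (r : rel G) :=
  eqv r /\ forall x y, r x y -> x != y -> nonedge x y.

Lemma rl_admissible (G : sgraph) k (P : bell_geq G k) : admissible (rl P).
Proof. by split; [exact: rl_eqv|move=> x y; apply: rl_h]. Qed.

Lemma admissible_mk (G : sgraph) k (r : rel G) : admissible r -> k <= classes r ->
  exists P : bell_geq G k, rl P =2 r.
Proof. by case=> er rh; apply: rl_mk. Qed.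

Lemma admissible_eq (G : sgraph) : admissible (@eq_op G).
Proof. by split; [exact: eqv_eq|move=> x y ->]. Qed.

Lemma admissible_out (G : sgraph) (r : rel G) v : admissible r -> admissible (mv r v v).
Proof.
case=> er rh; split; first exact: eqv_mv.
move=> x y; rewrite /mv eqxx /= orbF; case: eqP => [->|_]; first by move=> /eqP->; rewrite eqxx.
by case: eqP => // _; apply: rh.
Qed.

Lemma classes_out (G : sgraph) (r : rel G) v : admissible r -> ~~ single r v ->
  classes (mv r v v) = classes r + 1.
Proof.
by case=> er _ ns; have := classes_mv v v er; rewrite (negPf ns) eqxx addn0.
Qed.

Lemma nonzero_rel (G : sgraph) (r : rel G) : admissible r ->
  (r =2 eq_op) \/ exists v, ~~ single r v.
Proof.
case=> -[rr rs rt] _; case: (pickP (fun v => ~~ single r v)) => [v nv|no].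
  by right; exists v.
left=> x y; apply/idP/eqP => [xy|->]; last exact: rr.
by have /negbFE/singleP s := no x; rewrite (s _ xy).
Qed.

(** Induction on the rank [n - classes r]: isolating one vertex at a time leads to the finest
    partition. The first hypothesis is needed because relations are functions, compared
    pointwise. *)
Lemma admissible_ind (G : sgraph) (T : rel G -> Prop) :
  (forall r q, r =2 q -> admissible r -> T r -> T q) ->
  T eq_op ->
  (forall r v, admissible r -> ~~ single r v -> T (mv r v v) -> T r) ->
  forall r, admissible r -> T r.
Proof.
move=> ext T0 Tout r; have [n] := ubnP (#|G| - classes r).
elim: n r => // n IH r lt ar; have [e|[v nv]] := nonzero_rel ar.
  by apply: ext T0; [move=> x y; rewrite e|exact: admissible_eq].
apply: (Tout _ _ ar nv); apply: IH; last exact: admissible_out.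
have := classes_out ar nv; have [er _] := admissible_out v ar.
by have := classes_le er; lia.
Qed.

Lemma admissible_classes (G : sgraph) (r : rel G) j : admissible r ->
  classes r <= j <= #|G| -> exists2 q : rel G, admissible q & classes q = j.
Proof.
move=> ar; move: r ar; apply: admissible_ind.
- by move=> r q e _ H; rewrite -(classes_ext e).
- rewrite classes_eq => jn; exists eq_op; first exact: admissible_eq.
  by rewrite classes_eq; apply/eqP; rewrite eqn_leq.
move=> r v ar nv H /andP[rj jn]; have [e|n] := eqVneq (classes r) j.
  by exists r.
by apply: H; rewrite classes_out // jn andbT addn1 ltn_neqAle n.
Qed.

Lemma core_vertex (G : sgraph) (x y : G) : nonedge x y ->
  exists x' : core (compl G), val x' = x.
Proof.
move=> xy; have x0 : x \in [set x : compl G | 0 < degree x].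
  by rewrite inE; apply/degree_gt0P; exists y.
by exists (Sub x x0).
Qed.

Section Transfer.
Variables (G1 G2 : sgraph).
Local Notation C1 := (core (compl G1)).
Local Notation C2 := (core (compl G2)).
Variables (f : C1 -> C2) (g : C2 -> C1).
Hypotheses (fK : cancel f g) (gK : cancel g f).
Hypothesis fE : forall x y, (f x -- f y) = (x -- y).

Implicit Types (r q : rel G1).

(** Vertices outside the core of the complement are universal in the graph and hence singletons in
    every partition; they become singletons again on the other side. *)
Definition transfer (r : rel G1) : rel G2 := fun u v =>
  (u == v) || [exists x : C1, exists y : C1,
    [&& val (f x) == u, val (f y) == v & r (val x) (val y)]].

Lemma transferE r (x y : C1) : eqv r ->
  transfer r (val (f x)) (val (f y)) = r (val x) (val y).
Proof.
case=> rr _ _; apply/orP/idP => [[|]|rxy].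
- by rewrite val_eqE (inj_eq (can_inj fK)) => /eqP->; apply: rr.
- move=> /existsP[x' /existsP[y' /and3P[]]].
  by rewrite !val_eqE !(inj_eq (can_inj fK)) => /eqP-> /eqP->.
by right; apply/existsP; exists x; apply/existsP; exists y; rewrite !eqxx.
Qed.

Lemma transferP r u v : u != v -> transfer r u v ->
  exists x y : C1, [/\ val (f x) = u, val (f y) = v & r (val x) (val y)].
Proof.
move=> n; rewrite /transfer (negPf n) => /existsP[x /existsP[y /and3P[/eqP ? /eqP ? ?]]].
by exists x, y.
Qed.

Lemma transfer_admissible r : admissible r -> admissible (transfer r).
Proof.
move=> [er rh]; have [rr rs rt] := er; split; first split.
- by move=> u; rewrite /transfer eqxx.
- suff H u v : transfer r u v -> transfer r v u by move=> u v; apply/idP/idP; apply: H.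
  have [->//|n] := eqVneq u v; move=> /(transferP n)[x [y [<- <- xy]]].
  by rewrite transferE // rs.
- move=> v u w; have [->//|n] := eqVneq u v; have [->//|n'] := eqVneq v w.
  move=> /(transferP n)[x [y [<- ev xy]]] /(transferP n')[y' [z [ev' <- yz]]].
  rewrite transferE //; apply: rt xy _.
  have yy : y = y' by apply: (can_inj fK); apply: val_inj; rewrite ev ev'.
  by rewrite yy.
move=> u v uv n; have [x [y [eu ev xy]]] := transferP n uv.
have nxy : val x != val y.
  by apply: contra n => /eqP/val_inj e; rewrite -eu -ev e.
have := fE x y; rewrite -eu -ev => E.
have hxy := rh _ _ xy nxy.
have : f x -- f y by rewrite E.
by [].
Qed.

Lemma transfer_ext r q : r =2 q -> transfer r =2 transfer q.
Proof.
move=> e u v; rewrite /transfer; congr (_ || _); apply: eq_existsb => x.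
by apply: eq_existsb => y; rewrite e.
Qed.

Lemma transfer_off r q (v : C1) : agree_off (val v) r q ->
  agree_off (val (f v)) (transfer r) (transfer q).
Proof.
move=> a u w uv wv; rewrite /transfer; congr (_ || _); apply: eq_existsb => x.
apply: eq_existsb => y; case: eqP => //= ex; case: eqP => //= ey.
apply: a; rewrite val_eqE; [apply: contra uv|apply: contra wv] => /eqP e;
by rewrite -?ex -?ey e.
Qed.

Lemma transfer_nsingle r (v : C1) : admissible r -> ~~ single r (val v) ->
  ~~ single (transfer r) (val (f v)).
Proof.
move=> [er rh] /nsingleP[y yv vy]; have [_ rs _] := er.
have [y' ey] : exists y' : C1, val y' = y.
  by apply: (@core_vertex G1 _ (val v)); apply: (rh _ _ _ yv); rewrite rs.
apply/nsingleP; exists (val (f y')); last by rewrite transferE // ey.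
by rewrite val_eqE (inj_eq (can_inj fK)) -val_eqE ey.
Qed.

Lemma transfer_single r (v : C1) : admissible r -> single r (val v) ->
  single (transfer r) (val (f v)).
Proof.
move=> [er rh] /singleP sv; apply/singleP => u; have [->//|n] := eqVneq u (val (f v)).
rewrite eq_sym in n; move=> /(transferP n)[x [y [ev eu xy]]].
have xv : x = v by apply: (can_inj fK); apply: val_inj.
by move: xy; rewrite xv => /sv/val_inj yv; rewrite -eu yv.
Qed.

(** The rank [n - classes] is preserved, stated without subtraction: isolating a vertex raises both
    counts by one, and both finest partitions have rank zero. *)
Lemma transfer_classes r : admissible r ->
  classes r + #|G2| = classes (transfer r) + #|G1|.
Proof.
move: r; apply: admissible_ind.
- by move=> r q e _; rewrite (classes_ext e) (classes_ext (transfer_ext e)).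
- rewrite classes_eq.
  have -> : classes (transfer eq_op) = #|G2|; last by rewrite addnC.
  rewrite -classes_eq; apply: classes_ext => u v; rewrite /transfer.
  case: eqP => //= uv; apply/negbTE; apply/existsP => -[x /existsP[y /and3P[/eqP ex /eqP ey]]].
  by rewrite val_eqE => /eqP e; apply: uv; rewrite -ex -ey e.
move=> r v ar nv; rewrite classes_out //.
have [er rh] := ar; have [_ rs _] := er.
have [v' ev] : exists v' : C1, val v' = v.
  have /nsingleP[y yv vy] := nv; apply: (@core_vertex G1 _ y); apply: rh vy _.
  by rewrite eq_sym.
subst v; have ao := admissible_out (val v' : G1) ar.
have := classes_move (transfer_admissible ar).1 (transfer_admissible ao).1
  (@transfer_off r (@mv G1 r (val v') (val v')) v' _).
have sv : single (@mv G1 r (val v') (val v')) (val v').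
  by apply/singleP => y; rewrite /mv !eqxx orbF => /eqP.
rewrite (transfer_single ao sv) (negPf (transfer_nsingle ar nv)) addn0.
have H : agree_off (val v') r (@mv G1 r (val v') (val v')) by move=> x y ? ?; rewrite mv_off.
by move=> /(_ H) <-; lia.
Qed.

End Transfer.

Section BellTransfer.
Variables (G1 G2 : sgraph) (k1 k2 : nat).
Local Notation C1 := (core (compl G1)).
Local Notation C2 := (core (compl G2)).
Variables (f : C1 -> C2) (g : C2 -> C1).
Hypotheses (fK : cancel f g) (gK : cancel g f).
Hypothesis fE : forall x y, (f x -- f y) = (x -- y).

Lemma core_gE x y : (g x -- g y) = (x -- y).
Proof. by rewrite -fE !gK. Qed.

Lemma transferK (r : rel G1) : admissible r -> transfer g (transfer f r) =2 r.
Proof.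
move=> ar; have at_ := transfer_admissible fK fE ar.
have [[rr rs rt] rh] := ar; move=> x y.
have [->|n] := eqVneq x y; first by rewrite rr /transfer eqxx.
apply/idP/idP => [/(transferP n)[u [v [<- <-]]]|xy].
  rewrite -[r _ _](transferE fK _ _ ar.1) ?gK //.
have [x' ex] := core_vertex (rh _ _ xy n).
have [y' ey] : exists y' : C1, val y' = y.
  by apply: (@core_vertex G1 _ x); apply: rh; rewrite 1?rs 1?eq_sym.
have := transferE gK (f x') (f y') at_.1; rewrite !fK ex ey => ->.
by rewrite (transferE fK _ _ ar.1) ex ey.
Qed.

Lemma transfer_map :
  (forall r, admissible r -> k1 <= classes r -> k2 <= classes (transfer f r)) ->
  exists F : bell_geq G1 k1 -> bell_geq G2 k2, [/\ injective F,
    forall P, rl (F P) =2 transfer f (rl P)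
    & forall P P', P -- P' -> F P -- F P'].
Proof.
move=> H.
have ex (P : bell_geq G1 k1) : exists P' : bell_geq G2 k2, rl P' =2 transfer f (rl P).
  apply: admissible_mk; first exact: (transfer_admissible fK fE (rl_admissible P)).
  by apply: H; [exact: rl_admissible|exact: rl_ge].
have [F FE] := fin_all_exists ex; exists F.
have FI : injective F.
  move=> P P' e; apply: rl_inj => x y.
  rewrite -(transferK (rl_admissible P)) -(transferK (rl_admissible P')).
  by apply: transfer_ext => u v; rewrite -!FE e.
split=> // P P' /adjP[n [v av]]; apply/adjP; split; first by move/FI.
(* The moved vertex is nonisolated in the complement: if it were a singleton in both partitions they
   would be equal. *)
have [v' ev] : exists v' : C1, val v' = v.
  case: (boolP (single (rl P) v)) => [sP|/nsingleP[y yv vy]]; last first.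
    by apply: (@core_vertex G1 _ y); apply: rl_h vy _; rewrite eq_sym.
  case: (boolP (single (rl P') v)) => [sP'|/nsingleP[y yv vy]]; last first.
    by apply: (@core_vertex G1 _ y); apply: rl_h vy _; rewrite eq_sym.
  case: n; apply: rl_agree av _ => x xv.
  by rewrite (single_rl _ sP) (single_rl _ sP').
exists (val (f v')) => x y xv yv; rewrite !FE.
have H0 : agree_off (val v' : G1) (rl P) (rl P') by rewrite ev.
exact: (transfer_off H0 xv yv).
Qed.

End BellTransfer.

Lemma core_iso_maps (G1 G2 : sgraph) : core (compl G1) ~= core (compl G2) ->
  exists (f : core (compl G1) -> core (compl G2)) (g : core (compl G2) -> core (compl G1)),
  [/\ cancel f g, cancel g f & forall x y, (f x -- f y) = (x -- y)].
Proof. by move=> /isoP[f [[g fK gK] fE]]; exists f, g. Qed.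

Lemma bell_iso_of_core (G1 G2 : sgraph) (k1 k2 : nat) f g :
  cancel f g -> cancel g f -> (forall x y, (f x -- f y) = (x -- y)) ->
  (forall r : rel G1, admissible r -> k1 <= classes r -> k2 <= classes (transfer f r)) ->
  (forall r : rel G2, admissible r -> k2 <= classes r -> k1 <= classes (transfer g r)) ->
  bell_geq G1 k1 ~= bell_geq G2 k2.
Proof.
move=> fK gK fE H1 H2.
have gE := core_gE gK fE.
have [F [FI FE FA]] := transfer_map fK gK fE H1.
have [H [HI HE HA]] := transfer_map gK fK gE H2.
have HF P : H (F P) = P.
  apply: rl_inj => x y; rewrite HE -[RHS](transferK fK gK fE (rl_admissible P)).
  by apply: transfer_ext => u v; rewrite FE.
have FH P : F (H P) = P.
  apply: rl_inj => x y; rewrite FE -[RHS](transferK gK fK gE (rl_admissible P)).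
  by apply: transfer_ext => u v; rewrite HE.
apply/isoP; exists F; split; first by exists H.
move=> P P'; apply/idP/idP; last exact: FA.
by move/HA; rewrite !HF.
Qed.

(** Transfer embeds the first graph into the second, and [r] is not reached because its preimage has
    fewer than [k1] classes. *)
Lemma bell_card_lt (G1 G2 : sgraph) (k1 k2 : nat) f g (r : rel G2) :
  cancel f g -> cancel g f -> (forall x y, (f x -- f y) = (x -- y)) ->
  (forall r : rel G1, admissible r -> k1 <= classes r -> k2 <= classes (transfer f r)) ->
  admissible r -> k2 <= classes r -> classes (transfer g r) < k1 ->
  #|bell_geq G1 k1| < #|bell_geq G2 k2|.
Proof.
move=> fK gK fE H1 ar kr lt.
have [F [FI FE FA]] := transfer_map fK gK fE H1.
have [P PE] := admissible_mk ar kr.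
rewrite -(card_imset predT FI) -cardsT; apply: proper_card.
apply/properP; split; first exact: subsetT.
exists P; rewrite ?inE //; apply/imsetP => -[P' _ eP].
have := rl_ge P'; rewrite leqNgt => /negP; apply.
apply: leq_ltn_trans lt; rewrite (@classes_ext _ _ (rl P')) // => x y.
rewrite -(transferK fK gK fE (rl_admissible P')).
by apply: transfer_ext => u v; rewrite -PE eP FE.
Qed.

Lemma chi_le (G : sgraph) (r : rel G) : admissible r -> chi G <= classes r.
Proof.
move=> [er rh]; rewrite /chi; case: ex_minnP => m _; apply.
pose P := equivalence_partition r [set: G]; pose T := {A : {set G} | A \in P}.
have PT : classes r = #|{: T}| by rewrite card_sig.
rewrite PT.
have cP x : [set y in [set: G] | r x y] \in P by apply/imsetP; exists x.
pose c x : T := @exist {set G} (fun A => A \in P) _ (cP x).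
apply/existsP; exists [ffun x => enum_rank (c x)].
apply/forallP => x; apply/forallP => y; apply/implyP => xy; rewrite !ffunE.
apply: contraTneq xy => /enum_rank_inj/(congr1 val) /= /setP/(_ y).
have [rr _ _] := er; rewrite !inE rr => rxy.
have [->|n] := eqVneq x y; first by rewrite sg_irrefl.
by have := rh _ _ rxy n; rewrite /nonedge /= => /andP[].
Qed.

Lemma chi_ex (G : sgraph) : exists2 r : rel G, admissible r & classes r <= chi G.
Proof.
rewrite /chi; case: ex_minnP => m /existsP[c /forallP cc] _.
exists (fun x y => c x == c y).
  split; first split.
  - by move=> x; rewrite eqxx.
  - by move=> x y; rewrite eq_sym.
  - by move=> y x z /eqP->.
  move=> x y e n; rewrite /nonedge /= n /=; apply/negP => xy.
  by have /forallP/(_ y) := cc x; rewrite xy e.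
rewrite -[X in _ <= X]card_ord -cardsT.
apply: leq_trans (leq_imset_card (fun i => [set y | i == c y]) _).
apply/subset_leq_card/subsetP => A /imsetP[x _ ->].
by apply/imsetP; exists (c x); rewrite ?inE //; apply/setP => y; rewrite !inE.
Qed.

Section Reconstruction.
Variables (G1 G2 : sgraph) (k1 k2 : nat).
Hypothesis cG : core (compl G1) ~= core (compl G2).

Lemma bell_iso_same : k1 <= #|G1| -> k2 <= #|G2| -> #|G1| - k1 = #|G2| - k2 ->
  bell_geq G1 k1 ~= bell_geq G2 k2.
Proof.
move=> kn1 kn2 kk; have [f [g [fK gK fE]]] := core_iso_maps cG.
apply: (bell_iso_of_core fK gK fE) => r ar kr.
  have := transfer_classes fK fE ar; lia.
have := transfer_classes gK (core_gE gK fE) ar; lia.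
Qed.

Lemma bell_iso_full : k1 <= chi G1 -> k2 <= chi G2 ->
  bell_geq G1 k1 ~= bell_geq G2 k2.
Proof.
move=> kn1 kn2; have [f [g [fK gK fE]]] := core_iso_maps cG.
apply: (bell_iso_of_core fK gK fE) => r ar kr.
  exact: leq_trans kn2 (chi_le (transfer_admissible fK fE ar)).
exact: leq_trans kn1 (chi_le (transfer_admissible gK (core_gE gK fE) ar)).
Qed.

End Reconstruction.

(** The bound [k1] excludes no partition of [G1], whereas [k2] excludes an optimal colouring of
    [G2]; its transfer is the extra vertex. *)
Lemma chi_lt_card (G1 G2 : sgraph) k1 k2 : core (compl G1) ~= core (compl G2) ->
  k1 <= chi G1 -> chi G2 < k2 -> k2 <= #|G2| ->
  #|bell_geq G2 k2| < #|bell_geq G1 k1|.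
Proof.
move=> cG kc1 kc2 kn2; have [f [g [fK gK fE]]] := core_iso_maps cG.
have gE := core_gE gK fE; have [r ar rc] := chi_ex G2.
have at_ := transfer_admissible gK gE ar.
apply: (bell_card_lt (r := transfer g r) gK fK gE) => //.
- by move=> q aq _; apply: leq_trans kc1 (chi_le (transfer_admissible gK gE aq)).
- exact: leq_trans kc1 (chi_le at_).
rewrite (classes_ext (transferK gK fK gE ar)); exact: leq_ltn_trans rc kc2.
Qed.

(** An optimal colouring of [G2] is refined to exactly [k2] classes; its rank [n2 - k2] is too large
    for [G1] to contain its transfer. *)
Lemma rank_lt_card (G1 G2 : sgraph) k1 k2 : core (compl G1) ~= core (compl G2) ->
  k1 <= #|G1| -> chi G2 < k2 -> k2 <= #|G2| -> #|G1| - k1 < #|G2| - k2 ->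
  #|bell_geq G1 k1| < #|bell_geq G2 k2|.
Proof.
move=> cG kn1 kc2 kn2 lt; have [f [g [fK gK fE]]] := core_iso_maps cG.
have gE := core_gE gK fE; have [r ar rc] := chi_ex G2.
have [|q aq qk] := @admissible_classes _ _ k2 ar.
  by rewrite kn2 andbT; apply: leq_trans rc _; apply: ltnW.
apply: (bell_card_lt (r := q) fK gK fE) => //.
- by move=> t at_ kt; have := transfer_classes fK fE at_; lia.
- by rewrite qk.
by have := transfer_classes gK gE aq; rewrite qk; lia.
Qed.

(** Each mismatch of the parameters makes one of the graphs embed in the other with a vertex left
    over, so the numbers of vertices differ. *)
Theorem bell_parameters (G1 G2 : sgraph) k1 k2 :
  core (compl G1) ~= core (compl G2) -> bell_geq G1 k1 ~= bell_geq G2 k2 ->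
  k1 + 2 <= #|G1| -> k2 + 2 <= #|G2| ->
  (k1 <= chi G1 /\ k2 <= chi G2) \/
  [/\ chi G1 < k1, chi G2 < k2 & #|G1| - k1 = #|G2| - k2].
Proof.
move=> cG /iso_card bc kn1 kn2; have cG' := iso_sym cG.
have n1 : k1 <= #|G1| by lia.
have n2 : k2 <= #|G2| by lia.
case: (leqP k1 (chi G1)) => c1; case: (leqP k2 (chi G2)) => c2.
- by left.
- by have := chi_lt_card cG c1 c2 n2; rewrite bc ltnn.
- by have := chi_lt_card cG' c2 c1 n1; rewrite bc ltnn.
right; split=> //; case: (ltngtP (#|G1| - k1) (#|G2| - k2)) => // lt.
  by have := rank_lt_card cG n1 c2 n2 lt; rewrite bc ltnn.
by have := rank_lt_card cG' n2 c1 n1 lt; rewrite bc ltnn.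
Qed.

(** * Stars, triangles and paws *)

Lemma core_compl (G : sgraph) : core (compl G) ~= compl (del_universal G).
Proof.
have -> : core (compl G) = @induced (compl G) [set x : G | ~~ universal x].
  by congr induced; apply/setP => x; rewrite !inE universal_compl.
apply/isoP; exists id; split; first by exists id.
by move=> x y; rewrite /= val_eqE.
Qed.

Lemma del_universal_iff (G X : sgraph) :
  del_universal G ~= X <-> core (compl G) ~= compl X.
Proof.
split=> [/compl_iso c|c].
  exact: iso_trans (core_compl G) c.
by apply: compl_iso_inv; apply: iso_trans (iso_sym (core_compl G)) c.
Qed.

Definition star_at (H : sgraph) (s : H) :=
  (exists y, s -- y) /\ forall x y, x -- y -> x = s \/ y = s.

Definition triangle_on (H : sgraph) (a b c : H) :=
  [/\ a -- b, a -- c, b -- c & forall x y, x -- y -> x \in [:: a; b; c]].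

Definition paw_on (H : sgraph) (a b c d : H) :=
  [/\ [/\ a -- b, a -- c & b -- c], a -- d, d \notin [:: a; b; c] &
    forall x y, x -- y -> [\/ (x \in [:: a; b; c]) && (y \in [:: a; b; c]),
       x = a /\ y = d | x = d /\ y = a]].

Section Small.
Variable H : sgraph.
Implicit Types (a b c d s x y : H).

Lemma core_mem x y : x -- y -> x \in [set x : H | 0 < degree x].
Proof. by move=> xy; rewrite inE; apply/degree_gt0P; exists y. Qed.

Lemma core_val_adj (x y : core H) : (x -- y) = (val x -- val y).
Proof. by []. Qed.

(** The complement of [K_m + K_1] is the star with [m] leaves: the clique becomes the leaves and the
    extra vertex the centre. *)
Lemma star_core s : star_at s ->
  core H ~= compl (dunion (complete #|[set y | s -- y]|) (complete 1)).
Proof.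
move=> [[y0 sy0] st]; set A := [set y | s -- y].
have lA (i : 'I_#|A|) : s -- enum_val i by have := enum_valP i; rewrite inE.
have l0 (i : 'I_#|A|) : enum_val i \in [set x : H | 0 < degree x].
  by apply: (@core_mem _ s); rewrite sg_sym.
pose p (i : 'I_#|A| + 'I_1) : core H :=
  match i with inl i => Sub (enum_val i) (l0 i) | inr _ => Sub s (core_mem sy0) end.
apply: (@iso_enum _ _ (compl (dunion (complete #|A|) (complete 1))) p id) => //.
- case=> [i|i] [j|j] /(congr1 val) /= e.
  + by congr inl; apply: enum_val_inj.
  + by have := lA i; rewrite e sg_irrefl.
  + by have := lA j; rewrite -e sg_irrefl.
  by rewrite [i]ord1 [j]ord1.
- move=> x; have := valP x; rewrite inE => /degree_gt0P[y xy].
  case: (st _ _ xy) => e; first by exists (inr ord0); apply: val_inj.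
  have xA : val x \in A by rewrite inE sg_sym -e.
  by exists (inl (enum_rank_in xA (val x))); apply: val_inj; rewrite /= enum_rankK_in.
- by move=> y; exists y.
case=> [i|i] [j|j]; rewrite core_val_adj.
- have -> : (val (p (inl i)) -- val (p (inl j))) = false.
    apply/negP => ij; case: (st _ _ ij) => /= e.
      by have := lA i; rewrite e sg_irrefl.
    by have := lA j; rewrite e sg_irrefl.
  by rewrite /= negbK; apply/esym/andP => -[/eqP n /eqP e]; apply: n; rewrite e.
- by rewrite /= sg_sym lA.
- by rewrite /= lA.
by rewrite /= sg_irrefl [i]ord1 [j]ord1 !eqxx.
Qed.

Lemma core_edge (X : sgraph) (f : X -> core H) : bijective f ->
  (forall u v, (f u -- f v) = (u -- v)) ->
  forall x y, x -- y -> exists u v, [/\ val (f u) = x, val (f v) = y & u -- v].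
Proof.
move=> [g fK gK] fE x y xy.
have yx : y -- x by rewrite sg_sym.
exists (g (Sub x (core_mem xy))), (g (Sub y (core_mem yx))).
by rewrite -fE !gK.
Qed.

Lemma core_star m : core H ~= compl (dunion (complete m) (complete 1)) ->
  exists s, star_at s /\ #|[set y | s -- y]| = m.
Proof.
move=> /iso_sym/isoP[f [fB fE]]; have ed := core_edge fB fE.
pose s := val (f (inr ord0)); pose l (i : 'I_m) := val (f (inl i)).
have sl i : s -- l i by have := fE (inr ord0) (inl i).
have lI : injective l by move=> i j /val_inj/(bij_inj fB)[].
exists s; split; last first.
  rewrite -[RHS]card_ord -(card_imset _ lI); apply: eq_card => y.
  rewrite inE; apply/idP/imsetP => [/ed[u [v [eu <- uv]]]|[i _ ->]]; last exact: sl.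
  have ue : u = inr ord0 by apply: (bij_inj fB); apply: val_inj.
  subst u; case: v uv => [j|j]; first by exists j.
  by rewrite [j]ord1 sg_irrefl.
split.
  have := valP (f (inr ord0)); rewrite inE => /degree_gt0P[y sy].
  by exists y.
move=> x y /ed[[i|i] [[j|j] [<- <- ij]]].
- by move: ij; rewrite /= negbK => /andP[/eqP n /eqP e]; case: n; rewrite e.
- by right; rewrite [j]ord1.
- by left; rewrite [i]ord1.
by left; rewrite [i]ord1.
Qed.

Lemma triangle_core a b c : triangle_on a b c -> core H ~= compl (compl (complete 3)).
Proof.
move=> [ab ac bc on].
have [nab nac nbc] := And3 (edge_neq ab) (edge_neq ac) (edge_neq bc).
have [ba ca cb] : [/\ b -- a, c -- a & c -- b] by rewrite ![_ -- a]sg_sym ![c -- b]sg_sym.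
pose p (i : 'I_3) : core H :=
  match val i with 0 => Sub a (core_mem ab) | 1 => Sub b (core_mem bc)
    | _ => Sub c (core_mem cb) end.
apply: (@iso_enum _ _ (compl (compl (complete 3))) p id) => //.
- case=> [[|[|[|//]]] i] [[|[|[|//]]] j] /(congr1 val) /= e; apply/val_inj => //=;
  by move: nab nac nbc; rewrite e eqxx.
- move=> x; have := valP x; rewrite inE => /degree_gt0P[y /on].
  rewrite !inE => /or3P[]/eqP xE.
  + by exists (Ordinal (isT : 0 < 3)); apply: val_inj.
  + by exists (Ordinal (isT : 1 < 3)); apply: val_inj.
  by exists (Ordinal (isT : 2 < 3)); apply: val_inj.
- by move=> y; exists y.
by case=> [[|[|[|//]]] i] [[|[|[|//]]] j] /=; rewrite ?sg_irrefl ?ab ?ac ?bc ?ba ?ca ?cb.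
Qed.

Lemma core_triangle : core H ~= compl (compl (complete 3)) ->
  exists a b c, triangle_on a b c.
Proof.
move=> /iso_sym/isoP[f [fB fE]]; have ed := core_edge fB fE.
pose o i (lt : i < 3) : compl (compl (complete 3)) := Ordinal lt.
exists (val (f (o 0 isT))), (val (f (o 1 isT))), (val (f (o 2 isT))); split.
- by have := fE (o 0 isT) (o 1 isT).
- by have := fE (o 0 isT) (o 2 isT).
- by have := fE (o 1 isT) (o 2 isT).
move=> x y /ed[u [v [<- _ _]]]; rewrite !inE.
by case: u => [[|[|[|//]]] i]; apply/or3P; [constructor 1|constructor 2|constructor 3];
  apply/eqP; congr (val (f _)); apply: val_inj.
Qed.

Lemma paw_core a b c d : paw_on a b c d ->
  core H ~= compl (dunion (path_graph 3) (complete 1)).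
Proof.
move=> [[ab ac bc] ad dT on].
have [nab nac nbc] := And3 (edge_neq ab) (edge_neq ac) (edge_neq bc).
have [ba ca cb] : [/\ b -- a, c -- a & c -- b] by rewrite ![_ -- a]sg_sym ![c -- b]sg_sym.
have da : d -- a by rewrite sg_sym.
have := dT; rewrite !inE !negb_or => /and3P[nda ndb ndc].
have nbd : b -- d = false.
  apply/negP => /on[/andP[_ bT]|[e _]|[e _]]; first by rewrite bT in dT.
    by rewrite e eqxx in nab.
  by rewrite e eqxx in ndb.
have ncd : c -- d = false.
  apply/negP => /on[/andP[_ bT]|[e _]|[e _]]; first by rewrite bT in dT.
    by rewrite e eqxx in nac.
  by rewrite e eqxx in ndc.
have ndb' : d -- b = false by rewrite sg_sym.
have ndc' : d -- c = false by rewrite sg_sym.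
(* In the complement of [P_3 + K_1] the isolated vertex becomes the vertex [a] of degree three, the
   ends of the path become [b] and [c], and its middle becomes the pendant vertex [d]. *)
pose p (i : 'I_3 + 'I_1) : core H :=
  match i with inl i => match val i with 0 => Sub b (core_mem bc)
    | 1 => Sub d (core_mem da) | _ => Sub c (core_mem cb) end
    | inr _ => Sub a (core_mem ab) end.
apply: (@iso_enum _ _ (compl (dunion (path_graph 3) (complete 1))) p id) => //.
- case=> [[[|[|[|//]]] i]|i] [[[|[|[|//]]] j]|j] /(congr1 val) /= e;
  rewrite ?[i]ord1 ?[j]ord1 //; try (by congr inl; apply: val_inj);
  by move: nab nac nbc nda ndb ndc; rewrite e ?eqxx.
- move=> x; have := valP x; rewrite inE => /degree_gt0P[y xy].
  have : [|| val x == a, val x == b, val x == c | val x == d].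
    have := on _ _ xy; rewrite !inE => -[/andP[/or3P[]->]|[-> _]|[-> _]];
      rewrite ?eqxx ?orbT //.
  case/or4P=> /eqP xE.
  + by exists (inr ord0); apply: val_inj.
  + by exists (inl (Ordinal (isT : 0 < 3))); apply: val_inj.
  + by exists (inl (Ordinal (isT : 2 < 3))); apply: val_inj.
  by exists (inl (Ordinal (isT : 1 < 3))); apply: val_inj.
- by move=> y; exists y.
case=> [[[|[|[|//]]] i]|i] [[[|[|[|//]]] j]|j]; rewrite core_val_adj /=;
rewrite ?[i]ord1 ?[j]ord1 ?sg_irrefl ?eqxx ?ab ?ac ?bc ?ba ?ca ?cb ?ad ?da ?nbd ?ncd ?ndb'
  ?ndc' //.
Qed.

Lemma core_paw : core H ~= compl (dunion (path_graph 3) (complete 1)) ->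
  exists a b c d, paw_on a b c d.
Proof.
move=> /iso_sym/isoP[f [fB fE]]; have ed := core_edge fB fE.
pose o i (lt : i < 3) : compl (dunion (path_graph 3) (complete 1)) := inl (Ordinal lt).
pose t : compl (dunion (path_graph 3) (complete 1)) := inr ord0.
exists (val (f t)), (val (f (o 0 isT))), (val (f (o 2 isT))), (val (f (o 1 isT))).
have fI u v : (val (f u) == val (f v)) = (u == v).
  by rewrite val_eqE (inj_eq (bij_inj fB)).
have oE u : [\/ u = t, u = o 0 isT, u = o 1 isT | u = o 2 isT].
  case: u => [[[|[|[|//]]] i]|i]; last by constructor 1; rewrite [i]ord1.
  - by constructor 2; congr inl; apply: val_inj.
  - by constructor 3; congr inl; apply: val_inj.
  by constructor 4; congr inl; apply: val_inj.
split; first split.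
- by have := fE t (o 0 isT).
- by have := fE t (o 2 isT).
- by have := fE (o 0 isT) (o 2 isT).
- by have := fE t (o 1 isT).
- by rewrite !inE !fI.
move=> x y /ed[u [v [<- <- uv]]]; rewrite !inE !fI.
by case: (oE u) (oE v) uv => -> [] -> // _;
  first [by constructor 1|by constructor 2|by constructor 3].
Qed.

Lemma card_line_star s : star_at s -> #|line H| = #|[set y | s -- y]|.
Proof.
move=> [_ st].
have ex (e : line H) : exists y, s -- y /\ val e = [set s; y].
  have [x [y [xy eE]]] := edge_ends e; case: (st _ _ xy) => e0; subst s.
    by exists y.
  by exists x; rewrite sg_sym setUC.
have [F FE] := fin_all_exists ex.
have FI : injective F.
  by move=> e e' ee; apply: val_inj; rewrite (FE e).2 (FE e').2 ee.
rewrite -(card_imset predT FI); apply: eq_card => y; rewrite [RHS]inE.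
apply/imsetP/idP => [[e _ ->]|sy]; first by case: (FE e).
have [e eE] := ex_edge sy; exists e => //.
have := (FE e).2; rewrite eE => /setP/(_ y); rewrite !inE eqxx orbT.
by rewrite eq_sym (negPf (edge_neq sy)) => /esym/eqP.
Qed.

Lemma card_seq (T : finType) (l : seq T) : uniq l -> (forall t, t \in l) ->
  #|T| = size l.
Proof. by move=> /card_uniqP <- H0; apply: eq_card => t; rewrite H0. Qed.

Lemma edge_set_neq (e f : line H) x : x \in val e -> x \notin val f -> e != f.
Proof. by move=> xe; apply: contraNneq => <-. Qed.

Lemma triangle_lines a b c : triangle_on a b c -> exists e1 e2 e3 : line H,
  [/\ val e1 = [set a; b], val e2 = [set a; c], val e3 = [set b; c],
      uniq [:: e1; e2; e3] & forall e, e \in [:: e1; e2; e3]].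
Proof.
move=> [ab ac bc on].
have [nab nac nbc] := And3 (edge_neq ab) (edge_neq ac) (edge_neq bc).
have [e1 E1] := ex_edge ab; have [e2 E2] := ex_edge ac; have [e3 E3] := ex_edge bc.
exists e1, e2, e3; split=> //=.
  rewrite !inE negb_or andbT -andbA; apply/and3P; split.
  - by apply: (edge_set_neq (x := b)); rewrite ?E1 ?E2 !inE; deq.
  - by apply: (edge_set_neq (x := a)); rewrite ?E1 ?E3 !inE; deq.
  by apply: (edge_set_neq (x := a)); rewrite ?E2 ?E3 !inE; deq.
move=> e; have [x [y [xy eE]]] := edge_ends e.
have yx : y -- x by rewrite sg_sym.
have nxy := edge_neq xy; move: (on _ _ xy) (on _ _ yx); rewrite !inE -!val_eqE /= eE E1 E2 E3.
by case/or3P=> /eqP ex; case/or3P=> /eqP ey; subst x y; rewrite ?eqxx // in nxy *;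
  rewrite ?eqxx ?orbT // setUC eqxx ?orbT.
Qed.

End Small.

(** * Complete graphs and complete graphs minus one edge *)

Definition all_adjacent (B : sgraph) := forall x y : B, x <> y -> x -- y.

Definition one_nonedge (B : sgraph) := exists p p' : B, [/\ p <> p', ~~ (p -- p') &
  forall x y, x <> y -> ~~ (x -- y) -> (x = p /\ y = p') \/ (x = p' /\ y = p)].

Lemma bij_of_card (A B : finType) : #|A| = #|B| -> exists f : A -> B, bijective f.
Proof.
move=> e; exists (fun x => enum_val (cast_ord e (enum_rank x))).
exists (fun y => enum_val (cast_ord (esym e) (enum_rank y))) => x.
  by rewrite enum_valK cast_ordK enum_rankK.
by rewrite enum_valK cast_ordKV enum_rankK.
Qed.

Lemma uniq_full (T : finType) (l : seq T) : uniq l -> #|T| <= size l ->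
  forall x, x \in l.
Proof.
move=> ul lT x; apply/negPn/negP => nx.
have /card_uniqP c : uniq (x :: l) by rewrite /= nx.
by have := max_card (mem (x :: l)); rewrite c /= ltnNge lT.
Qed.

Section Transport.
Variables (B C : sgraph).

Lemma all_adjacent_iso : all_adjacent B -> all_adjacent C -> #|B| = #|C| -> B ~= C.
Proof.
move=> aB aC e; have [f fB] := bij_of_card e; apply/isoP; exists f; split=> // x y.
have [->|/eqP n] := eqVneq x y; first by rewrite !sg_irrefl.
by rewrite aB // aC // => /(bij_inj fB).
Qed.

Lemma all_adjacent_transport : B ~= C -> all_adjacent B -> all_adjacent C.
Proof.
move=> /iso_sym/isoP[f [fB fE]] aB x y n; rewrite -fE; apply: aB.
by move/(bij_inj fB).
Qed.

Lemma one_nonedge_transport : B ~= C -> one_nonedge B -> one_nonedge C.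
Proof.
move=> /isoP[f [[g fK gK] fE]] [p [p' [n np H]]]; exists (f p), (f p').
split; first by move/(can_inj fK).
  by rewrite fE.
move=> x y xy nxy; case: (H (g x) (g y)).
- by move/(can_inj gK).
- by rewrite -fE !gK.
- by case=> <- <-; rewrite !gK; left.
by case=> <- <-; rewrite !gK; right.
Qed.

(** Any bijection is corrected by two transpositions in [C]: the first sends [p] to [q], the second
    sends [p'] to [q'] without disturbing the first. *)
Lemma one_nonedge_iso : one_nonedge B -> one_nonedge C -> #|B| = #|C| -> B ~= C.
Proof.
move=> [p [p' [n np Hp]]] [q [q' [m nq Hq]]] e; have [f0 f0B] := bij_of_card e.
pose sw (u v w : C) := if w == u then v else if w == v then u else w.
have swI u v : involutive (sw u v).
  move=> w; rewrite /sw; case: (w =P u) => [->|wu].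
    by case: (v =P u) => [->|]; rewrite ?eqxx.
  case: (w =P v) => [->|wv]; first by rewrite eqxx.
  by move/eqP/negPf: wu => ->; move/eqP/negPf: wv => ->.
pose f1 x := sw (f0 p) q (f0 x).
pose f2 x := sw (f1 p') q' (f1 x).
have f1I : injective f1 by move=> x y /(can_inj (swI _ _))/(bij_inj f0B).
have f2I : injective f2 by move=> x y /(can_inj (swI _ _))/f1I.
have f1p : f1 p = q by rewrite /f1 /sw eqxx.
have f2p' : f2 p' = q' by rewrite /f2 /sw eqxx.
have f2p : f2 p = q.
  rewrite /f2 /sw f1p; case: eqP => [e1|_].
    by case: n; apply: f1I; rewrite f1p.
  by case: eqP => // /m.
have f2B : bijective f2 by apply: inj_card_bij => //; rewrite e.
apply/isoP; exists f2; split=> // x y.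
have [->|/eqP nxy] := eqVneq x y; first by rewrite !sg_irrefl.
have nf : f2 x <> f2 y by move/f2I.
case: (boolP (x -- y)) => xy; case: (boolP (f2 x -- f2 y)) => fxy //.
  case: (Hq _ _ nf fxy) => -[]; rewrite -f2p -f2p' => /f2I ex /f2I ey; subst x y.
    by rewrite xy in np.
  by rewrite sg_sym xy in np.
case: (Hp _ _ nxy xy) => -[ex ey]; subst x y; move: fxy; rewrite f2p f2p'.
  by rewrite (negPf nq).
by rewrite sg_sym (negPf nq).
Qed.

End Transport.

(** * Bell graphs with a partition adjacent to all others *)

Section Type1.
Variables (G : sgraph) (k : nat).
Local Notation h := (@nonedge G).
Local Notation B := (bell_geq G k).
Local Notation H := (compl G).
Implicit Types (P O W X Y Z T : B) (a b c d x y z s : G).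

Definition dominating O := forall P, P <> O -> O -- P.

Lemma agree_off_adj P P' v : P <> P' -> agree_off v (rl P) (rl P') -> P -- P'.
Proof. by move=> n a; apply/adjP; split=> //; exists v. Qed.

Lemma classes_max P : #|G| <= classes (rl P) -> is_zero P.
Proof.
move=> le; have ar := rl_admissible P.
have [//|[v nv]] := nonzero_rel ar.
have := classes_le (admissible_out v ar).1; rewrite classes_out //; lia.
Qed.

(** Isolating a vertex of a nontrivial part of [P] gives at least [k + 1 = n] classes, hence the
    finest partition, in one move. *)
Lemma dominating_of_k O : is_zero O -> k + 1 = #|G| -> dominating O.
Proof.
move=> zO kn P nPO; have ar := rl_admissible P.
have [e|[v nv]] := nonzero_rel ar.
  by case: nPO; apply: rl_inj => x y; rewrite e zO.
have [Y [eY cY]] := out_ex P v.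
have zY : is_zero Y.
  apply: classes_max; rewrite (negPf nv) addn0 in cY; rewrite cY -kn leq_add2r.
  exact: rl_ge.
apply: (agree_off_adj (v := v)); first exact: nesym.
by move=> x y xv yv; rewrite zO -zY eY mv_off.
Qed.

(** Every edge of H contains [s], so off [s] every relation is equality and any two partitions
    differ only at [s]. *)
Lemma star_all_adjacent s : @star_at H s -> all_adjacent B.
Proof.
move=> [_ st] P P' n; apply: (agree_off_adj (v := s)) => // x y xs ys.
have F (R : B) : rl R x y = (x == y).
  apply/idP/eqP => [rxy|->]; last exact: rl_refl.
  apply/eqP/negPn/negP => nxy; case: (st _ _ (rl_h rxy nxy)) => e.
    by rewrite e eqxx in xs.
  by rewrite e eqxx in ys.
by rewrite !F.
Qed.

Section Zero.
Variables (O : B) (b : line H -> B).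
Hypotheses (zO : is_zero O) (bm : nbhd_map O b).

Lemma map_neq0 e : b e <> O.
Proof. by have [_ Q _ _] := bm; apply/nesym/adj_neq. Qed.

Lemma dominating_cases : dominating O -> forall P, P = O \/ exists e, P = b e.
Proof.
move=> t1 P; have [_ _ on _] := bm.
have [->|/eqP n] := eqVneq P O; first by left.
by right; have [e <-] := on P (t1 _ n); exists e.
Qed.

Lemma dominating_card : dominating O -> #|B| = #|line H| + 1.
Proof.
move=> t1; have [bI _ _ _] := bm.
have -> : #|B| = #|O |: [set b e | e : line H]|.
  rewrite -cardsT; apply: eq_card => P; rewrite !inE; apply/esym/orP.
  have [->|[e ->]] := dominating_cases t1 P; first by left.
  by right; apply: imset_f.
rewrite cardsU1 card_imset // addnC; congr (_ + _).
suff -> : O \notin [set b e | e : line H] by [].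
by apply/imsetP => -[e _ eO]; apply: (@map_neq0 e).
Qed.

Lemma dominating_all_adjacent : dominating O -> (forall e f : line H, e <> f -> e -- f) ->
  all_adjacent B.
Proof.
move=> t1 L P P' n; have [bI _ _ bE] := bm.
have [eP|[e eP]] := dominating_cases t1 P; have [eP'|[f eP']] := dominating_cases t1 P';
  subst P P'.
- by case: n.
- by apply: t1; apply: nesym.
- by rewrite sg_sym; apply: t1.
by rewrite bE; apply: L => ef; apply: n; rewrite ef.
Qed.

Lemma all_adjacent_lines : all_adjacent B -> forall e f : line H, e <> f -> e -- f.
Proof. by move=> aB e f n; have [bI _ _ bE] := bm; rewrite -bE; apply: aB => /bI. Qed.

End Zero.

Lemma zero_data : k + 1 <= #|G| -> exists (O : B) (b : line H -> B),
  [/\ is_zero O, nbhd_map O b &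
    forall e x y, val e = [set x; y] -> h x y -> rl (b e) =2 erel x y].
Proof.
move=> kn; have [|O zO] := @zero_ex G k; first lia.
by have [b [bm bs]] := zero_map kn zO; exists O, b.
Qed.

Lemma lines_triangle a b c : @triangle_on H a b c ->
  forall e f : line H, e <> f -> e -- f.
Proof.
move=> /triangle_lines[e1 [e2 [e3 [E1 E2 E3 _ on]]]] e f n.
have sh (g g' : line H) x : g <> g' -> x \in val g -> x \in val g' -> g -- g'.
  exact: line_adj.
move: (on e) (on f); rewrite !inE.
case/or3P=> /eqP ee; case/or3P=> /eqP ef; subst e f; try (by case: n).
all: first [apply: (sh _ _ a) => //; by rewrite ?E1 ?E2 ?E3 !inE eqxx ?orbT
  |apply: (sh _ _ b) => //; by rewrite ?E1 ?E2 ?E3 !inE eqxx ?orbT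
  |apply: (sh _ _ c) => //; by rewrite ?E1 ?E2 ?E3 !inE eqxx ?orbT].
Qed.

(** Three pairwise meeting edges that are no star form a triangle, and an edge leaving it would need
    its other end on all three sides. If all triples are stars, the common vertex of two edges lies
    on every edge. *)
Lemma lines_star_or_triangle : (exists e : line H, true) ->
  (forall e f : line H, e <> f -> e -- f) ->
  (exists s, @star_at H s) \/ exists a b c, @triangle_on H a b c.
Proof.
move=> [e0 _] L.
case: (pickP (fun t : line H * line H * line H => [&& t.1.1 != t.1.2, t.1.1 != t.2,
   t.1.2 != t.2 & ~~ star t.1.1 t.1.2 t.2])) => [[[e1 e2] e3]|no].
  move=> /and4P[/eqP n12 /eqP n13 /eqP n23 ns]; right.
  have [a [b [c [E1 E2 E3 [ab ac bc]]]]] :=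
    nonstar_triangle (L _ _ n12) (L _ _ n13) (L _ _ n23) ns.
  have [nab nac nbc] := And3 (edge_neq ab) (edge_neq ac) (edge_neq bc).
  exists a, b, c; split=> // x y xy; have [g gE] := ex_edge xy.
  have xg : x \in val g by rewrite gE !inE eqxx.
  apply/negPn/negP => nx.
  have meet (e : line H) u v : val e = [set u; v] -> u \in [:: a; b; c] ->
      v \in [:: a; b; c] -> y \in val e.
    move=> eE uT vT; have nge : g <> e.
      move=> ge; case/negP: nx; move: xg; rewrite ge eE => /set2P[] ->; rewrite ?uT ?vT //.
    have /line_adjP[_ [z [zg ze]]] := L _ _ nge.
    move: zg; rewrite gE => /set2P[] ez; subst z; last by [].
    by case/negP: nx; move: ze; rewrite eE => /set2P[] ->.
  have y1 : y \in val e1 by apply: meet E1 _ _; rewrite !inE eqxx ?orbT.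
  have y2 : y \in val e2 by apply: meet E2 _ _; rewrite !inE eqxx ?orbT.
  have y3 : y \in val e3 by apply: meet E3 _ _; rewrite !inE eqxx ?orbT.
  by case/negP: ns; apply/starP; exists y.
left; have [x0 [y0 [xy0 E0]]] := edge_ends e0.
case: (pickP (fun e : line H => e != e0)) => [e1 /eqP n10|one]; last first.
  exists x0; split; first by exists y0.
  move=> x y xy; have [g gE] := ex_edge xy; have /negbFE/eqP ge := one g.
  have : x0 \in val g by rewrite ge E0 !inE eqxx.
  by rewrite gE => /set2P[] ->; auto.
have /line_adjP[_ [s [s1 s0]]] := L _ _ n10.
have [w [sw _]] := edge_at s0.
exists s; split; first by exists w.
move=> x y xy; have [g gE] := ex_edge xy.
suff : s \in val g by rewrite gE => /set2P[] ->; auto.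
have [->//|/eqP ng0] := eqVneq g e0; have [->//|/eqP ng1] := eqVneq g e1.
have := no (e1, e0, g); rewrite [(_, _, _).1.1]/= [(_, _, _).1.2]/= [(_, _, _).2]/=.
move/eqP: (n10) => ->; move/nesym/eqP: ng0 => -> /=;
  move/nesym/eqP: ng1 => -> /= /negbFE/starP[t [t1 t0 tg]].
by rewrite (line_share (L _ _ n10) s1 s0 t1 t0).
Qed.

Lemma edges_of_incomplete : ~~ is_complete G -> exists e : line H, true.
Proof.
rewrite negb_forall => /existsP[x]; rewrite negb_forall => /existsP[y].
rewrite negb_imply => /andP[xy nxy].
have [|e _] := @ex_edge H x y; first by rewrite /= xy.
by exists e.
Qed.

(** As soon as [k <= n - 2], two disjoint edges or a triangle of H give a partition at distance two;
    without these H is a star. *)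
Lemma dominating_star O : k + 2 <= #|G| -> is_zero O -> dominating O ->
  (exists e : line H, true) -> exists s, @star_at H s.
Proof.
move=> kn zO t1 ne; have kn1 : k + 1 <= #|G| by lia.
have [b [bm bs]] := zero_map kn1 zO; have [bI Q on bE] := bm.
have far W : W <> O -> ~~ (O -- W) -> False by move=> /t1 ->.
have L (e f : line H) : e <> f -> e -- f.
  move=> n; apply/negPn/negP => nef.
  have [||W [_ _ WO nW]] := zl_ex (zero_like_zero kn zO) (Q e) (Q f).
  - by move/bI.
  - by rewrite bE.
  exact: far nW.
have [//|[x [y [z [xy xz yz on3]]]]] := lines_star_or_triangle ne L.
have [e1 E1] := @ex_edge H x y xy; have [e2 E2] := @ex_edge H y z yz.
have [e3 E3] := @ex_edge H x z xz.
have [W [WO nW _ _ _]] := zero_triangle kn zO xy yz xz (bs _ _ _ E1 xy) (bs _ _ _ E2 yz) (bs _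
  _ _ E3 xz).
by case: (far W).
Qed.

(* A universal vertex other than the finest partition is an edge; partitions of
   rank at least two then exist only if the complement is a triangle. *)
Lemma universal_triangle O Q : k + 2 <= #|G| -> is_zero O -> dominating Q -> ~ dominating O ->
  exists a b c, @triangle_on H a b c.
Proof.
move=> kn zO uQ nt1; have kn1 : k + 1 <= #|G| by lia.
have [W WO nW] : exists2 W, W <> O & ~~ (O -- W).
  case: (pickP (fun W => (W != O) && ~~ (O -- W))) => [W /andP[/eqP ? ?]|no].
    by exists W.
  case: nt1 => P /eqP nPO; have := no P; by rewrite nPO /= => /negbFE.
have QO : Q <> O by move=> e; subst Q; case/negP: nW; apply: uQ.
have OQ : O -- Q by rewrite sg_sym; apply: uQ; apply: nesym.
have /(zero_adjP _ zO)[a [b [ab eQ]]] := OQ.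
have nab := h_neq ab.
have QW : Q -- W by apply: uQ => e; subst W; rewrite OQ in nW.
(* An edge disjoint from [ab] is a partition that is not adjacent to [Q]. *)
have meet c d : h c d -> c <> a -> c <> b -> d <> a -> d <> b -> False.
  move=> cd ca cb da db; have [Y [eY _]] := edge_ex kn1 cd.
  have ncd := h_neq cd.
  have nQY : ~~ (Q -- Y).
    by apply: (@nadj2 G k _ _ a b c d); try neqs; rewrite eQ eY /erel; deq.
  case/negP: nQY; apply: uQ; apply: (@rl_neq G k _ _ c d).
  by rewrite eQ eY /erel; deq.
have [[c [ca cb eW]]|[c [d [cd /andP[/eqP ca /eqP cb] /andP[/eqP da /eqP db] _]]]] :=
  zero_dist2 zO ab eQ WO nW QW; last first.
  by case: (meet c d).
have ac : h a c by apply: (@rl_h G k W); rewrite ?eW /trel ?eqxx ?orbT // eq_sym.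
have bc : h b c by apply: (@rl_h G k W); rewrite ?eW /trel ?eqxx ?orbT // eq_sym.
(* For an edge [ud] leaving the triangle at an end [u] of [ab], the matching of [ud] and [vc] is a
   partition not adjacent to [Q]. An edge leaving at [c] is disjoint from [ab] and already
   excluded. *)
have no u v d : (u = a /\ v = b) \/ (u = b /\ v = a) -> h u d ->
    d != a -> d != b -> d != c -> False.
  move=> uv ud da db dc.
  have [nuv nuc nvc nud nvd] : [/\ u != v, u != c, v != c, u != d & v != d].
    by case: uv => -[-> ->]; split; rewrite // eq_sym.
  have vc : h v c by case: uv => -[_ ->].
  have eQ' : rl Q =2 erel u v.
    by case: uv => -[-> ->] // x y; rewrite eQ erelC.
  have [X1 [e1 _]] := edge_ex kn1 ud; have [X2 [e2 _]] := edge_ex kn1 vc.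
  have O1 : O -- X1 by apply/(zero_adjP _ zO); exists u, d.
  have O2 : O -- X2 by apply/(zero_adjP _ zO); exists v, c.
  have n12 : X1 <> X2 by apply: (@rl_neq G k _ _ u d); rewrite e1 e2 /erel; deq.
  have na12 : ~~ (X1 -- X2).
    apply: (@nadj2 G k _ _ u d v c); try (by apply/eqP; rewrite // eq_sym);
    by rewrite e1 e2 /erel; deq.
  have [T [T1 T2 TO nT]] := zl_ex (zero_like_zero kn zO) O1 O2 n12 na12.
  have eT := zero_dist2_matching zO ud vc e1 e2 n12 na12 TO nT T1 T2.
  have nQT : ~~ (Q -- T).
    apply: (@nadj2 G k _ _ u d v c); try (by apply/eqP; rewrite // eq_sym);
    by rewrite eQ' eT /e2rel /erel; deq.
  case/negP: nQT; apply: uQ; apply: (@rl_neq G k _ _ u d).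
  by rewrite eQ' eT /e2rel /erel; deq.
exists a, b, c; split=> // x y xy; apply/negPn/negP.
rewrite !inE !negb_or => /and3P[xa xb xc].
have yx : h y x by rewrite h_sym.
have [ya|/eqP ya] := eqVneq y a; first by subst y; apply: (no a b x) => //; left.
have [yb|/eqP yb] := eqVneq y b; first by subst y; apply: (no b a x) => //; right.
by apply: (meet x y) => //; apply/eqP.
Qed.

Lemma paw_lines a b c d : @paw_on H a b c d -> exists e1 e2 e3 e4 : line H,
  [/\ [/\ val e1 = [set a; b], val e2 = [set a; c], val e3 = [set b; c] & val e4 = [set a; d]],
      uniq [:: e1; e2; e3; e4], forall e, e \in [:: e1; e2; e3; e4] & ~~ (e3 -- e4)].
Proof.
move=> [[ab ac bc] ad dT on].
have [nab nac nbc] := And3 (edge_neq ab) (edge_neq ac) (edge_neq bc).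
have nad := edge_neq ad.
have := dT; rewrite !inE !negb_or => /and3P[nda ndb ndc].
have [e1 E1] := ex_edge ab; have [e2 E2] := ex_edge ac; have [e3 E3] := ex_edge bc.
have [e4 E4] := ex_edge ad.
exists e1, e2, e3, e4; split=> //.
- have sep (e f : line H) x u v : x \in val e -> val f = [set u; v] -> x != u -> x != v ->
      (e == f) = false.
    move=> xe fE xu xv; apply/eqP => ef; move: xe.
    by rewrite ef fE !inE (negPf xu) (negPf xv).
  have [nba nca ncb] : [/\ b != a, c != a & c != b] by rewrite ![_ == a]eq_sym ![c == b]eq_sym.
  have nbd : b != d by rewrite eq_sym.
  have ncd : c != d by rewrite eq_sym.
  have [b1 a1 c2] : [/\ b \in val e1, a \in val e1 & c \in val e2].
    by rewrite E1 E2 !inE !eqxx ?orbT.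
  have [a2 b3] : a \in val e2 /\ b \in val e3 by rewrite E2 E3 !inE !eqxx ?orbT.
  by rewrite /= !inE (sep _ _ _ _ _ b1 E2) // (sep _ _ _ _ _ a1 E3) //
    (sep _ _ _ _ _ b1 E4) // (sep _ _ _ _ _ a2 E3) // (sep _ _ _ _ _ c2 E4) //
    (sep _ _ _ _ _ b3 E4).
- move=> e; have [x [y [xy eE]]] := edge_ends e.
  have nxy := edge_neq xy; rewrite !inE -!val_eqE /= eE E1 E2 E3 E4.
  case: (on _ _ xy) => [/andP[]|[-> ->]|[-> ->]]; rewrite ?eqxx ?orbT //.
    rewrite !inE => /or3P[]/eqP ex; case/or3P=> /eqP ey; subst x y;
    rewrite ?eqxx // in nxy *; rewrite ?eqxx ?orbT //;
    by rewrite setUC eqxx ?orbT.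
  by rewrite [in X in _ || X]setUC ?eqxx ?orbT // [[set d; a]]setUC eqxx !orbT.
apply/negP => /line_adjP[_ [x []]]; rewrite E3 E4 !inE => /orP[]/eqP->; deq.
Qed.

(** The vertices are the finest partition and the four edges of the paw, of which only [bc] and the
    pendant [ad] are disjoint. *)
Lemma paw_one_nonedge O a b c d : k + 1 <= #|G| -> is_zero O -> dominating O ->
  @paw_on H a b c d -> one_nonedge B /\ #|B| = 5.
Proof.
move=> kn zO t1 paw; have [m [bm _]] := zero_map kn zO.
have [e1 [e2 [e3 [e4 [[E1 E2 E3 E4] u4 on n34]]]]] := paw_lines paw.
have [bI Q _ bE] := bm.
split; last by rewrite (dominating_card bm t1) (card_seq u4 on).
have n34' : e3 <> e4.
  by have := u4; rewrite !cons_uniq => /and4P[_ _ + _]; rewrite inE => /eqP.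
exists (m e3), (m e4); split; first by move/bI.
  by rewrite bE.
move=> P P' n nPP; have [eP|[e eP]] := dominating_cases bm t1 P; subst P.
  by rewrite t1 // in nPP; apply: nesym.
have [eP'|[f eP']] := dominating_cases bm t1 P'; subst P'.
  by rewrite sg_sym t1 // in nPP.
have ef : e <> f by move=> e0; apply: n; rewrite e0.
rewrite bE in nPP.
have sh x : x \in val e -> x \in val f -> False.
  by move=> xe xf; case/negP: nPP; apply: line_adj xe xf.
have sa := sh a; have sb := sh b; have sc := sh c.
move: (on e) (on f) sa sb sc; rewrite !inE.
case/or4P=> /eqP ee; case/or4P=> /eqP ff; subst e f; rewrite ?E1 ?E2 ?E3 ?E4 !inE !eqxx ?orbT;
move=> sa sb sc; try (by case: ef); try (by case: (sa isT isT)); try (by case: (sb isT isT));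
try (by case: (sc isT isT)); auto.
Qed.

(** The five vertices are the finest partition, the three sides and the joined triangle; only the
    first and the last are nonadjacent. The paw with [k = n - 1] gives the same [K_5] minus an edge,
    which is the source of the eighth condition. *)
Lemma triangle_one_nonedge a b c : k + 2 <= #|G| -> @triangle_on H a b c ->
  one_nonedge B /\ #|B| = 5.
Proof.
move=> kn tri; have [|O [m [zO bm bs]]] := zero_data; first lia.
have [e1 [e2 [e3 [E1 E2 E3 u3 on]]]] := triangle_lines tri.
have L := lines_triangle tri.
have [ab ac bc on3] := tri; have [bI Q onb bE] := bm.
have [nab nac nbc] := And3 (h_neq ab) (h_neq ac) (h_neq bc).
have E1' : val e1 = [set b; a] by rewrite E1 setUC.
have ba : h b a by rewrite h_sym.
have [T [TO nT T1 T2 T3]] := zero_triangle kn zO ba ac bc (bs _ _ _ E1' ba) (bs _ _ _ E2 ac)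
  (bs _ _ _ E3 bc).
have inT (P : B) x y : rl P x y -> x <> y -> x \in [:: a; b; c] /\ y \in [:: a; b; c].
  move=> r /eqP n; split; first exact: on3 (rl_h r n).
  apply: (on3 _ x); apply: (@rl_h G k P); by rewrite 1?rl_sym // eq_sym.
have full (P : B) : P <> O -> ~~ (O -- P) -> [/\ rl P a b, rl P a c & rl P b c].
  move=> PO nP.
  (* If [P] misses the side [uv], every pair it joins contains the third vertex [w], and [P] is
     adjacent to [O]. *)
  have key u v w : rl P u v = false ->
    (forall x, x \in [:: a; b; c] -> [\/ x = u, x = v | x = w]) -> False.
    move=> uvF cv; case/negP: nP; apply: (agree_off_adj (v := w)); first exact: nesym.
    move=> x y xw yw; rewrite zO; apply/eqP/idP => [->|r]; first exact: rl_refl.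
    apply/eqP/negPn/negP => /eqP n; have [xT yT] := inT _ _ _ r n.
    have vuF : rl P v u = false by rewrite rl_sym.
    case: (cv _ xT) => ex; case: (cv _ yT) => ey; subst x y; rewrite ?eqxx // in xw yw;
    by rewrite ?uvF ?vuF in r; case: n.
  split; apply/negPn/negP => /negPf F.
  - by apply: (key a b c) => // x; rewrite !inE => /or3P[]/eqP->;
    [constructor 1|constructor 2|constructor 3].
  - by apply: (key a c b) => // x; rewrite !inE => /or3P[]/eqP->;
    [constructor 1|constructor 3|constructor 2].
  by apply: (key b c a) => // x; rewrite !inE => /or3P[]/eqP->;
    [constructor 3|constructor 1|constructor 2].
have fullE (P : B) : P <> O -> ~~ (O -- P) -> rl P =2 trel a b c.
  move=> PO nP x y; have [ab' ac' bc'] := full P PO nP.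
  have ba' : rl P b a by rewrite rl_sym.
  have ca' : rl P c a by rewrite rl_sym.
  have cb' : rl P c b by rewrite rl_sym.
  rewrite /trel; have [->|/eqP n] := eqVneq x y; first by rewrite rl_refl.
  apply/idP/andP => [r|[]].
    by have [] := inT _ _ _ r n; rewrite !inE.
  by case/or3P=> /eqP->; case/or3P=> /eqP->; rewrite ?rl_refl.
have onlyT (P : B) : P <> O -> ~~ (O -- P) -> P = T.
  by move=> PO nP; apply: rl_inj => x y; rewrite !fullE.
have cases (P : B) : [\/ P = O, P = T | exists e, P = m e].
  have [->|/eqP nPO] := eqVneq P O; first by constructor 1.
  case: (boolP (O -- P)) => [/onb[e <-]|nP]; first by constructor 3; exists e.
  by constructor 2; apply: onlyT.
have mT e : m e -- T.
  move: (on e); rewrite !inE => /or3P[]/eqP->; [exact: T1|exact: T2|exact: T3].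
split.
  exists O, T; split; [exact: nesym|exact: nT|].
  move=> x y n nxy; have [ex|ex|[e ex]] := cases x; have [ey|ey|[f ey]] := cases y; subst x y.
  - by [].
  - by left.
  - by rewrite Q in nxy.
  - by right.
  - by [].
  - by rewrite sg_sym mT in nxy.
  - by rewrite sg_sym Q in nxy.
  - by rewrite mT in nxy.
  by rewrite bE L // in nxy => ef; apply: n; rewrite ef.
have -> : 5 = size (O :: T :: map m [:: e1; e2; e3]) by [].
apply: card_seq.
  rewrite cons_uniq cons_uniq map_inj_uniq // u3 andbT inE negb_or -andbA.
  apply/and3P; split; first exact/eqP/nesym.
    by apply/mapP => -[e _ eO]; have := Q e; rewrite -eO sg_irrefl.
  by apply/mapP => -[e _ eT]; have := mT e; rewrite -eT sg_irrefl.
move=> P; have [->|->|[e ->]] := cases P; first exact: mem_head.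
  by rewrite in_cons mem_head orbT.
have me := map_f m (on e).
apply: (@mem_behead _ [:: O, T & map m [:: e1; e2; e3]]).
exact: (@mem_behead _ (T :: map m [:: e1; e2; e3])).
Qed.

(** H has four edges, of which only [e] and [f] are disjoint. Each of [g] and [g'] joins an end of
    [e] to an end of [f]; as they meet, one of [e] and [f] closes a triangle with them and the other
    is pendant. *)
Lemma one_nonedge_paw O : k + 1 <= #|G| -> is_zero O -> dominating O ->
  one_nonedge B -> #|B| = 5 -> exists a b c d, @paw_on H a b c d.
Proof.
move=> kn zO t1 [p [p' [npp np H0]]] c5; have [m [bm _]] := zero_map kn zO.
have [bI Q _ bE] := bm.
have c4 : #|line H| = 4 by move: c5; rewrite (dominating_card bm t1); lia.
have [e pe] : exists e, p = m e.
  have [e|//] := dominating_cases bm t1 p; case/negP: np; rewrite e; apply: t1.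
  by move=> e'; apply: npp; rewrite e e'.
have [f pf] : exists f, p' = m f.
  have [e'|//] := dominating_cases bm t1 p'; case/negP: np; rewrite e' sg_sym; apply: t1.
  by move=> e''; apply: npp; rewrite e' e''.
subst p p'; rewrite bE in np.
have nef : e <> f by move=> e0; apply: npp; rewrite e0.
have adj (g g' : line H) : g <> g' -> g <> e \/ g' <> f -> g <> f \/ g' <> e -> g -- g'.
  move=> n n1 n2; apply/negPn/negP => ng.
  have [||[/bI ? /bI ?]|[/bI ? /bI ?]] := H0 (m g) (m g').
  - by move/bI.
  - by rewrite bE.
  - by case: n1.
  by case: n2.
have more (l : seq (line H)) : uniq l -> size l < 4 -> exists g, g \notin l.
  move=> ul sl; case: (pickP (fun g => g \notin l)) => [g gl|all]; first by exists g.
  have := card_seq ul (fun t => negbFE (all t)); rewrite c4 => e0.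
  by rewrite -e0 ltnn in sl.
have [|//|g ng] := more [:: e; f]; first by rewrite /= inE andbT; apply/eqP.
have := ng; rewrite !inE negb_or => /andP[/eqP ge /eqP gf].
have [|//|g' ng'] := more [:: g; e; f].
  by rewrite cons_uniq ng /= inE andbT; apply/eqP.
have := ng'; rewrite !inE !negb_or => /and3P[/eqP g'g /eqP g'e /eqP g'f].
have u4 : uniq [:: g'; g; e; f].
  by rewrite cons_uniq ng' cons_uniq ng /= inE andbT; apply/eqP.
have all4 t : t \in [:: g'; g; e; f].
  by apply: uniq_full u4 _ t; rewrite c4.
have /line_adjP[_ [x [xg xe]]] : g -- e by apply: adj; auto.
have /line_adjP[_ [z [zg zf]]] : g -- f by apply: adj; auto.
have [y [xy eE]] := edge_at xe; have [w [zw fE]] := edge_at zf.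
have dis t : t \in val e -> t \in val f -> False.
  by move=> te tf; case/negP: np; apply: line_adj nef te tf.
have [nxy nzw] := (edge_neq xy, edge_neq zw).
have ye : y \in val e by rewrite eE !inE eqxx orbT.
have wf : w \in val f by rewrite fE !inE eqxx orbT.
have nxz : x != z by apply/eqP => e0; apply: (dis x); rewrite // e0.
have nxw : x != w by apply/eqP => e0; apply: (dis x); rewrite // e0.
have nyz : y != z by apply/eqP => e0; apply: (dis y); rewrite // e0.
have nyw : y != w by apply/eqP => e0; apply: (dis y); rewrite // e0.
have gE := edge_eq2 xg zg nxz.
have edge_adj (t : line H) u v : val t = [set u; v] -> u != v -> u -- v.
  move=> tE n; have ut : u \in val t by rewrite tE !inE eqxx.
  have [r [ur tr]] := edge_at ut; move: tr; rewrite tE => /setP/(_ v).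
  by rewrite !inE eqxx orbT eq_sym (negPf n) => /esym/eqP->.
have build u v r q (g1 g2 g3 g4 : line H) : val g1 = [set u; v] -> val g2 = [set u; r] ->
    val g3 = [set v; r] -> val g4 = [set u; q] ->
    u != v -> u != r -> v != r -> q != u -> q != v -> q != r ->
    (forall t, t \in [:: g1; g2; g3; g4]) -> @paw_on H u v r q.
  move=> G1 G2 G3 G4 nuv nur nvr nqu nqv nqr on4; split.
  - by split; [exact: edge_adj G1 nuv|exact: edge_adj G2 nur|exact: edge_adj G3 nvr].
  - by apply: edge_adj G4 _; rewrite eq_sym.
  - by rewrite !inE !negb_or nqu nqv nqr.
  move=> s t st; have [i iE] := ex_edge st; have nst := edge_neq st.
  move: (on4 i); rewrite !inE => /or4P[]/eqP ei; subst i.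
  - by have [[-> ->]|[-> ->]] := set2_eq nst (etrans (esym iE) G1); constructor 1;
    rewrite !eqxx ?orbT.
  - by have [[-> ->]|[-> ->]] := set2_eq nst (etrans (esym iE) G2); constructor 1;
    rewrite !eqxx ?orbT.
  - by have [[-> ->]|[-> ->]] := set2_eq nst (etrans (esym iE) G3); constructor 1;
    rewrite !eqxx ?orbT.
  by have [[-> ->]|[-> ->]] := set2_eq nst (etrans (esym iE) G4); [constructor 2|constructor 3].
have perm4 i l : l = [:: g; g'; e; f] \/ l = [:: g; g'; f; e] -> i \in l.
  move=> ll; have := all4 i; rewrite !inE.
  by case: ll => ->; rewrite !inE => /or4P[]->; rewrite ?orbT.
have /line_adjP[_ [s [sg' se]]] : g' -- e by apply: adj; auto.
have /line_adjP[_ [t [tg' tf]]] : g' -- f by apply: adj; auto.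
have nst : s != t by apply/eqP => e0; apply: (dis s); rewrite // e0.
have g'E := edge_eq2 sg' tg' nst.
have /line_adjP[_ [r [rg' rg]]] : g' -- g by apply: adj; auto.
have neq' : val g' <> val g by move=> e0; apply: g'g; apply: val_inj.
move: se tf; rewrite eE fE !inE => /orP[]/eqP es /orP[]/eqP et; subst s t.
- by case: neq'; rewrite g'E gE.
- exists x, z, w, y.
  apply: (build _ _ _ _ g g' f e gE g'E fE eE nxz nxw nzw _ nyz nyw); first by rewrite eq_sym.
  by move=> i; apply: (perm4 i); right.
- exists z, x, y, w.
  have gE' : val g = [set z; x] by rewrite gE setUC.
  have g'E' : val g' = [set z; y] by rewrite g'E setUC.
  have [nzx nzy] : z != x /\ z != y by rewrite ![z == _]eq_sym.
  have [nwz nwx nwy] : [/\ w != z, w != x & w != y] by rewrite ![w == _]eq_sym.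
  apply: (build _ _ _ _ g g' e f gE' g'E' eE fE nzx nzy nxy nwz nwx nwy).
  by move=> i; apply: (perm4 i); left.
move: rg' rg; rewrite g'E gE !inE => /orP[]/eqP-> /orP[]/eqP e0; subst;
by rewrite ?eqxx // in nxy nyz nxw nzw *.
Qed.

End Type1.

Lemma card1_eq (T : finType) : #|T| = 1 -> forall x y : T, x = y.
Proof. by move=> /eqP/fintype1P[z zE] x y; rewrite (zE x) (zE y). Qed.

(** * What each condition of the theorem says about a single graph *)

Section Sides.
Variables (G : sgraph) (k : nat).
Local Notation B := (bell_geq G k).

Lemma bell_empty : #|G| < k <-> #|B| = 0.
Proof.
split=> [nk|c0].
  apply/eqP; rewrite -leqn0 leqNgt; apply/negP => /card_gt0P[P _].
  by have := leq_trans (rl_ge P) (classes_le (rl_eqv P)); rewrite leqNgt nk.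
rewrite ltnNge; apply/negP => /zero_ex[O _].
by have := card0_eq c0 O; rewrite inE.
Qed.

(** A second vertex appears as soon as [k < n] and H has an edge, since that edge is itself a
    partition with [n - 1] parts. *)
Lemma bell_singleton : (k = #|G| \/ (k <= #|G| /\ is_complete G)) <-> #|B| = 1.
Proof.
split=> [H|c1].
  have kn : k <= #|G| by case: H => [->|[]].
  have [O zO] := zero_ex kn.
  have only P : P = O.
    apply: rl_inj => x y; rewrite zO; case: H => [kE|[_ /forallP cG]].
      by apply: classes_max; rewrite -kE; apply: rl_ge.
    apply/idP/eqP => [r|->]; last exact: rl_refl.
    apply/eqP/negPn/negP => n; have /andP[_] := rl_h r n.
    by have /forallP/(_ y)/implyP/(_ n) := cG x => ->.
  by rewrite -(cards1 O) -cardsT; apply: eq_card => P; rewrite !inE (only P) eqxx.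
have kn : k <= #|G|.
  by rewrite leqNgt; apply/negP => /bell_empty; rewrite c1.
case: (eqVneq k #|G|) => [|nk]; first by left.
right; split=> //; apply/negPn/negP => nc.
have kn1 : k + 1 <= #|G| by rewrite addn1 ltn_neqAle nk.
have [O [b [zO bm _]]] := zero_data kn1; have [e _] := edges_of_incomplete nc.
exact: map_neq0 bm e (card1_eq c1 _ _).
Qed.

(** When H is a star, a partition joins at most one edge, so its number of parts is [n] or [n - 1]
    and the value of [k] below [n] does not matter. *)
Lemma star_side m : k + 1 <= #|G| ->
  del_universal G ~= dunion (complete m) (complete 1) ->
  all_adjacent B /\ #|B| = m + 1.
Proof.
move=> kn /del_universal_iff/core_star[s [st <-]].
have [O [b [zO bm _]]] := zero_data kn; have aB := @star_all_adjacent G k s st.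
split=> //; rewrite -(card_line_star st); apply: dominating_card bm _.
by move=> P n; apply: aB; apply: nesym.
Qed.

Lemma triangle_side : k + 1 = #|G| -> del_universal G ~= compl (complete 3) ->
  all_adjacent B /\ #|B| = 4.
Proof.
move=> kn /del_universal_iff/core_triangle[x [y [z tri]]].
have kn1 : k + 1 <= #|G| by rewrite kn.
have [O [b [zO bm _]]] := zero_data kn1.
have t1 := dominating_of_k zO kn; split.
  by apply: dominating_all_adjacent bm t1 _; apply: lines_triangle tri.
rewrite (dominating_card bm t1).
have [e1 [e2 [e3 [_ _ _ u3 on]]]] := triangle_lines tri.
by rewrite (card_seq u3 on).
Qed.

Lemma triangle_side2 : k + 2 <= #|G| -> del_universal G ~= compl (complete 3) ->
  one_nonedge B /\ #|B| = 5.
Proof.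
move=> kn /del_universal_iff/core_triangle[x [y [z tri]]].
exact: triangle_one_nonedge tri.
Qed.

Lemma paw_side : k + 1 = #|G| ->
  del_universal G ~= dunion (path_graph 3) (complete 1) ->
  one_nonedge B /\ #|B| = 5.
Proof.
move=> kn /del_universal_iff/core_paw[x [y [z [w paw]]]].
have kn1 : k + 1 <= #|G| by rewrite kn.
have [O [b [zO bm _]]] := zero_data kn1.
by apply: paw_one_nonedge zO (dominating_of_k zO kn) paw; rewrite kn.
Qed.

(** The line graph is complete, so H is a star or a triangle up to isolated vertices. The triangle
    is possible only for [k = n - 1], as otherwise [dominating_star] applies. *)
Lemma all_adjacent_side : k + 1 <= #|G| -> ~~ is_complete G -> all_adjacent B ->
  del_universal G ~= dunion (complete (#|B| - 1)) (complete 1) \/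
  [/\ k + 1 = #|G|, #|B| = 4 & del_universal G ~= compl (complete 3)].
Proof.
move=> kn nc aB; have [O [b [zO bm _]]] := zero_data kn.
have t1 : dominating O by move=> P n; apply: aB; apply: nesym.
have ne := edges_of_incomplete nc.
have star : (exists s, @star_at (compl G) s) ->
    del_universal G ~= dunion (complete (#|B| - 1)) (complete 1).
  move=> [s st]; apply/del_universal_iff; rewrite (dominating_card bm t1) addnK.
  by rewrite (card_line_star st); apply: star_core.
have [|[x [y [z tri]]]] := lines_star_or_triangle ne (all_adjacent_lines bm aB).
  by left; apply: star.
case: (eqVneq (k + 1) #|G|) => [kE|nk].
  right; have D : del_universal G ~= compl (complete 3).
    by apply/del_universal_iff; apply: triangle_core tri.
  by have [_ c] := triangle_side kE D.
left; apply: star; apply: dominating_star zO t1 ne.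
by clear -kn nk; lia.
Qed.

End Sides.

Lemma swap_universal (B : sgraph) (u v : B) :
    (forall P, P <> u -> u -- P) -> (forall P, P <> v -> v -- P) ->
  exists sw : B -> B, [/\ bijective sw, sw u = v & forall P P', (sw P -- sw P') = (P -- P')].
Proof.
move=> uA vA; pose sw P := if P == u then v else if P == v then u else P.
have swI : involutive sw.
  move=> w; rewrite /sw; have [->|wu] := eqVneq w u.
    by case: (eqVneq v u) => [->|]; rewrite ?eqxx.
  have [->|wv] := eqVneq w v; first by rewrite eqxx.
  by rewrite (negPf wu) (negPf wv).
have univ P : (P == u) || (P == v) -> forall P', P' <> P -> P -- P'.
  by case/orP=> /eqP -> P' n; [apply: uA|apply: vA].
have sw_univ P : ((sw P == u) || (sw P == v)) = ((P == u) || (P == v)).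
  rewrite /sw; have [_|n] := eqVneq P u; first by rewrite eqxx orbT.
  have [_|n'] := eqVneq P v; first by rewrite eqxx.
  by rewrite (negPf n) (negPf n').
exists sw; split; [exact: inv_bij|by rewrite /sw eqxx|move=> P P'].
have [->|/eqP n] := eqVneq P P'; first by rewrite !sg_irrefl.
have nsw : sw P <> sw P' by move/(can_inj swI).
have n' := nesym n; have nsw' := nesym nsw.
have [U|nU] := boolP ((P == u) || (P == v)).
  by rewrite (univ P U P' n') (univ (sw P) _ (sw P') nsw') ?sw_univ.
have [U|nU'] := boolP ((P' == u) || (P' == v)).
  by rewrite sg_sym [RHS]sg_sym (univ P' U P n) (univ (sw P') _ (sw P) nsw) ?sw_univ.
have sid R : ~~ ((R == u) || (R == v)) -> sw R = R.
  by rewrite negb_or /sw => /andP[/negPf-> /negPf->].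
by rewrite !sid.
Qed.

Section Lines.
Variables (G1 G2 : sgraph) (k1 k2 : nat) (O1 : bell_geq G1 k1) (O2 : bell_geq G2 k2).
Hypotheses (kn1 : k1 + 1 <= #|G1|) (kn2 : k2 + 1 <= #|G2|).
Hypotheses (z1 : is_zero O1) (z2 : is_zero O2) (t1 : dominating O1) (t2 : dominating O2).

(** When the finest partition is dominating, the Bell graph is a cone over the line graph with the
    finest partition as apex. *)
Lemma dominating_bell : line (compl G1) ~= line (compl G2) ->
  bell_geq G1 k1 ~= bell_geq G2 k2.
Proof.
move=> /isoP[a [aB aE]]; have [a' aK a'K] := aB.
have [b1 [m1 _]] := zero_map kn1 z1; have [b2 [m2 _]] := zero_map kn2 z2.
have [b1I _ _ b1E] := m1; have [b2I Q2 _ b2E] := m2.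
have ex P : exists P' : bell_geq G2 k2, (P = O1 /\ P' = O2) \/
    exists2 e, P = b1 e & P' = b2 (a e).
  have [->|[e ->]] := dominating_cases m1 t1 P; first by exists O2; left.
  by exists (b2 (a e)); right; exists e.
have [F FE] := fin_all_exists ex.
have F0 : F O1 = O2.
  by case: (FE O1) => [[]//|[e e0 _]]; case: (map_neq0 m1 (e := e)).
have Fb e : F (b1 e) = b2 (a e).
  case: (FE (b1 e)) => [[e0 _]|[e' /b1I -> //]].
  by case: (map_neq0 m1 e0).
apply/isoP; exists F; split.
  apply: bij_of_onto => [P P'|P'].
    have [->|[e ->]] := dominating_cases m1 t1 P;
      have [->|[e' ->]] := dominating_cases m1 t1 P';
    rewrite ?F0 ?Fb // => e0.
    - by case: (map_neq0 m2 (esym e0)).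
    - by case: (map_neq0 m2 e0).
    by congr b1; apply: (can_inj aK); apply: b2I.
  have [->|[e' ->]] := dominating_cases m2 t2 P'; first by exists O1.
  by exists (b1 (a' e')); rewrite Fb a'K.
move=> P P'; have [->|[e ->]] := dominating_cases m1 t1 P;
  have [->|[e' ->]] := dominating_cases m1 t1 P'; rewrite ?F0 ?Fb ?sg_irrefl //.
- rewrite t2; last exact: (map_neq0 m2).
  by rewrite t1 //; exact: (map_neq0 m1).
- rewrite sg_sym t2; last exact: (map_neq0 m2).
  by rewrite sg_sym t1 //; exact: (map_neq0 m1).
by rewrite b2E aE b1E.
Qed.

(* Two universal vertices can be exchanged, so an isomorphism may be assumed to
   preserve the finest partition. *)
Lemma dominating_line : bell_geq G1 k1 ~= bell_geq G2 k2 ->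
  line (compl G1) ~= line (compl G2).
Proof.
move=> /isoP[f [fB fE]]; have [g fK gK] := fB.
have uQ P : P <> f O1 -> f O1 -- P.
  move=> n; rewrite -[P]gK fE; apply: t1 => e; apply: n; by rewrite -e gK.
have [sw [swB sw0 swE]] := swap_universal uQ t2.
have [b1 [m1 _]] := zero_map kn1 z1; have [b2 [m2 _]] := zero_map kn2 z2.
have m2' : nbhd_map ((sw \o f) O1) b2 by rewrite /comp sw0.
have cE x y : ((sw \o f) x -- (sw \o f) y) = (x -- y) by rewrite /comp swE fE.
have [a [aB aE _]] := nbhd_iso (bij_comp swB fB) cE m1 m2'.
by apply/isoP; exists a.
Qed.

End Lines.

Lemma not_dominating (G : sgraph) k (O : bell_geq G k) : is_zero O -> k + 1 <= #|G| ->
  ~ dominating O -> k + 2 <= #|G|.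
Proof.
move=> zO kn nt; case: (eqVneq (k + 1) #|G|) => [kE|nk].
  by case: nt; apply: dominating_of_k zO kE.
by lia.
Qed.

Lemma dominating_dec (G : sgraph) k (O : bell_geq G k) : dominating O \/ ~ dominating O.
Proof.
case: (pickP (fun P => (P != O) && ~~ (O -- P))) => [P /andP[/eqP n nP]|no].
  by right=> t1; rewrite t1 in nP.
left=> P /eqP n; have := no P; by rewrite n /= => /negbFE.
Qed.

(** The image of [O2] dominates the first graph without being its finest partition, so
    [universal_triangle] makes the first graph [K_5] minus an edge. The second then has this shape
    with a dominating finest partition: a star would make it complete, so [k2 = n2 - 1] and its four
    edges form a paw. *)
Lemma one_sided_dominating (G1 G2 : sgraph) k1 k2 (O1 : bell_geq G1 k1) (O2 : bell_geq G2 k2) :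
  k1 + 1 <= #|G1| -> k2 + 1 <= #|G2| -> is_zero O1 -> is_zero O2 ->
  ~~ is_complete G2 ->
  ~ dominating O1 -> dominating O2 -> bell_geq G1 k1 ~= bell_geq G2 k2 ->
  (k1 + 2 <= #|G1| /\ del_universal G1 ~= compl (complete 3)) /\
  (k2 + 1 = #|G2| /\ del_universal G2 ~= dunion (path_graph 3) (complete 1)).
Proof.
move=> kn1 kn2 z1 z2 nc nt1 t2 B12; have kn1' := not_dominating z1 kn1 nt1.
have /iso_sym/isoP[g [gB gE]] := B12.
have uQ : dominating (g O2).
  have [f gK fK] := gB.
  move=> P n; rewrite -[P]fK gE; apply: t2 => e; apply: n; by rewrite -e fK.
have [a [b [c tri]]] := universal_triangle kn1' z1 uQ nt1.
have [on c5] := triangle_one_nonedge kn1' tri.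
split; first by split=> //; apply/del_universal_iff; apply: triangle_core tri.
have on2 := one_nonedge_transport B12 on.
have c52 : #|bell_geq G2 k2| = 5 by rewrite -(iso_card B12).
have kE : k2 + 1 = #|G2|.
  case: (eqVneq (k2 + 1) #|G2|) => // nk.
  have [|s st] := dominating_star _ z2 t2 (edges_of_incomplete nc); first by lia.
  have aB := @star_all_adjacent G2 k2 s st.
  by have [p [p' [n np _]]] := on2; rewrite aB in np.
split=> //; apply/del_universal_iff.
have [x [y [z [w paw]]]] := one_nonedge_paw kn2 z2 t2 on2 c52.
exact: paw_core paw.
Qed.

(** One [N] serves both sides of the sixth condition: by [star_side] each graph is complete on [N]
    vertices, so two different values would not give isomorphic graphs. Writing [k + 1 = n] avoids
    truncated subtraction; in [n1 - k1 = n2 - k2] the bounds beside it prevent truncation. *)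
Theorem theoremA1 (G1 G2 : sgraph) (n1 n2 k1 k2 : nat)
    (card_G1 : #|G1| = n1) (card_G2 : #|G2| = n2) :
  bell_geq G1 k1 ~= bell_geq G2 k2 <->
     (n1 < k1 /\ n2 < k2)
  \/ ((k1 = n1 \/ (k1 <= n1 /\ is_complete G1)) /\
      (k2 = n2 \/ (k2 <= n2 /\ is_complete G2)))
  \/ (claw_graph G1 ~= claw_graph G2 /\ k1 + 1 = n1 /\ k2 + 1 = n2)
  \/ (del_universal G1 ~= del_universal G2 /\
      (chi G1 + 1 <= k1 /\ k1 + 2 <= n1) /\
      (chi G2 + 1 <= k2 /\ k2 + 2 <= n2) /\
      n1 - k1 = n2 - k2)
  \/ (del_universal G1 ~= del_universal G2 /\ k1 <= chi G1 /\ k2 <= chi G2)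
  \/ (exists N : nat,
        (k1 + 1 <= n1 /\ #|bell_geq G1 k1| = N /\
         del_universal G1 ~= dunion (complete (N - 1)) (complete 1)) /\
        (k2 + 1 <= n2 /\ #|bell_geq G2 k2| = N /\
         del_universal G2 ~= dunion (complete (N - 1)) (complete 1)))
  \/ (((k1 + 1 <= n1 /\ del_universal G1 ~= dunion (complete 3) (complete 1)) \/
       (k1 + 1 = n1 /\ del_universal G1 ~= compl (complete 3))) /\
      ((k2 + 1 <= n2 /\ del_universal G2 ~= dunion (complete 3) (complete 1)) \/
       (k2 + 1 = n2 /\ del_universal G2 ~= compl (complete 3))))
  \/ (((k1 + 2 <= n1 /\ del_universal G1 ~= compl (complete 3)) \/
       (k1 + 1 = n1 /\ del_universal G1 ~= dunion (path_graph 3) (complete 1))) /\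
      ((k2 + 2 <= n2 /\ del_universal G2 ~= compl (complete 3)) \/
       (k2 + 1 = n2 /\ del_universal G2 ~= dunion (path_graph 3) (complete 1)))).
Proof.
subst n1 n2; split=> [B12|]; last first.
  case=> [[/bell_empty c1 /bell_empty c2]|].
    apply: all_adjacent_iso; last by rewrite c1 c2.
      by move=> x; have := card0_eq c1 x; rewrite inE.
    by move=> x; have := card0_eq c2 x; rewrite inE.
  case=> [[/bell_singleton c1 /bell_singleton c2]|].
    have one (B : sgraph) : #|B| = 1 -> all_adjacent B.
      by move=> c x y []; apply: card1_eq.
    by apply: all_adjacent_iso; rewrite ?c1 ?c2 //; apply: one.
  case=> [[/claw_graph_line l [kE1 kE2]]|].
    have [|O1 z1] := @zero_ex G1 k1; first by rewrite -kE1 leq_addr.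
    have [|O2 z2] := @zero_ex G2 k2; first by rewrite -kE2 leq_addr.
    apply: (@dominating_bell _ _ _ _ O1 O2) => //; rewrite ?kE1 ?kE2 //; exact: dominating_of_k.
  case=> [[/del_universal_core D [[_ kn1] [[_ kn2] nk]]]|].
    by apply: (bell_iso_same D) => //; [apply: leq_trans kn1|apply: leq_trans kn2]; apply: leq_addr.
  case=> [[/del_universal_core D [kc1 kc2]]|].
    exact: (bell_iso_full D).
  case=> [[N [[kn1 [c1 D1]] [kn2 [c2 D2]]]]|].
    have [a1 _] := star_side kn1 D1; have [a2 _] := star_side kn2 D2.
    by apply: all_adjacent_iso; rewrite ?c1 ?c2.
  case=> [[S1 S2]|[S1 S2]].
    have side (G : sgraph) k :
       (k + 1 <= #|G| /\ del_universal G ~= dunion (complete 3) (complete 1)) \/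
       (k + 1 = #|G| /\ del_universal G ~= compl (complete 3)) ->
       all_adjacent (bell_geq G k) /\ #|bell_geq G k| = 4.
      by case=> -[kn D]; [apply: (star_side kn D)|apply: triangle_side].
    have [a1 c1] := side _ _ S1; have [a2 c2] := side _ _ S2.
    by apply: all_adjacent_iso; rewrite ?c1 ?c2.
  have side (G : sgraph) k : (k + 2 <= #|G| /\ del_universal G ~= compl (complete 3)) \/
       (k + 1 = #|G| /\ del_universal G ~= dunion (path_graph 3) (complete 1)) ->
       one_nonedge (bell_geq G k) /\ #|bell_geq G k| = 5.
    by case=> -[kn D]; [apply: triangle_side2|apply: paw_side].
  have [a1 c1] := side _ _ S1; have [a2 c2] := side _ _ S2.
  by apply: one_nonedge_iso; rewrite ?c1 ?c2.
have c12 := iso_card B12.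
have [nk1|kn1] : #|G1| < k1 \/ k1 <= #|G1| by clear; lia.
  left; split=> //; apply/(bell_empty G2 k2); rewrite -c12.
  exact/bell_empty.
have kn2 : k2 <= #|G2|.
  rewrite leqNgt; apply/negP => /bell_empty; rewrite -c12 => /bell_empty.
  by rewrite ltnNge kn1.
right; have [c1|/eqP nc1] := eqVneq #|bell_geq G1 k1| 1.
  by left; split; [apply (bell_singleton G1 k1)|apply (bell_singleton G2 k2)]; rewrite -?c12.
have nc2 : #|bell_geq G2 k2| <> 1 by rewrite -c12.
right.
have inc (G : sgraph) k : k <= #|G| -> #|bell_geq G k| <> 1 -> k + 1 <= #|G| /\ ~~ is_complete G.
  move=> kn n; split.
    rewrite addn1 ltn_neqAle kn andbT; apply/eqP => e; apply: n.
    by apply/(bell_singleton G k); left.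
  by apply/negP => cG; apply: n; apply/(bell_singleton G k); right.
have [kn1' i1] := inc _ _ kn1 nc1; have [kn2' i2] := inc _ _ kn2 nc2.
have [O1 z1] := zero_ex kn1; have [O2 z2] := zero_ex kn2.
(* The cases are ordered by which finest partitions dominate: both lead to conditions three, six and
   seven, exactly one to condition eight, and none to the reconstruction, with conditions four and
   five. *)
have [t1|nt1] := dominating_dec O1; have [t2|nt2] := dominating_dec O2.
- have [[kE1 kE2]|nk] : (k1 + 1 = #|G1| /\ k2 + 1 = #|G2|) \/
      (k1 + 2 <= #|G1| \/ k2 + 2 <= #|G2|).
    by clear -kn1' kn2'; lia.
    left; split=> //; apply/claw_graph_line.
    exact: (dominating_line kn1' kn2' z1 z2 t1 t2 B12).
  have [a1 a2] : all_adjacent (bell_geq G1 k1) /\ all_adjacent (bell_geq G2 k2).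
    case: nk => nk.
      have [s st] := dominating_star nk z1 t1 (edges_of_incomplete i1).
      have a1 := @star_all_adjacent G1 k1 s st.
      by split=> //; apply: all_adjacent_transport B12 a1.
    have [s st] := dominating_star nk z2 t2 (edges_of_incomplete i2).
    have a2 := @star_all_adjacent G2 k2 s st.
    by split=> //; apply: all_adjacent_transport (iso_sym B12) a2.
  (* Both graphs are complete with equally many vertices. Two stars give condition six; a triangle
     with [k = n - 1] forces four vertices, hence three leaves on a star opposite it, which is
     condition seven. *)
  have D1 := all_adjacent_side kn1' i1 a1; have D2 := all_adjacent_side kn2' i2 a2.
  rewrite -c12 in D2; right; right; right.
  case: D1 D2 => [D1|[kE1 c4 D1]] [D2|[kE2 c4' D2]].
  + by left; exists #|bell_geq G1 k1|.
  + right; left; rewrite c4' in D1; split; [by left|by right].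
  + right; left; rewrite c4 in D2; split; [by right|by left].
  by right; left; split; right.
- have [S2 S1] := one_sided_dominating kn2' kn1' z2 z1 i1 nt2 t1 (iso_sym B12).
  by do 5!right; split; [right|left].
- have [S1 S2] := one_sided_dominating kn1' kn2' z1 z2 i2 nt1 t2 B12.
  by do 5!right; split; [left|right].
have kn1s := not_dominating z1 kn1' nt1; have kn2s := not_dominating z2 kn2' nt2.
have /isoP[f [fB fE]] := B12; have C := bell_core kn1s kn2s fB fE.
have D : del_universal G1 ~= del_universal G2 by apply/del_universal_core.
right; have [[kc1 kc2]|[kc1 kc2 nk]] := bell_parameters C B12 kn1s kn2s.
  by right; left.
by left; rewrite !addn1.
Qed.
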